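(* Let $n\ge 1$ and let $A\subset \mathbb{F}_5^n$ be sum-free, i.e. there are no $a,b,c\in A$ with $a+b=c$. If $|A|>1.2\cdot 5^{n-1}$, then $A$ is normal: there exist a subspace $V<\mathbb{F}_5^n$ of co-dimension $1$ and an element $w\in\mathbb{F}_5^n\setminus V$ such that $A\subset \{2w,3w\}+V$.
   Context: A set $A$ in an abelian group is sum-free if $(A+A)\cap A=\emptyset$. For a prime $p\equiv 2 \pmod 3$ let $m_p=(p+1)/3$; a sum-free set $A\subset\mathbb{F}_p^n$ is called normal if $A\subset\{m_pw,(m_p+1)w,\ldots,(2m_p-1)w\}+V$ for some subspace $V$ of co-dimension $1$ and some $w\notin V$. For $p=5$, $m_5=2$. *)

(* Defs.v *)
From HB Require Import structures.
From mathcomp Require Import all_boot all_order all_algebra.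

Set Implicit Arguments.
Unset Strict Implicit.
Unset Printing Implicit Defensive.

Import GRing.Theory.
Local Open Scope ring_scope.

Definition sumset (G : finZmodType) (A B : {set G}) : {set G} :=
  [set a + b | a in A, b in B].

Definition sum_free (G : finZmodType) (A : {set G}) : Prop :=
  sumset A A :&: A = set0.

(* [m_ p] is (p + 1) / 3 only when p = 2 mod 3, the only case of interest. *)
Definition m_ (p : nat) : nat := (p.+1 %/ 3)%N.

(* The multiples k w for m_p <= k <= 2 m_p - 1, a range of m_p integers. *)
Definition middle_multiples (G : finZmodType) (p : nat) (w : G) : {set G} :=
  [set w *+ (m_ p + i) | i : 'I_(m_ p)].

(* Meant for p prime with p = 2 mod 3: 'F_p has p elements only for p prime.
   Sum-freeness of A is not part of the predicate. *)
Definition normal_set (p n : nat) (A : {set 'rV['F_p]_n}) : Prop :=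
  exists (V : {vspace 'rV['F_p]_n}) (w : 'rV['F_p]_n),
    [/\ (\dim V).+1 = n, w \notin V
      & A \subset sumset (middle_multiples p w) [set v in V]].
Arguments normal_set p {n} A.

Lemma sum_freeP (G : finZmodType) (A : {set G}) :
  sum_free A <->
  ~ (exists a b c, [/\ a \in A, b \in A, c \in A & a + b = c]).
Proof.
split=> [A0 [a [b [c [Aa Ab Ac abc]]]]|nA].
  have : c \in sumset A A :&: A.
    by rewrite inE Ac andbT -abc; apply/imset2P; exists a b.
  by rewrite A0 inE.
apply/setP=> c; rewrite !inE; apply/negP=> /andP[/imset2P[a b Aa Ab cE] Ac].
by apply: nA; exists a, b, c; split.
Qed.

Lemma middle_multiples5 (G : finZmodType) (w : G) :
  middle_multiples 5 w = [set w *+ 2; w *+ 3].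
Proof.
apply/setP=> x; rewrite !inE; apply/imsetP/orP.
  by case=> -[[|[|//]] ?] _ ->; rewrite /m_ /= ?addn0 ?addn1 eqxx; [left|right].
case=> /eqP->; first by exists ord0.
by exists (@Ordinal 2 1 isT).
Qed.

Lemma normal_set5 (n : nat) (A : {set 'rV['F_5]_n}) :
  normal_set 5 A <->
  exists (V : {vspace 'rV['F_5]_n}) (w : 'rV['F_5]_n),
    [/\ (\dim V).+1 = n, w \notin V
      & A \subset sumset [set w *+ 2; w *+ 3] [set v in V]].
Proof.
by split=> -[V [w [dV wV sA]]]; exists V, w;
  rewrite middle_multiples5 in sA *.
Qed.

(* Main.v *)
Require Import Defs.
From mathcomp Require Import all_boot all_order all_algebra all_fingroup.
From mathcomp Require Import zify lra.

Set Implicit Arguments.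
Unset Strict Implicit.
Unset Printing Implicit Defensive.

Import GRing.Theory Num.Theory.

(** Induction on n. Averaging over the hyperplanes through 0 yields one whose
    section of A is itself above the bound (for n = 3 one averages over the
    planes through a suitable point of A), hence normal; so some coset, not
    containing 0, of a subspace W of codimension 2 has more than 3/5 |W| points
    in A. Take W and the coset with the most points, and record the numbers of
    points of A in the 25 cosets of W. Dyson's transform shows that three
    nonempty cells u, v, u + v have at most 6/5 |W| points together, and at
    most 26/25 |W| if two of them are dense enough; moreover A is normal as
    soon as some affine hyperplane is more than half full. These constraints
    are contradictory: branching on the sizes of single cells reduces this to
    linear programs, whose dual solutions are listed in a certificate. *)

(** * The grid of cells *)

(** The constants have a common source. Dyson's transform enlarges one set to X', trades the second
    for a proper subgroup H of W, and keeps the third disjoint from a translate of X'; so the total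
    is at most |W| + |H|, and |H| <= |W|/5 gives 6/5. The bound 26/25 is 1 + 1/25 if H has index at
    least 25; for index 5 it is 4/5 + 1/5 * 6/5, the first bound being applied again inside one
    coset of H. The density 3/5 is half of 6/5, because a normal section is covered by two cosets of
    W. The averaging has hardly any slack. In dimension 3, with |A| = 31 and at most 6 points in
    each plane through 0, counting pairs of a point and a nonzero form vanishing there gives a tie:
    31 * 24 = 124 * 6. Counting only the forms that vanish at one point a of A ties again, 24 + 30 *
    4 = 24 * 6. If -a is in A as well, the count wins; if A contains no pair a, -a, then each plane
    section has at most 5 points, which breaks the tie. *)

(* The cell (i, j) of the 5 x 5 grid has index 5 * i + j. *)
Definition cell_add (u v : nat) : nat :=
  5 * ((u %/ 5 + v %/ 5) %% 5) + (u %% 5 + v %% 5) %% 5.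

(** Every line of the grid that misses the origin has an equation with right-hand side 1; its cells
    together fill an affine hyperplane. *)
Definition on_line (c d u : nat) : bool := (c * (u %/ 5) + d * (u %% 5)) %% 5 == 1.

(* Cell counts of a non-normal sum-free set above the bound, the cells having
   room for N points. The normalisations [grid_max],
   [grid_col], [grid_head] come from the choice of
   coordinates, which maximises cell 1 = (0, 1), then column 1, then
   cell 5 = (1, 0). *)
Record extremal_grid (x : nat -> nat) (N : nat) : Prop := ExtremalGrid {
  grid_large : 6 * N < \sum_(u < 25) x u;
  grid_cell : 3 * N < 5 * x 1;
  grid_le : forall u, u < 25 -> x u <= N;
  grid_max : forall u, 0 < u < 25 -> x u <= x 1;
  grid_col : forall i, 0 < i < 5 ->
    \sum_(u < 25 | u %/ 5 == i) x u <= \sum_(u < 25 | u %/ 5 == 1) x u;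
  grid_head : forall u, u < 25 -> u %/ 5 = 1 -> x u <= x 5;
  grid_line : forall c d, 2 * (\sum_(u < 25 | on_line c d u) x u) <= 5 * N;
  grid_triple : forall u v, u < 25 -> v < 25 ->
    0 < x u -> 0 < x v -> 0 < x (cell_add u v) ->
    5 * (x u + x v + x (cell_add u v)) <= 6 * N;
  grid_dense : forall u v r a b, u < 25 -> v < 25 ->
    0 < x u -> 0 < x v -> 0 < x (cell_add u v) ->
    (a, b) \in [:: (u, v); (u, cell_add u v); (v, cell_add u v)] ->
    r <= 4 -> r * N < 5 * x a -> (4 - r) * N < 5 * x b ->
    25 * (x u + x v + x (cell_add u v)) <= 26 * N
}.

(** * Linear programming certificates *)

Inductive bound :=
  | Max of nat | Head of nat | Col of nat | Line of nat & nat
  | Low of nat | Tri of nat & nat.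

(* [Split u k s t] branches on whether 5 * x u <= k * N; [Leaf d s] bounds
   d * \sum_u x u by the combination s of inequalities, completed by upper
   bounds of single cells. *)
Inductive tree :=
  | Leaf of nat & seq (nat * bound)
  | Split of nat & nat & tree & tree.

Section Checker.

(* hi`_u = k means 5 * x u <= k * N; lo`_u = k.+1 means k * N < 5 * x u, and
   lo`_u = 0 means nothing. *)
Variables lo hi : seq nat.

Definition lo_ u := nth 0 lo u.
(** The default 5 is the trivial bound [grid_le], so an empty list is no constraint. *)
Definition hi_ u := nth 5 hi u.

(** An inequality [b] has terms on both sides so that all coefficients are natural numbers: the
    [coefL] combination plus [constL * N] is at most the [coefR] combination plus [constR * N]. It
    is stated for the quantities [50 * x u], since 50 clears the denominators 2, 5 and 25 of the
    line bound, the triple bound and the dense triple bound. *)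
Definition coefL (b : bound) (u : nat) : nat :=
  match b with
  | Max v | Head v => u == v
  | Col i => u %/ 5 == i
  | Line c d => on_line c d u
  | Low _ => 0
  | Tri v w => (u == v) + (u == w) + (u == cell_add v w)
  end.

Definition coefR (b : bound) (u : nat) : nat :=
  match b with
  | Max _ => u == 1
  | Head _ => u == 5
  | Col _ => u %/ 5 == 1
  | Low v => u == v
  | _ => 0
  end.

Definition constL (b : bound) : nat :=
  if b is Low v then 10 * (lo_ v).-1 else 0.

(** An entry [k.+1] of [lo] stands for a density above k/5, so this supplies the densities above r/5
    and (4 - r)/5 required by [grid_dense]. *)
Definition dense u v : bool := 4 <= (lo_ u).-1 + (lo_ v).-1.

Definition constR (b : bound) : nat :=
  match b with
  | Line _ _ => 125
  | Tri u v => let w := cell_add u v in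
    if [|| dense u v, dense u w | dense v w] then 52 else 60
  | _ => 0
  end.

(** A positive entry of [lo] forces its cell to be nonempty, even the entry 1, which stands for
    [0 * N < 5 * x u]. The triple bounds need this for all three cells. *)
Definition valid (b : bound) : bool :=
  match b with
  | Max v => 0 < v < 25
  | Head v => (v < 25) && (v %/ 5 == 1)
  | Col i => 0 < i < 5
  | Line _ _ => true
  | Low v => v < 25
  | Tri u v => [&& u < 25, v < 25, 0 < lo_ u, 0 < lo_ v & 0 < lo_ (cell_add u v)]
  end.

Definition comb (s : seq (nat * bound)) (c : bound -> nat) : nat :=
  sumn [seq p.1 * c p.2 | p <- s].

(** The part of the coefficient of cell u that the combination does not cover and that the upper
    bound of this cell has to pay for. Truncated subtraction is intended: a surplus is simply
    dropped. *)
Definition deficit d s u := d + comb s (coefR^~ u) - comb s (coefL^~ u).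

(** Weak duality: if the test succeeds, the combination yields a total of at most [300 * d * N] for
    [d] times the sum of the [50 * x u], whereas [grid_large] multiplied by [50 * d] says that it is
    larger. *)
Definition check_leaf d s : bool :=
  [&& 0 < d, all (fun p => valid p.2) s
    & comb s constR + sumn [seq deficit d s u * (10 * hi_ u) | u <- iota 0 25]
        <= 300 * d + comb s constL].

End Checker.

Fixpoint check (t : tree) (lo hi : seq nat) : bool :=
  match t with
  | Leaf d s => check_leaf lo hi d s
  | Split u k s t => check s lo (set_nth 5 hi u k) && check t (set_nth 0 lo u k.+1) hi
  end.

(** * Soundness of the certificate checker *)

Section Soundness.

Variables (x : nat -> nat) (N : nat).
Hypothesis xG : extremal_grid x N.

Definition respects (lo hi : seq nat) := forall u, u < 25 ->
  (0 < lo_ lo u -> (lo_ lo u).-1 * N < 5 * x u) /\ 5 * x u <= hi_ hi u * N.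

Let y u := 50 * x u.

Lemma sum_eq_coef v : v < 25 -> \sum_(u < 25) (val u == v) * y u = y v.
Proof.
move=> v25; rewrite (bigD1 (Ordinal v25)) //= eqxx mul1n big1 ?addn0 // => u.
by rewrite -val_eqE /= => /negPf->.
Qed.

Lemma sum_pred_coef (P : pred nat) :
  \sum_(u < 25) P u * y u = 50 * \sum_(u < 25 | P u) x u.
Proof.
rewrite big_distrr /= [RHS]big_mkcond; apply: eq_bigr => u _.
by case: (P u); rewrite ?mul1n ?mul0n.
Qed.

Lemma cell_add_lt u v : cell_add u v < 25.
Proof.
rewrite /cell_add; have q5 := ltn_pmod (u %/ 5 + v %/ 5) (isT : 0 < 5).
have r5 := ltn_pmod (u %% 5 + v %% 5) (isT : 0 < 5).
by apply: (@leq_trans (5 * 4 + 5)); rewrite // -addnS leq_add // leq_mul2l -ltnS q5.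
Qed.

Lemma lo_pos lo hi u : respects lo hi -> u < 25 -> 0 < lo_ lo u -> 0 < x u.
Proof. by move=> sat u25 lu; have [/(_ lu) + _] := sat u u25; case: (x u); rewrite ?muln0. Qed.

Lemma valid_bound lo hi b : respects lo hi -> valid lo b ->
  \sum_(u < 25) coefL b u * y u + constL lo b * N
    <= \sum_(u < 25) coefR b u * y u + constR lo b * N.
Proof.
move=> sat; case: b => [v|v|i|c d|v|u v] /=.
- move=> /andP[v0 v25]; rewrite !sum_eq_coef // /y !mul0n !addn0 leq_mul2l /=.
  by apply: (grid_max xG); rewrite v0.
- case/andP=> v25 /eqP v1; rewrite !sum_eq_coef // /y !mul0n !addn0 leq_mul2l /=.
  exact: (grid_head xG).
- move=> i5; rewrite !(sum_pred_coef (fun u => u %/ 5 == _)) !mul0n !addn0.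
  by rewrite leq_mul2l /=; apply: (grid_col xG).
- move=> _; rewrite sum_pred_coef mul0n addn0.
  have := grid_line xG c d; rewrite [X in _ <= X + _]big1 ?add0n //.
  by move: (\sum_(_ < _ | _) _) => S; lia.
- move=> v25; rewrite sum_eq_coef // big1 ?add0n // mul0n addn0 /y.
  have [+ _] := sat v v25; case: (lo_ lo v) => [|k] /=; first by rewrite muln0.
  by move=> /(_ isT); nia.
case/and5P=> u25 v25 lu lv lw; rewrite mul0n addn0 [X in _ <= X + _]big1 ?add0n //.
under eq_bigr do rewrite !mulnDl; rewrite !big_split /= !sum_eq_coef ?cell_add_lt //.
have w25 := cell_add_lt u v.
have xu := lo_pos sat u25 lu; have xv := lo_pos sat v25 lv.
have xw := lo_pos sat w25 lw.
have le60 := grid_triple xG u25 v25 xu xv xw.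
have dense52 a b : (a, b) \in [:: (u, v); (u, cell_add u v); (v, cell_add u v)] ->
    a < 25 -> b < 25 -> 0 < lo_ lo a -> 0 < lo_ lo b -> dense lo a b ->
    25 * (x u + x v + x (cell_add u v)) <= 26 * N.
  move=> ab a25 b25 la lb; rewrite /dense => dab.
  have [/(_ la) ltA _] := sat a a25; have [/(_ lb) ltB _] := sat b b25.
  (* The cap keeps r in the range of [grid_dense]; by [dense], the lower bound of b then reaches 4 -
     r. *)
  apply: (grid_dense xG (r := minn 4 (lo_ lo a).-1) u25 v25 xu xv xw ab).
  - exact: geq_minl.
  - by apply: leq_ltn_trans ltA; rewrite leq_mul2r geq_minr orbT.
  - by apply: leq_ltn_trans ltB; rewrite leq_mul2r; apply/orP; right; lia.
rewrite /y; case: ifP => [dns|_]; last by lia.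
suff : 25 * (x u + x v + x (cell_add u v)) <= 26 * N by lia.
by case/or3P: dns => dns; apply: dense52 dns; rewrite ?inE ?eqxx ?orbT.
Qed.

Lemma combE s c : comb s c = \sum_(p <- s) p.1 * c p.2.
Proof. by rewrite /comb sumnE big_map. Qed.

Lemma check_leaf_sound lo hi d s : respects lo hi -> ~~ check_leaf lo hi d s.
Proof.
move=> sat; apply/negP=> /and3P[d0 vs].
rewrite sumnE big_map -[iota 0 25]/(index_iota 0 25) big_mkord => le300.
have sumE (c : bound -> nat -> nat) :
    \sum_(u < 25) comb s (c^~ u) * y u
      = \sum_(p <- s) p.1 * \sum_(u < 25) c p.2 u * y u.
  under [RHS]eq_bigr do rewrite big_distrr /=.
  rewrite exchange_big; apply: eq_bigr => u _; rewrite combE big_distrl /=.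
  by apply: eq_bigr => p _; rewrite mulnA.
have constE (c : bound -> nat) : comb s c * N = \sum_(p <- s) p.1 * (c p.2 * N).
  by rewrite combE big_distrl /=; apply: eq_bigr => p _; rewrite mulnA.
have main : \sum_(u < 25) comb s (coefL^~ u) * y u + comb s (constL lo) * N
    <= \sum_(u < 25) comb s (coefR^~ u) * y u + comb s (constR lo) * N.
  rewrite !sumE !constE -!big_split /=.
  elim: s vs {d0 le300 sumE constE} => [|p s IHs] /=; first by rewrite !big_nil.
  case/andP=> vp vs; rewrite !big_cons -!mulnDr; apply: leq_add (IHs vs).
  by rewrite leq_mul2l (valid_bound sat vp) orbT.
(* Cell by cell: a missing coefficient is made up by the upper bound of the cell, and where
   [deficit] is truncated to 0 the surplus multiplies a nonnegative count. *)
have cover : \sum_(u < 25) d * y u + \sum_(u < 25) comb s (coefR^~ u) * y u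
    <= \sum_(u < 25) comb s (coefL^~ u) * y u
       + (\sum_(u < 25) deficit d s u * (10 * hi_ hi u)) * N.
  rewrite big_distrl -!big_split /=; apply: leq_sum => u _.
  apply: leq_trans (_ : (comb s (coefL^~ u) + deficit d s u) * y u <= _).
    by rewrite -mulnDl leq_mul2r /deficit; apply/orP; right; lia.
  rewrite mulnDl leq_add2l -mulnA leq_mul2l; apply/orP; right.
  by have [_] := sat u (ltn_ord u); rewrite /y; lia.
have : 300 * d * N < \sum_(u < 25) d * y u.
  rewrite (mulnC 300) -mulnA -big_distrr /= ltn_pmul2l // -big_distrr /=.
  by move: (grid_large xG); move: (\sum_(_ < _) x _) => S; lia.
have : (comb s (constR lo) + \sum_(u < 25) deficit d s u * (10 * hi_ hi u)) * N
    <= (300 * d + comb s (constL lo)) * N by rewrite leq_mul2r le300 orbT.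
rewrite !mulnDl; move: main cover.
by lia.
Qed.

Lemma check_sound t lo hi : respects lo hi -> ~~ check t lo hi.
Proof.
elim: t lo hi => [d s|v k s IHs t IHt] lo hi sat /=; first exact: check_leaf_sound.
rewrite negb_and; have [lek|ltk] := leqP (5 * x v) (k * N).
  apply/orP; left; apply: IHs => u u25; have [lu hu] := sat u u25.
  by split=> //; rewrite /hi_ nth_set_nth /=; case: eqP => // ->.
apply/orP; right; apply: IHt => u u25; have [lu hu] := sat u u25.
by split=> //; rewrite /lo_ nth_set_nth /=; case: eqP => // ->.
Qed.

(** The root of the tree already knows one bound: the entry 4 for cell 1 encodes [grid_cell]. *)
Lemma extremal_grid_check t : ~~ check t [:: 0; 4] [::].
Proof.
apply: check_sound => u u25; split; last by rewrite /hi_ nth_nil leq_mul2l (grid_le xG).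
case: u u25 => [|[|u]] // _; last by rewrite /lo_ /= nth_nil.
by move=> _; have := grid_cell xG.
Qed.

End Soundness.

(* Output of a branch-and-bound search; the coefficients of the leaves are exact
   dual solutions of the linear programs. *)
Definition certificate : tree :=
(Split 0 0 (Split 2 0 (Split 5 0 (Leaf 1 [:: (1, Max 2); (1, Col 3); (4, Head 9); (1, Max 3); (4,
Head 8); (1, Col 2); (4, Head 7); (1, Max 4); (1, Col 4); (4, Head 6)]) (Split 5 1 (Split 3 0 (Leaf
1 [:: (1, Col 4); (4, Head 8); (4, Head 9); (1, Col 2); (4, Head 6); (1, Col 3); (4, Head 7)])
(Split 4 0 (Leaf 1 [:: (4, Head 6); (4, Head 7); (4, Head 8); (4, Head 9); (1, Col 2); (1, Col 3);
(1, Col 4)]) (Leaf 1 [:: (4, Head 9); (1, Col 2); (4, Head 8); (1, Tri 1 3); (4, Head 6); (1, Col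
3); (4, Head 7); (1, Col 4)]))) (Split 6 0 (Split 9 0 (Split 21 0 (Split 5 2 (Split 3 0 (Split 7 0
(Leaf 1 [:: (4, Head 8); (1, Col 2); (1, Col 3); (1, Col 4)]) (Split 8 0 (Leaf 1 [:: (4, Head 7);
(1, Col 2); (1, Col 3); (1, Col 4)]) (Leaf 3 [:: (11, Tri 1 7); (1, Max 7); (1, Max 8); (3, Col 2);
(3, Col 3); (3, Max 4); (3, Col 4); (3, Max 3)]))) (Split 4 0 (Leaf 2 [:: (8, Head 8); (1, Tri 3 3);
(2, Col 2); (2, Col 3); (2, Col 4); (8, Head 7)]) (Leaf 1 [:: (1, Tri 1 3); (4, Head 7); (4, Head
8); (1, Col 2); (1, Col 3); (1, Col 4)]))) (Split 10 0 (Split 8 0 (Split 7 0 (Split 3 0 (Leaf 1 [::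
(1, Col 2); (1, Col 3); (1, Col 4)]) (Split 4 0 (Leaf 1 [:: (1, Col 2); (1, Col 3); (1, Col 4)])
(Leaf 1 [:: (1, Tri 1 3); (1, Col 2); (1, Col 3); (1, Col 4)]))) (Split 3 0 (Split 24 0 (Split 12 0
(Split 15 0 (Split 16 0 (Split 7 1 (Leaf 7 [:: (5, Line 4 1); (5, Line 1 1); (2, Col 2); (5, Line 1
4); (3, Max 5); (2, Col 3); (2, Col 4)]) (Split 7 2 (Split 4 3 (Leaf 7 [:: (5, Line 4 1); (5, Line 1
4); (2, Col 2); (2, Col 4); (2, Col 3); (3, Max 5); (5, Line 1 1)]) (Split 22 0 (Split 14 0 (Leaf 1
[:: (1, Line 1 4); (1, Line 4 1)]) (Split 13 0 (Leaf 9 [:: (6, Line 4 1); (1, Max 4); (6, Line 1 1);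
(1, Col 2); (2, Tri 7 7); (8, Line 1 4); (2, Max 20); (3, Col 3); (1, Col 4)]) (Leaf 2 [:: (1, Line
1 1); (1, Tri 1 13); (2, Line 1 4); (1, Max 20); (1, Line 4 1); (1, Col 3)]))) (Leaf 7 [:: (5, Line
4 1); (2, Tri 7 22); (5, Line 1 1); (2, Col 2); (5, Line 1 4); (3, Max 5); (2, Col 3); (2, Col
4)]))) (Split 4 0 (Split 11 0 (Leaf 1 [:: (1, Line 1 1); (1, Line 4 1); (1, Max 23)]) (Split 14 0
(Split 18 0 (Leaf 1 [:: (1, Line 1 4); (1, Line 4 1)]) (Leaf 21 [:: (13, Line 1 1); (3, Max 22); (7,
Tri 7 11); (14, Line 1 4); (1, Max 13); (2, Max 23); (5, Col 4); (1, Col 3); (20, Line 4 1); (6, Max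
17)])) (Leaf 7 [:: (5, Line 1 1); (5, Line 1 4); (4, Tri 7 7); (2, Col 2); (2, Col 4); (2, Col 3);
(3, Max 5); (5, Line 4 1)]))) (Split 14 0 (Split 22 0 (Leaf 1 [:: (1, Line 1 4); (1, Line 4 1)])
(Split 23 0 (Leaf 5 [:: (3, Line 1 1); (3, Line 1 4); (2, Tri 7 22); (2, Max 11); (2, Col 3); (5,
Line 4 1); (1, Max 5)]) (Split 11 0 (Leaf 5 [:: (3, Line 1 1); (3, Line 1 4); (2, Max 23); (2, Tri 7
22); (2, Col 3); (5, Line 4 1); (1, Max 5)]) (Leaf 15 [:: (4, Tri 1 22); (4, Tri 7 22); (6, Max 18);
(2, Tri 11 11); (11, Line 1 4); (4, Col 3); (15, Line 4 1); (5, Line 1 1); (3, Max 5)])))) (Split 22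
0 (Split 11 0 (Leaf 34 [:: (23, Line 1 1); (2, Max 18); (11, Tri 7 7); (6, Max 13); (7, Col 4); (26,
Line 1 4); (8, Max 4); (8, Col 3); (27, Line 4 1); (1, Line 0 2)]) (Split 18 0 (Leaf 1 [:: (1, Line
1 4); (1, Line 4 1)]) (Leaf 5 [:: (3, Line 1 1); (1, Max 4); (2, Low 7); (2, Tri 7 7); (1, Col 3);
(1, Max 13); (4, Line 1 4); (1, Tri 7 11); (4, Line 4 1); (1, Col 4)]))) (Split 13 0 (Leaf 35 [::
(4, Max 4); (4, Tri 7 22); (23, Line 1 1); (25, Line 4 1); (6, Max 11); (12, Tri 7 7); (27, Line 1
4); (2, Line 4 3); (3, Max 5); (10, Col 3); (8, Col 4)]) (Split 18 0 (Leaf 14 [:: (8, Line 1 1); (3,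
Tri 7 22); (3, Max 5); (4, Tri 7 7); (3, Col 4); (2, Col 2); (3, Col 3); (11, Line 1 4); (11, Line 4
1); (1, Max 11); (1, Max 13)]) (Leaf 12 [:: (3, Col 3); (6, Line 1 1); (4, Tri 7 7); (1, Max 11);
(2, Col 2); (5, Max 5); (9, Line 1 4); (3, Tri 13 18); (9, Line 4 1); (3, Tri 7 22); (3, Col
4)])))))))) (Split 16 2 (Split 7 1 (Split 4 0 (Leaf 1 [:: (1, Col 2); (1, Col 3); (1, Col 4)])
(Split 5 4 (Leaf 1 [:: (1, Col 2); (1, Col 3); (1, Col 4)]) (Split 11 0 (Split 13 0 (Leaf 2 [:: (1,
Line 4 1); (1, Line 1 4); (1, Col 4); (1, Col 3); (1, Max 5); (2, Line 1 1)]) (Leaf 2 [:: (1, Line 1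
4); (1, Line 4 1); (1, Max 5); (1, Tri 13 16); (1, Col 3); (2, Line 1 1); (1, Col 4)])) (Leaf 3 [::
(2, Line 4 1); (2, Line 1 4); (2, Tri 5 11); (1, Max 4); (1, Col 2); (1, Col 3); (2, Line 1 1); (1,
Col 4)])))) (Split 5 4 (Split 7 2 (Split 4 0 (Leaf 1 [:: (1, Col 2); (1, Col 3); (1, Col 4)]) (Split
5 3 (Leaf 1 [:: (1, Col 2); (1, Col 3); (1, Col 4)]) (Split 16 1 (Split 4 3 (Split 1 4 (Split 13 0
(Split 19 0 (Leaf 1 [:: (1, Line 1 1); (1, Col 4); (1, Line 1 4)]) (Leaf 3 [:: (1, Max 4); (2, Line
1 4); (1, Col 2); (2, Tri 16 19); (1, Col 3); (2, Line 1 1); (2, Max 20); (1, Col 4)])) (Split 14 0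
(Split 11 0 (Leaf 3 [:: (2, Line 1 4); (1, Max 13); (1, Col 3); (2, Line 1 1); (2, Line 4 1); (1,
Col 4)]) (Leaf 11 [:: (7, Line 1 1); (1, Max 5); (1, Max 13); (7, Line 1 4); (3, Tri 13 16); (4, Tri
5 11); (4, Col 3); (7, Line 4 1); (4, Col 4); (1, Max 4)])) (Split 11 0 (Leaf 1 [:: (1, Tri 1 13);
(1, Col 3); (1, Col 4)]) (Leaf 7 [:: (4, Line 4 1); (3, Max 4); (4, Line 1 4); (3, Tri 1 13); (3,
Col 3); (4, Line 1 1); (4, Tri 5 11); (1, Max 5); (3, Col 4)])))) (Split 22 0 (Split 20 0 (Leaf 3
[:: (2, Line 1 4); (1, Col 2); (2, Line 4 1); (2, Line 1 1); (1, Col 3); (1, Max 23)]) (Split 23 0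
(Leaf 3 [:: (1, Col 2); (2, Line 1 4); (1, Col 3); (2, Line 1 1); (2, Line 4 1); (1, Max 20)])
(Split 18 0 (Split 14 0 (Leaf 1 [:: (1, Line 1 4); (1, Line 4 1)]) (Leaf 1 [:: (1, Tri 7 14); (1,
Low 7); (1, Line 1 4); (1, Line 4 1)])) (Split 14 0 (Leaf 20 [:: (6, Line 1 1); (9, Tri 7 18); (1,
Col 2); (19, Line 1 4); (1, Line 0 2); (2, Max 13); (16, Line 4 1); (4, Col 3)]) (Leaf 4 [:: (2,
Line 1 1); (1, Tri 5 18); (1, Col 2); (1, Tri 7 7); (3, Line 1 4); (1, Max 20); (3, Line 4 1); (1,
Col 3)]))))) (Split 23 0 (Split 17 0 (Leaf 1 [:: (1, Line 1 1); (1, Max 11); (1, Line 4 1)]) (Leaf 1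
[:: (1, Line 1 1); (1, Max 11); (1, Tri 1 16); (1, Low 1); (1, Line 4 1)])) (Split 20 3 (Leaf 1 [::
(1, Col 2); (1, Col 3); (1, Tri 1 22)]) (Split 18 0 (Split 14 0 (Leaf 4 [:: (2, Col 4); (2, Tri 7
22); (1, Tri 16 16); (2, Col 2); (2, Line 1 4); (2, Line 4 1); (2, Col 3)]) (Leaf 6 [:: (5, Tri 1
22); (1, Tri 7 22); (2, Tri 14 14); (1, Tri 7 7); (1, Col 2); (1, Col 3); (5, Line 1 4); (5, Line 4
1); (3, Max 5); (1, Max 20)])) (Leaf 1 [:: (2, Low 20); (1, Col 2); (1, Col 3); (3, Tri 7 18); (1,
Tri 1 22)])))))) (Split 22 0 (Split 20 0 (Split 23 0 (Leaf 3 [:: (1, Max 5); (1, Col 2); (2, Line 4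
1); (2, Line 1 1); (1, Tri 16 16); (1, Col 3); (2, Line 1 4)]) (Leaf 7 [:: (5, Line 4 1); (2, Max
4); (5, Line 1 1); (2, Col 2); (1, Max 5); (2, Col 3); (5, Line 1 4); (1, Tri 23 23)])) (Split 23 0
(Split 18 0 (Split 14 0 (Leaf 1 [:: (1, Line 1 4); (1, Line 4 1)]) (Leaf 1 [:: (1, Tri 7 14); (1,
Low 7); (1, Line 1 4); (1, Line 4 1)])) (Split 14 0 (Leaf 20 [:: (6, Line 1 1); (9, Tri 7 18); (1,
Col 2); (19, Line 1 4); (1, Line 0 2); (2, Max 13); (16, Line 4 1); (4, Col 3)]) (Leaf 4 [:: (2,
Line 1 1); (1, Max 5); (1, Tri 7 7); (1, Col 2); (3, Line 1 4); (1, Tri 7 18); (1, Col 3); (3, Line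
4 1)]))) (Split 18 0 (Split 14 0 (Leaf 1 [:: (1, Line 1 4); (1, Line 4 1)]) (Leaf 1 [:: (1, Tri 7
14); (1, Low 7); (1, Line 1 4); (1, Line 4 1)])) (Split 14 0 (Leaf 20 [:: (6, Line 1 1); (9, Tri 7
18); (1, Col 2); (19, Line 1 4); (1, Line 0 2); (2, Max 13); (16, Line 4 1); (4, Col 3)]) (Leaf 29
[:: (13, Line 1 1); (6, Max 4); (4, Tri 5 18); (6, Tri 7 7); (6, Col 2); (2, Tri 14 14); (23, Line 1
4); (6, Tri 7 18); (1, Max 5); (23, Line 4 1); (6, Col 3)]))))) (Split 23 1 (Split 20 3 (Leaf 2 [::
(1, Tri 7 22); (1, Col 2); (1, Line 1 1); (1, Col 3); (1, Line 4 1); (1, Line 1 4)]) (Split 18 0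
(Split 14 0 (Leaf 4 [:: (2, Col 4); (2, Tri 7 22); (1, Tri 16 16); (2, Col 2); (2, Line 1 4); (2,
Line 4 1); (2, Col 3)]) (Leaf 29 [:: (15, Line 1 1); (8, Tri 7 22); (9, Max 5); (8, Tri 7 7); (6,
Col 4); (6, Col 2); (6, Col 3); (23, Line 1 4); (23, Line 4 1); (2, Low 4)])) (Leaf 2 [:: (1, Line 4
1); (1, Tri 7 22); (1, Tri 7 18); (1, Col 2); (1, Line 1 4); (1, Col 3); (1, Line 1 1)]))) (Split 20
3 (Leaf 1 [:: (2, Low 4); (3, Tri 7 22); (1, Col 2); (1, Col 3); (1, Tri 1 22)]) (Split 18 0 (Split
14 0 (Leaf 4 [:: (2, Col 4); (2, Tri 7 22); (1, Tri 16 16); (2, Col 2); (2, Line 1 4); (2, Line 4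
1); (2, Col 3)]) (Leaf 29 [:: (15, Line 1 1); (8, Tri 7 22); (9, Max 5); (8, Tri 7 7); (6, Col 4);
(6, Col 2); (6, Col 3); (23, Line 1 4); (23, Line 4 1); (2, Low 4)])) (Leaf 1 [:: (1, Tri 7 22); (1,
Low 20); (1, Col 2); (1, Col 3); (2, Tri 7 18); (1, Tri 1 22)])))))) (Split 11 0 (Split 17 0 (Split
23 0 (Leaf 1 [:: (1, Line 1 1); (1, Line 4 1); (1, Max 16)]) (Leaf 17 [:: (16, Line 1 1); (4, Tri 16
16); (4, Max 5); (1, Col 2); (1, Col 4); (1, Col 3); (16, Line 4 1); (8, Tri 23 23); (11, Max 4)]))
(Split 23 0 (Leaf 11 [:: (10, Line 1 1); (11, Max 4); (3, Max 5); (3, Max 7); (1, Max 13); (1, Max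
14); (10, Tri 1 16); (1, Col 4); (1, Col 3); (10, Line 4 1)]) (Leaf 11 [:: (10, Line 1 1); (5, Low
16); (4, Max 5); (4, Max 7); (5, Tri 23 23); (11, Max 4); (1, Col 3); (1, Col 4); (10, Line 4 1);
(1, Col 2); (10, Tri 1 16)]))) (Split 13 0 (Split 14 0 (Leaf 2 [:: (1, Line 1 4); (1, Tri 5 11); (1,
Col 3); (1, Line 4 1); (1, Line 1 1); (1, Col 4)]) (Leaf 7 [:: (4, Line 4 1); (4, Line 1 4); (4, Tri
5 11); (3, Tri 7 7); (3, Col 3); (4, Line 1 1); (1, Max 5); (3, Col 4)])) (Split 14 0 (Leaf 11 [::
(7, Line 1 1); (1, Max 5); (1, Max 13); (7, Line 1 4); (3, Tri 13 16); (4, Tri 5 11); (4, Col 3);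
(7, Line 4 1); (4, Col 4); (1, Max 4)]) (Leaf 7 [:: (4, Line 4 1); (3, Max 4); (4, Line 1 4); (3,
Tri 1 13); (3, Col 3); (4, Line 1 1); (4, Tri 5 11); (1, Max 5); (3, Col 4)]))))))) (Split 4 0
(Split 5 3 (Leaf 1 [:: (4, Head 7); (1, Col 2); (1, Col 3); (1, Col 4)]) (Split 17 0 (Split 11 0
(Leaf 1 [:: (1, Line 1 1); (1, Line 4 1); (1, Max 23)]) (Leaf 5 [:: (4, Line 1 1); (4, Tri 5 11);
(1, Col 2); (1, Col 4); (1, Col 3); (4, Line 4 1); (3, Max 23)])) (Split 11 1 (Leaf 3 [:: (3, Line 1
1); (1, Max 16); (1, Max 17); (3, Line 4 1); (3, Max 23); (2, Tri 1 16)]) (Leaf 18 [:: (16, Line 1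
1); (16, Tri 5 11); (8, Head 7); (2, Col 2); (2, Col 4); (7, Max 17); (2, Col 3); (16, Line 4 1);
(16, Max 23); (9, Tri 1 16)])))) (Split 4 1 (Split 14 0 (Split 11 0 (Split 17 0 (Leaf 7 [:: (6, Line
1 1); (3, Tri 16 16); (1, Col 4); (1, Col 3); (6, Line 4 1); (5, Max 23)]) (Leaf 3 [:: (3, Line 1
1); (1, Max 16); (1, Max 17); (3, Line 4 1); (3, Max 23); (2, Tri 1 16)])) (Split 23 0 (Leaf 7 [::
(6, Line 1 1); (6, Tri 5 11); (3, Max 17); (3, Head 7); (1, Col 2); (1, Max 20); (1, Col 3); (6,
Line 4 1); (1, Max 22)]) (Split 22 0 (Leaf 5 [:: (2, Line 1 1); (2, Head 7); (3, Line 1 4); (2, Tri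
5 11); (2, Max 5); (2, Col 3); (5, Line 4 1); (1, Tri 23 23)]) (Leaf 13 [:: (1, Tri 7 16); (6, Tri 5
11); (4, Tri 1 22); (6, Col 3); (3, Max 5); (7, Line 1 4); (4, Max 18); (3, Line 1 1); (13, Line 4
1); (5, Tri 7 22); (1, Tri 4 23)])))) (Split 11 0 (Split 13 0 (Leaf 2 [:: (3, Tri 7 7); (2, Col 3);
(2, Col 4)]) (Leaf 4 [:: (2, Line 1 1); (3, Tri 7 7); (2, Tri 13 16); (2, Col 4); (2, Line 1 4); (2,
Col 3); (2, Line 4 1)])) (Split 13 0 (Leaf 10 [:: (6, Line 4 1); (4, Tri 5 11); (6, Line 1 4); (4,
Tri 7 7); (4, Col 4); (1, Tri 16 16); (4, Col 3); (2, Max 5); (6, Line 1 1)]) (Leaf 4 [:: (2, Line 1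
1); (2, Tri 5 11); (2, Tri 1 13); (3, Tri 7 7); (2, Col 4); (2, Max 5); (2, Col 3); (2, Line 4 1);
(2, Line 1 4)])))) (Split 14 0 (Split 22 0 (Split 18 0 (Leaf 1 [:: (1, Line 1 4); (1, Line 4 1)])
(Split 13 0 (Split 20 0 (Leaf 13 [:: (8, Line 4 1); (6, Head 7); (4, Tri 16 16); (13, Line 1 4); (8,
Line 1 1); (3, Max 5); (5, Col 3)]) (Leaf 3 [:: (1, Tri 16 16); (1, Col 3); (3, Line 1 4); (2, Tri 7
18); (1, Line 4 1)])) (Leaf 11 [:: (4, Tri 16 16); (8, Tri 13 18); (3, Col 3); (11, Line 1 4); (2,
Max 7); (8, Line 4 1); (3, Max 20)]))) (Split 18 0 (Leaf 11 [:: (8, Tri 7 22); (4, Tri 16 16); (3,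
Col 2); (3, Col 3); (8, Line 1 4); (8, Line 4 1); (5, Low 4); (3, Col 4)]) (Split 13 0 (Split 11 0
(Split 7 3 (Leaf 3 [:: (2, Line 1 4); (1, Max 5); (1, Tri 16 16); (1, Col 3); (2, Line 1 1); (2,
Line 4 1); (1, Col 4); (1, Tri 7 22)]) (Leaf 4 [:: (2, Line 1 1); (2, Line 1 4); (1, Tri 16 16); (2,
Col 3); (3, Head 7); (2, Line 4 1); (2, Tri 7 22); (2, Col 4)])) (Leaf 70 [:: (15, Tri 7 22); (3,
Tri 11 18); (52, Line 4 1); (13, Tri 7 11); (26, Tri 16 16); (52, Line 1 4); (18, Col 3); (18, Col
4); (36, Line 1 1); (1, Tri 11 11); (18, Max 5)])) (Split 11 0 (Leaf 19 [:: (9, Line 1 1); (14, Line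
1 4); (6, Max 5); (5, Tri 7 22); (5, Tri 13 18); (7, Tri 16 16); (3, Max 7); (5, Col 3); (14, Line 4
1); (5, Col 4)]) (Leaf 94 [:: (36, Line 1 1); (24, Col 4); (36, Max 5); (27, Tri 7 22); (10, Tri 7
11); (7, Tri 11 11); (35, Tri 16 16); (70, Line 1 4); (24, Tri 13 18); (24, Col 3); (70, Line 4
1)]))))) (Split 13 0 (Split 11 0 (Leaf 2 [:: (3, Tri 7 7); (2, Col 3); (2, Col 4)]) (Split 5 3 (Leaf
2 [:: (3, Tri 7 7); (2, Tri 5 11); (2, Col 3); (2, Col 4)]) (Split 16 1 (Leaf 6 [:: (4, Line 4 1);
(4, Line 1 1); (2, Max 4); (3, Tri 7 7); (4, Line 1 4); (2, Col 3); (2, Tri 5 11); (2, Col 4)])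
(Leaf 14 [:: (8, Line 4 1); (8, Line 1 1); (8, Tri 5 11); (9, Tri 7 7); (8, Line 1 4); (6, Col 3);
(2, Max 5); (6, Col 4)])))) (Split 11 0 (Leaf 4 [:: (2, Line 1 1); (3, Tri 7 7); (2, Tri 13 16); (2,
Col 4); (2, Line 1 4); (2, Col 3); (2, Line 4 1)]) (Split 4 2 (Leaf 4 [:: (2, Line 1 1); (2, Line 1
4); (3, Tri 7 7); (2, Tri 1 13); (2, Col 4); (2, Tri 5 11); (2, Max 5); (2, Col 3); (2, Line 4 1)])
(Split 22 0 (Split 18 0 (Leaf 1 [:: (1, Tri 7 14); (1, Low 7); (1, Line 1 4); (1, Line 4 1)]) (Leaf
17 [:: (4, Tri 13 18); (11, Tri 5 11); (9, Tri 7 7); (6, Col 3); (8, Tri 1 13); (6, Max 4); (11,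
Line 1 4); (6, Col 4); (7, Tri 5 13); (11, Line 4 1)])) (Leaf 2 [:: (1, Col 3); (1, Line 1 1); (1,
Tri 7 22); (1, Tri 5 11); (1, Tri 13 22); (1, Tri 7 7); (1, Line 1 4); (1, Line 4 1); (1, Col
4)]))))))))) (Split 16 1 (Split 1 4 (Split 11 0 (Split 17 0 (Leaf 1 [:: (1, Line 1 1); (1, Max 4);
(1, Line 4 1); (1, Max 23)]) (Split 23 0 (Leaf 1 [:: (1, Line 1 1); (1, Max 4); (1, Line 4 1); (1,
Max 17)]) (Leaf 3 [:: (3, Line 1 1); (4, Low 5); (1, Line 1 4); (1, Tri 23 23); (2, Max 4); (3, Line
4 1); (3, Max 5); (2, Tri 1 16)]))) (Split 17 0 (Split 23 0 (Leaf 1 [:: (1, Line 1 1); (1, Max 4);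
(1, Max 11); (1, Line 4 1)]) (Leaf 4 [:: (4, Line 1 1); (3, Max 4); (3, Tri 5 11); (1, Line 1 4);
(4, Low 5); (4, Line 4 1); (1, Max 23); (1, Tri 23 23)])) (Split 23 0 (Leaf 4 [:: (4, Line 1 1); (3,
Max 4); (3, Tri 5 11); (1, Tri 1 16); (1, Line 1 4); (2, Max 17); (4, Low 5); (4, Line 4 1)]) (Split
17 1 (Leaf 3 [:: (3, Line 1 1); (2, Max 4); (2, Tri 5 11); (1, Line 1 4); (4, Low 5); (3, Line 4 1);
(1, Max 5); (1, Tri 23 23)]) (Leaf 1 [:: (1, Line 1 1); (1, Low 17); (1, Tri 1 16); (1, Line 1 4);
(2, Max 5); (3, Low 5); (1, Line 4 1)]))))) (Split 11 0 (Split 17 0 (Split 23 0 (Leaf 1 [:: (1, Line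
1 1); (1, Line 4 1); (1, Max 16)]) (Leaf 17 [:: (16, Line 1 1); (4, Tri 16 16); (4, Max 5); (1, Col
2); (1, Col 4); (1, Col 3); (16, Line 4 1); (8, Tri 23 23); (11, Max 4)])) (Split 23 0 (Leaf 11 [::
(10, Line 1 1); (11, Max 4); (3, Max 5); (3, Max 7); (1, Max 13); (1, Max 14); (10, Tri 1 16); (1,
Col 4); (1, Col 3); (10, Line 4 1)]) (Leaf 3 [:: (3, Line 1 1); (4, Low 5); (1, Line 1 4); (1, Tri
23 23); (2, Max 4); (3, Line 4 1); (3, Max 5); (2, Tri 1 16)]))) (Split 17 0 (Split 23 0 (Leaf 7 [::
(6, Line 1 1); (6, Tri 5 11); (3, Max 4); (3, Head 7); (1, Col 2); (1, Max 20); (1, Col 3); (6, Line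
4 1); (1, Max 22)]) (Leaf 4 [:: (4, Line 1 1); (3, Max 4); (3, Tri 5 11); (1, Line 1 4); (4, Low 5);
(4, Line 4 1); (1, Max 23); (1, Tri 23 23)])) (Split 23 0 (Leaf 4 [:: (4, Line 1 1); (3, Max 4); (3,
Tri 5 11); (1, Tri 1 16); (1, Line 1 4); (2, Max 17); (4, Low 5); (4, Line 4 1)]) (Leaf 5 [:: (5,
Low 5); (5, Line 1 1); (2, Max 4); (2, Tri 5 11); (2, Tri 1 16); (3, Line 1 4); (1, Tri 23 23); (5,
Line 4 1); (5, Low 1)]))))) (Split 11 0 (Split 17 0 (Split 23 0 (Leaf 1 [:: (1, Line 1 1); (1, Line
4 1); (1, Max 16)]) (Leaf 17 [:: (16, Line 1 1); (4, Tri 16 16); (4, Max 5); (1, Col 2); (1, Col 4);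
(1, Col 3); (16, Line 4 1); (8, Tri 23 23); (11, Max 4)])) (Split 23 0 (Leaf 11 [:: (10, Line 1 1);
(11, Max 4); (3, Max 5); (3, Max 7); (1, Max 13); (1, Max 14); (10, Tri 1 16); (1, Col 4); (1, Col
3); (10, Line 4 1)]) (Leaf 3 [:: (3, Line 1 1); (4, Low 5); (1, Line 1 4); (1, Tri 23 23); (2, Max
4); (3, Line 4 1); (3, Max 5); (2, Tri 1 16)]))) (Split 17 0 (Split 23 0 (Leaf 7 [:: (6, Line 1 1);
(6, Tri 5 11); (3, Max 4); (3, Head 7); (1, Col 2); (1, Max 20); (1, Col 3); (6, Line 4 1); (1, Max
22)]) (Leaf 4 [:: (4, Line 1 1); (3, Max 4); (3, Tri 5 11); (1, Line 1 4); (4, Low 5); (4, Line 4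
1); (1, Max 23); (1, Tri 23 23)])) (Split 23 0 (Leaf 4 [:: (4, Line 1 1); (3, Max 4); (3, Tri 5 11);
(1, Tri 1 16); (1, Line 1 4); (2, Max 17); (4, Low 5); (4, Line 4 1)]) (Leaf 5 [:: (5, Max 5); (5,
Line 1 1); (2, Max 4); (2, Tri 5 11); (10, Low 5); (2, Tri 1 16); (3, Line 1 4); (1, Tri 23 23); (5,
Line 4 1)]))))))) (Split 17 0 (Split 11 0 (Split 23 0 (Leaf 1 [:: (1, Line 1 1); (1, Line 4 1); (1,
Max 16)]) (Leaf 17 [:: (16, Line 1 1); (4, Tri 16 16); (4, Max 5); (1, Col 2); (1, Col 4); (1, Col
3); (16, Line 4 1); (8, Tri 23 23); (11, Max 4)])) (Leaf 1 [:: (4, Tri 16 16); (1, Max 4); (1, Col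
2); (12, Low 16); (1, Col 3); (1, Col 4); (4, Tri 5 11)])) (Leaf 1 [:: (6, Tri 1 16); (1, Max 3);
(4, Max 5); (14, Low 16); (1, Col 2); (4, Tri 16 16); (1, Col 3); (1, Col 4)])))) (Split 16 0 (Split
5 4 (Split 7 2 (Split 4 0 (Leaf 3 [:: (2, Line 1 4); (1, Col 2); (1, Tri 15 15); (1, Col 3); (2,
Line 1 1); (2, Line 4 1); (1, Max 5); (1, Col 4)]) (Split 5 3 (Leaf 1 [:: (1, Col 2); (1, Col 3);
(1, Col 4)]) (Split 15 1 (Split 22 0 (Split 20 0 (Split 19 0 (Leaf 1 [:: (1, Line 1 4); (1, Col 2);
(1, Line 1 1)]) (Leaf 5 [:: (4, Tri 1 19); (4, Line 1 4); (1, Col 2); (1, Col 3); (4, Line 1 1); (3,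
Max 13); (1, Col 4)])) (Split 23 1 (Leaf 12 [:: (1, Tri 15 15); (2, Max 5); (5, Col 2); (5, Tri 5
15); (5, Col 3); (7, Line 1 1); (7, Line 4 1); (7, Line 1 4)]) (Split 18 0 (Split 14 0 (Leaf 1 [::
(1, Line 1 4); (1, Line 4 1)]) (Leaf 5 [:: (2, Line 1 1); (2, Tri 15 15); (2, Tri 7 7); (1, Col 4);
(1, Col 2); (1, Max 4); (1, Col 3); (4, Line 1 4); (4, Line 4 1)])) (Leaf 2 [:: (1, Line 1 1); (1,
Col 2); (1, Col 3); (1, Tri 5 18); (1, Line 4 1); (1, Tri 5 15); (1, Line 1 4)])))) (Split 20 0
(Split 19 0 (Leaf 1 [:: (1, Line 1 4); (1, Col 2); (1, Line 1 1)]) (Leaf 5 [:: (4, Tri 1 19); (4,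
Line 1 4); (1, Col 2); (1, Col 3); (4, Line 1 1); (3, Max 13); (1, Col 4)])) (Split 23 0 (Leaf 18
[:: (11, Line 1 4); (2, Max 19); (7, Col 2); (1, Tri 15 15); (7, Col 3); (11, Line 1 1); (9, Line 4
1); (9, Tri 5 15); (7, Tri 7 22)]) (Leaf 12 [:: (7, Line 4 1); (5, Max 4); (7, Line 1 4); (5, Col
2); (5, Tri 5 15); (1, Tri 15 15); (5, Col 3); (7, Line 1 1); (2, Max 5); (5, Tri 1 22)])))) (Split
22 0 (Split 4 3 (Leaf 1 [:: (4, Tri 15 15); (1, Col 2); (1, Col 3); (8, Low 15); (1, Col 4)]) (Split
14 0 (Split 11 0 (Leaf 3 [:: (1, Line 1 4); (5, Tri 15 15); (2, Col 3); (9, Low 15); (2, Line 4 1);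
(1, Col 4); (1, Line 0 2)]) (Leaf 1 [:: (4, Tri 15 15); (1, Col 2); (1, Col 3); (9, Low 15); (1, Tri
11 15); (1, Col 4)])) (Leaf 1 [:: (4, Tri 15 15); (1, Tri 14 15); (1, Col 2); (1, Col 3); (9, Low
15); (1, Col 4)]))) (Leaf 1 [:: (1, Tri 7 22); (4, Tri 15 15); (1, Col 2); (1, Col 3); (8, Low 15);
(1, Col 4)]))))) (Split 14 0 (Split 22 0 (Split 18 0 (Leaf 1 [:: (1, Line 1 4); (1, Line 4 1)])
(Split 13 0 (Split 20 0 (Leaf 13 [:: (7, Head 7); (4, Tri 15 15); (3, Max 7); (5, Col 3); (13, Line
1 4); (8, Line 1 1); (8, Line 4 1)]) (Leaf 2 [:: (1, Line 1 1); (2, Head 7); (1, Col 3); (2, Line 1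
4); (1, Line 4 1); (1, Tri 5 15)])) (Leaf 13 [:: (6, Tri 13 18); (6, Head 7); (3, Col 3); (3, Max
20); (13, Line 1 4); (4, Tri 5 13); (5, Tri 15 15); (10, Line 4 1)]))) (Split 18 0 (Leaf 37 [:: (12,
Line 1 1); (5, Max 4); (2, Max 5); (20, Tri 7 15); (5, Col 2); (6, Tri 15 15); (32, Line 1 4); (32,
Line 4 1); (5, Col 3); (5, Col 4)]) (Split 18 1 (Leaf 1 [:: (1, Low 7); (1, Tri 7 15); (1, Line 1
4); (1, Line 4 1)]) (Split 13 0 (Split 20 0 (Leaf 2 [:: (1, Line 4 1); (1, Col 3); (2, Line 1 4);
(1, Line 1 1); (1, Tri 7 15); (1, Head 7)]) (Split 19 0 (Leaf 33 [:: (32, Line 1 1); (36, Head 7);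
(1, Col 2); (8, Tri 15 15); (32, Line 1 4); (16, Tri 20 20); (1, Col 3); (1, Col 4)]) (Leaf 1 [::
(1, Line 1 4); (1, Tri 1 18); (1, Tri 7 15)]))) (Leaf 26 [:: (6, Tri 13 22); (5, Max 4); (6, Max 5);
(15, Tri 7 15); (5, Max 11); (21, Tri 13 18); (3, Tri 15 15); (21, Line 1 4); (21, Line 4 1); (5,
Col 3); (5, Col 4)]))))) (Split 4 0 (Split 11 0 (Leaf 6 [:: (4, Line 1 1); (2, Tri 15 15); (3, Tri 7
7); (2, Col 4); (2, Max 13); (2, Col 3); (4, Line 4 1); (4, Line 1 4)]) (Leaf 28 [:: (18, Line 1 1);
(4, Tri 15 15); (15, Tri 7 7); (10, Max 13); (10, Col 4); (8, Max 5); (10, Col 3); (18, Line 1 4);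
(18, Line 4 1); (10, Tri 11 15)])) (Split 22 0 (Split 18 0 (Leaf 5 [:: (2, Line 1 1); (2, Tri 15
15); (2, Tri 7 7); (1, Col 4); (1, Col 2); (1, Max 4); (1, Col 3); (4, Line 1 4); (4, Line 4 1)])
(Split 13 0 (Split 11 0 (Leaf 6 [:: (4, Line 1 4); (2, Max 4); (3, Tri 7 7); (2, Tri 15 15); (2, Col
4); (2, Col 3); (4, Line 4 1); (4, Line 1 1)]) (Leaf 28 [:: (10, Tri 11 15); (10, Max 4); (18, Line
1 1); (15, Tri 7 7); (4, Tri 15 15); (18, Line 1 4); (10, Col 3); (8, Max 5); (10, Col 4); (18, Line
4 1)])) (Leaf 11 [:: (2, Line 1 1); (3, Tri 15 15); (5, Tri 7 7); (5, Max 20); (5, Col 3); (11, Line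
1 4); (4, Tri 13 18); (6, Line 4 1); (4, Tri 1 13)]))) (Split 18 0 (Leaf 10 [:: (3, Line 1 1); (3,
Tri 7 22); (4, Tri 7 7); (3, Col 4); (3, Col 2); (3, Col 3); (3, Tri 15 15); (7, Line 1 4); (7, Line
4 1); (1, Tri 7 15)]) (Split 13 0 (Split 11 0 (Leaf 6 [:: (4, Line 1 4); (2, Max 4); (3, Tri 7 7);
(2, Tri 15 15); (2, Col 4); (2, Col 3); (4, Line 4 1); (4, Line 1 1)]) (Leaf 28 [:: (10, Tri 11 15);
(10, Max 4); (18, Line 1 1); (15, Tri 7 7); (4, Tri 15 15); (18, Line 1 4); (10, Col 3); (8, Max 5);
(10, Col 4); (18, Line 4 1)])) (Split 11 0 (Leaf 1 [:: (1, Tri 7 22); (1, Tri 1 13); (1, Tri 7 7);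
(1, Col 3); (1, Col 4)]) (Leaf 68 [:: (23, Col 3); (23, Tri 11 15); (32, Line 1 1); (3, Max 20); (3,
Max 19); (36, Tri 7 7); (11, Tri 15 15); (45, Line 1 4); (23, Max 4); (13, Tri 5 13); (42, Line 4
1); (13, Tri 13 22); (23, Col 4)])))))))) (Split 13 0 (Split 19 0 (Leaf 2 [:: (1, Line 4 1); (2,
Line 1 1); (1, Head 7); (1, Tri 15 15); (2, Line 1 4); (1, Max 20); (2, Low 5)]) (Split 20 0 (Leaf 2
[:: (1, Line 4 1); (2, Low 5); (2, Line 1 1); (1, Head 7); (1, Tri 15 15); (2, Line 1 4); (1, Max
19)]) (Leaf 4 [:: (1, Tri 1 19); (4, Line 1 1); (3, Head 7); (2, Max 19); (4, Line 1 4); (4, Low 5);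
(1, Line 4 1); (3, Tri 5 15)]))) (Split 20 0 (Split 19 0 (Leaf 2 [:: (1, Line 4 1); (2, Line 1 1);
(1, Head 7); (1, Max 13); (1, Tri 15 15); (2, Line 1 4); (2, Low 5)]) (Leaf 2 [:: (1, Tri 1 19); (2,
Line 1 1); (1, Tri 7 13); (2, Max 5); (2, Line 1 4); (1, Line 4 1); (4, Low 5)])) (Split 19 0 (Leaf
3 [:: (1, Line 4 1); (3, Line 1 1); (1, Tri 20 20); (2, Tri 7 13); (3, Line 1 4); (4, Low 5); (1,
Max 5)]) (Leaf 3 [:: (3, Line 1 1); (3, Max 5); (1, Tri 1 19); (1, Tri 7 13); (3, Line 1 4); (1, Tri
5 15); (2, Line 4 1); (7, Low 5)]))))) (Split 7 1 (Split 1 4 (Leaf 1 [:: (4, Max 5); (1, Col 2); (1,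
Col 3); (1, Col 4)]) (Leaf 3 [:: (1, Max 4); (2, Max 5); (2, Line 1 4); (1, Col 2); (2, Line 4 1);
(2, Tri 1 15); (1, Col 3); (2, Line 1 1); (1, Col 4)])) (Split 5 4 (Split 7 2 (Split 5 3 (Leaf 1 [::
(1, Col 2); (1, Col 3); (1, Col 4)]) (Split 4 0 (Leaf 1 [:: (1, Col 2); (1, Col 3); (1, Col 4)])
(Split 1 4 (Split 22 0 (Split 23 0 (Leaf 1 [:: (1, Max 4); (3, Max 5); (1, Col 2); (1, Col 3); (1,
Max 20)]) (Split 20 1 (Leaf 2 [:: (2, Max 4); (6, Max 5); (2, Col 2); (1, Tri 23 23); (2, Col 3)])
(Leaf 3 [:: (2, Max 4); (3, Max 5); (2, Col 2); (2, Tri 5 15); (1, Tri 23 23); (2, Col 3); (1, Line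
1 1); (1, Line 4 1); (1, Line 1 4)]))) (Split 23 0 (Leaf 1 [:: (3, Max 5); (1, Col 2); (1, Col 3);
(1, Max 20); (1, Tri 7 22)]) (Split 20 0 (Leaf 1 [:: (3, Max 5); (1, Col 2); (1, Col 3); (1, Tri 7
22); (1, Max 23)]) (Leaf 1 [:: (1, Tri 7 22); (1, Col 2); (1, Col 3); (1, Tri 5 15); (1, Tri 1
22)])))) (Split 4 3 (Split 11 0 (Split 17 0 (Leaf 1 [:: (1, Line 1 1); (1, Low 1); (1, Line 4 1);
(1, Max 23); (1, Tri 1 15)]) (Split 14 0 (Leaf 2 [:: (1, Line 1 4); (1, Max 13); (1, Line 1 1); (1,
Tri 1 15); (1, Col 3); (1, Line 4 1); (1, Col 4)]) (Leaf 7 [:: (5, Tri 14 17); (2, Max 13); (6, Max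
5); (5, Tri 1 15); (2, Col 3); (5, Line 1 1); (5, Line 4 1); (2, Col 4); (5, Max 23)]))) (Split 17 0
(Split 23 0 (Leaf 1 [:: (1, Line 1 1); (1, Max 11); (1, Tri 1 15); (1, Low 1); (1, Line 4 1)]) (Leaf
2 [:: (2, Line 1 1); (2, Max 4); (3, Low 1); (1, Tri 1 15); (2, Tri 11 15); (2, Line 4 1); (1, Tri
23 23)])) (Split 23 0 (Leaf 4 [:: (3, Tri 11 15); (4, Max 4); (4, Max 5); (1, Col 2); (3, Tri 1 16);
(1, Col 3); (3, Line 1 1); (3, Line 4 1); (1, Col 4)]) (Leaf 2 [:: (1, Tri 23 23); (2, Tri 11 15);
(2, Tri 1 16); (2, Line 1 1); (2, Line 4 1); (6, Low 1)])))) (Split 22 0 (Split 14 0 (Split 13 0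
(Leaf 2 [:: (1, Line 1 1); (1, Tri 1 15); (1, Col 3); (1, Line 4 1); (1, Max 20); (2, Line 1 4)])
(Split 11 0 (Leaf 7 [:: (4, Tri 1 15); (5, Max 5); (4, Line 1 4); (3, Tri 13 16); (3, Col 3); (4,
Line 4 1); (3, Col 4); (4, Line 1 1)]) (Leaf 7 [:: (4, Line 1 1); (1, Tri 1 15); (4, Line 1 4); (3,
Tri 11 15); (3, Tri 13 16); (3, Col 3); (4, Line 4 1); (3, Col 4); (5, Max 5)]))) (Split 18 0 (Leaf
3 [:: (2, Tri 1 15); (2, Tri 7 7); (1, Max 4); (1, Col 2); (1, Col 4); (1, Col 3); (2, Line 1 4);
(2, Line 4 1)]) (Split 13 0 (Split 11 0 (Leaf 1 [:: (1, Tri 7 7); (1, Col 3); (1, Col 4)]) (Leaf 7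
[:: (4, Line 4 1); (4, Line 1 4); (3, Col 4); (3, Tri 14 15); (1, Tri 1 15); (3, Tri 5 11); (3, Col
3); (4, Line 1 1); (2, Max 5)])) (Leaf 1 [:: (1, Tri 1 15); (1, Tri 1 13); (3, Low 1); (1, Tri 13
18); (1, Line 4 1); (1, Line 1 4)])))) (Split 23 0 (Leaf 2 [:: (1, Line 1 4); (1, Col 2); (1, Tri 1
15); (1, Col 3); (1, Line 1 1); (1, Line 4 1); (1, Max 20); (1, Tri 7 22)]) (Split 20 0 (Leaf 2 [::
(1, Line 1 4); (1, Col 2); (1, Line 4 1); (1, Tri 1 15); (1, Col 3); (1, Line 1 1); (1, Tri 7 22);
(1, Max 23)]) (Leaf 1 [:: (1, Tri 7 22); (1, Col 2); (1, Col 3); (1, Tri 5 15); (1, Tri 1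
22)])))))))) (Split 1 4 (Split 14 0 (Split 22 0 (Split 18 0 (Leaf 4 [:: (4, Tri 1 15); (1, Max 13);
(1, Max 20); (4, Line 1 4); (1, Max 19); (3, Line 4 1)]) (Split 13 0 (Split 20 0 (Leaf 1 [:: (2,
Head 7); (1, Col 3); (1, Line 1 4)]) (Leaf 1 [:: (1, Tri 1 15); (1, Tri 7 18); (1, Line 1 4)]))
(Leaf 7 [:: (5, Tri 1 15); (2, Col 3); (5, Tri 13 18); (2, Max 20); (4, Max 7); (5, Line 4 1); (7,
Line 1 4); (2, Max 5)]))) (Split 18 0 (Split 16 1 (Leaf 1 [:: (1, Low 7); (1, Tri 7 15); (1, Line 1
4); (1, Line 4 1)]) (Split 4 0 (Leaf 16 [:: (13, Tri 1 15); (11, Max 5); (12, Tri 7 15); (3, Col 2);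
(3, Col 4); (13, Line 1 4); (3, Col 3); (13, Line 4 1); (1, Line 1 1)]) (Leaf 16 [:: (13, Tri 1 15);
(3, Col 4); (3, Col 3); (3, Col 2); (11, Max 5); (13, Line 1 4); (1, Line 1 1); (13, Line 4 1); (3,
Tri 7 22); (9, Tri 7 15)]))) (Split 13 0 (Split 19 0 (Split 20 0 (Leaf 9 [:: (8, Tri 1 15); (8, Line
1 1); (11, Head 7); (6, Max 5); (1, Max 23); (8, Line 1 4); (1, Col 3); (1, Col 2)]) (Leaf 29 [::
(6, Tri 1 15); (3, Max 4); (26, Line 1 1); (28, Head 7); (3, Col 2); (14, Tri 5 15); (10, Tri 16
16); (26, Line 1 4); (3, Col 3); (6, Tri 20 20); (3, Col 4)])) (Split 4 0 (Leaf 7 [:: (3, Max 5);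
(6, Line 1 4); (1, Max 11); (6, Tri 7 15); (3, Tri 16 16); (1, Col 3); (6, Tri 1 18); (6, Max 20);
(1, Col 4)]) (Leaf 8 [:: (7, Line 1 4); (3, Max 5); (6, Tri 7 15); (1, Max 11); (3, Tri 16 16); (1,
Col 3); (1, Tri 1 15); (7, Tri 1 18); (7, Max 20); (1, Tri 7 22); (1, Col 4)]))) (Split 19 0 (Leaf 8
[:: (1, Tri 13 22); (2, Tri 1 15); (6, Tri 7 15); (3, Tri 16 16); (8, Line 1 4); (8, Tri 13 18); (7,
Max 20); (1, Col 4)]) (Split 20 0 (Leaf 5 [:: (5, Line 1 4); (4, Tri 13 18); (4, Tri 7 15); (2, Tri
16 16); (1, Col 3); (4, Max 19); (1, Tri 13 22)]) (Leaf 12 [:: (8, Tri 1 15); (2, Max 4); (2, Tri 16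
19); (16, Head 7); (2, Max 11); (2, Tri 5 13); (1, Tri 20 20); (2, Col 4); (2, Col 3); (8, Tri 1
18); (10, Tri 13 22); (10, Line 1 4); (8, Tri 5 15)])))))) (Split 11 0 (Split 13 0 (Leaf 2 [:: (3,
Tri 7 7); (2, Col 3); (2, Col 4)]) (Leaf 2 [:: (2, Max 4); (6, Max 5); (2, Tri 1 13); (3, Tri 7 7);
(2, Col 3); (2, Col 4)])) (Split 13 0 (Leaf 2 [:: (2, Max 4); (3, Tri 7 7); (2, Col 3); (6, Max 5);
(2, Tri 11 15); (2, Col 4)]) (Split 4 2 (Leaf 2 [:: (2, Tri 11 15); (2, Max 5); (3, Tri 7 7); (2,
Tri 1 13); (2, Col 3); (2, Col 4)]) (Split 22 0 (Split 18 0 (Leaf 3 [:: (2, Tri 1 15); (2, Tri 7 7);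
(1, Max 4); (1, Col 2); (1, Col 4); (1, Col 3); (2, Line 1 4); (2, Line 4 1)]) (Leaf 5 [:: (3, Tri 1
15); (2, Max 5); (5, Tri 7 7); (2, Max 20); (6, Low 7); (3, Tri 13 18); (2, Col 3); (3, Line 4 1);
(5, Line 1 4)])) (Leaf 3 [:: (1, Line 1 4); (2, Tri 7 7); (1, Tri 11 15); (2, Tri 1 13); (2, Col 4);
(1, Tri 5 11); (2, Col 3); (1, Line 4 1); (1, Max 18); (2, Tri 7 22)])))))) (Split 4 0 (Split 17 0
(Split 11 0 (Leaf 3 [:: (3, Line 1 1); (1, Max 15); (1, Max 16); (3, Line 4 1); (3, Max 23); (2, Tri
1 15)]) (Leaf 23 [:: (20, Line 1 1); (4, Tri 15 15); (9, Head 7); (6, Tri 11 15); (3, Col 2); (3,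
Max 20); (14, Tri 5 11); (3, Col 3); (3, Max 22); (20, Line 4 1); (23, Max 23); (6, Tri 1 15)]))
(Split 11 0 (Leaf 7 [:: (6, Tri 1 16); (1, Max 13); (1, Max 14); (3, Tri 15 15); (1, Head 7); (1,
Col 3); (6, Line 1 1); (6, Line 4 1); (1, Max 20); (1, Max 22); (7, Max 23)]) (Leaf 6 [:: (5, Tri 1
16); (3, Max 5); (3, Max 7); (1, Col 2); (5, Tri 11 15); (1, Col 3); (5, Line 1 1); (5, Line 4 1);
(1, Max 20); (1, Max 22); (6, Max 23)]))) (Split 14 0 (Split 22 0 (Split 18 0 (Leaf 4 [:: (4, Tri 1
15); (1, Max 13); (1, Max 20); (4, Line 1 4); (1, Max 19); (3, Line 4 1)]) (Split 20 0 (Split 13 0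
(Leaf 1 [:: (2, Head 7); (1, Col 3); (1, Line 1 4)]) (Leaf 7 [:: (5, Tri 1 15); (2, Col 3); (5, Tri
13 18); (2, Max 20); (4, Max 7); (5, Line 4 1); (7, Line 1 4); (2, Max 5)])) (Leaf 10 [:: (7, Tri 1
15); (2, Max 5); (3, Max 13); (1, Line 1 1); (3, Col 3); (6, Tri 7 18); (7, Line 4 1); (10, Line 1
4)]))) (Split 18 0 (Leaf 16 [:: (13, Tri 1 15); (3, Col 4); (3, Col 3); (3, Col 2); (11, Max 5);
(13, Line 1 4); (1, Line 1 1); (13, Line 4 1); (3, Tri 7 22); (9, Tri 7 15)]) (Split 23 0 (Split 11
0 (Leaf 1 [:: (1, Col 3); (1, Line 4 1); (1, Tri 7 22)]) (Leaf 1 [:: (1, Tri 11 15); (1, Tri 7 22);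
(1, Max 5); (1, Col 3); (1, Line 4 1)])) (Leaf 2 [:: (1, Tri 1 15); (1, Tri 7 22); (1, Max 5); (1,
Tri 1 22); (1, Max 11); (1, Col 3); (2, Line 4 1); (1, Line 1 4); (1, Tri 5 18)])))) (Split 22 0
(Split 18 0 (Leaf 3 [:: (2, Tri 1 15); (2, Tri 7 7); (1, Max 4); (1, Col 2); (1, Col 4); (1, Col 3);
(2, Line 1 4); (2, Line 4 1)]) (Split 13 0 (Split 11 0 (Leaf 2 [:: (3, Tri 7 7); (2, Col 3); (2, Col
4)]) (Leaf 14 [:: (8, Tri 1 15); (6, Max 4); (8, Line 1 4); (8, Line 4 1); (6, Tri 11 15); (9, Tri 7
7); (6, Col 3); (8, Line 1 1); (10, Max 5); (6, Col 4)])) (Leaf 5 [:: (3, Tri 1 15); (2, Max 5); (5,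
Tri 7 7); (2, Max 20); (6, Low 7); (3, Tri 13 18); (2, Col 3); (3, Line 4 1); (5, Line 1 4)])))
(Split 18 0 (Leaf 7 [:: (4, Tri 1 15); (1, Low 1); (4, Tri 7 7); (1, Tri 7 15); (3, Col 2); (3, Col
3); (4, Line 1 4); (4, Line 4 1); (3, Tri 7 22); (3, Col 4)]) (Split 13 0 (Split 11 0 (Leaf 2 [::
(3, Tri 7 7); (2, Col 3); (2, Col 4)]) (Leaf 14 [:: (8, Tri 1 15); (6, Max 4); (8, Line 1 4); (8,
Line 4 1); (6, Tri 11 15); (9, Tri 7 7); (6, Col 3); (8, Line 1 1); (10, Max 5); (6, Col 4)])) (Leaf
2 [:: (1, Line 1 4); (1, Low 1); (1, Tri 7 7); (1, Max 11); (1, Tri 1 13); (1, Col 4); (1, Tri 13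
18); (1, Col 3); (1, Line 4 1); (1, Tri 7 22); (1, Tri 1 15)])))))))) (Split 16 1 (Split 1 4 (Split
17 0 (Split 11 0 (Split 23 0 (Leaf 11 [:: (10, Line 1 1); (11, Max 4); (3, Max 5); (3, Max 7); (1,
Max 13); (1, Max 14); (10, Tri 1 15); (1, Col 4); (1, Col 3); (10, Line 4 1)]) (Leaf 33 [:: (30,
Line 1 1); (3, Col 2); (10, Tri 7 16); (3, Col 4); (10, Tri 23 23); (33, Max 4); (12, Tri 15 15);
(3, Col 3); (30, Line 4 1); (2, Tri 16 16); (6, Tri 1 15)])) (Split 23 0 (Leaf 23 [:: (20, Line 1
1); (3, Tri 1 15); (17, Tri 5 11); (23, Max 4); (7, Tri 15 15); (12, Head 7); (3, Col 2); (3, Tri 11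
15); (3, Col 3); (20, Line 4 1); (3, Col 4)]) (Leaf 2 [:: (2, Line 1 1); (2, Max 4); (2, Tri 5 11);
(1, Tri 15 15); (3, Low 5); (2, Line 4 1); (1, Tri 23 23)]))) (Split 17 1 (Split 23 0 (Split 11 0
(Leaf 23 [:: (20, Tri 1 16); (4, Head 7); (23, Max 4); (2, Max 7); (3, Max 13); (3, Max 14); (10,
Tri 15 15); (3, Col 3); (20, Line 1 1); (20, Line 4 1); (3, Max 20); (3, Max 22)]) (Leaf 2 [:: (2,
Max 4); (1, Tri 15 15); (1, Max 17); (1, Tri 1 16); (2, Tri 5 11); (2, Line 1 1); (2, Line 4 1); (3,
Low 5)])) (Split 11 0 (Split 23 2 (Leaf 2 [:: (2, Tri 1 16); (3, Low 5); (2, Max 4); (1, Tri 15 15);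
(2, Line 1 1); (2, Line 4 1); (2, Max 5)]) (Leaf 4 [:: (4, Line 1 1); (2, Tri 1 15); (1, Tri 15 15);
(2, Max 5); (3, Low 5); (4, Line 4 1); (4, Max 4); (2, Tri 23 23)])) (Split 23 2 (Leaf 2 [:: (2,
Line 1 1); (2, Tri 5 11); (2, Max 4); (1, Tri 15 15); (2, Line 4 1); (3, Low 5)]) (Split 22 0 (Split
18 0 (Leaf 9 [:: (3, Tri 15 15); (5, Tri 5 11); (3, Tri 11 15); (1, Line 1 4); (4, Tri 23 23); (9,
Max 14); (9, Line 4 1); (8, Max 4)]) (Leaf 2 [:: (2, Max 4); (2, Tri 5 11); (1, Tri 15 15); (2, Line
1 1); (2, Line 4 1); (2, Tri 5 18); (2, Tri 17 18); (7, Low 5)])) (Leaf 2 [:: (2, Tri 1 22); (2, Max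
4); (2, Tri 5 11); (1, Tri 15 15); (2, Line 1 1); (2, Line 4 1); (2, Max 5); (2, Tri 5 17); (7, Low
5)]))))) (Split 19 0 (Split 20 0 (Leaf 2 [:: (1, Low 5); (2, Line 1 1); (2, Low 17); (2, Tri 1 16);
(2, Line 1 4); (2, Head 7); (2, Max 13); (1, Tri 15 15)]) (Split 13 0 (Leaf 2 [:: (1, Low 5); (2,
Line 1 1); (1, Tri 15 15); (2, Max 20); (2, Tri 1 16); (2, Line 1 4); (2, Head 7); (2, Low 17)])
(Leaf 2 [:: (1, Line 4 1); (2, Line 1 1); (1, Tri 5 15); (1, Tri 7 13); (2, Line 1 4); (4, Low 5);
(1, Max 5)]))) (Split 7 3 (Split 13 0 (Leaf 2 [:: (2, Line 1 4); (1, Tri 15 15); (2, Tri 16 19); (5,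
Low 5); (2, Line 1 1); (2, Max 20)]) (Split 20 0 (Leaf 2 [:: (2, Line 1 4); (2, Max 13); (1, Tri 15
15); (2, Tri 16 19); (2, Line 1 1); (5, Low 5)]) (Leaf 1 [:: (1, Line 1 4); (3, Low 5); (1, Tri 7
13); (1, Tri 5 15); (1, Line 1 1); (1, Tri 16 19)]))) (Split 14 0 (Split 18 0 (Leaf 2 [:: (1, Low
5); (2, Low 17); (1, Tri 15 15); (2, Tri 1 16); (2, Line 1 4); (2, Max 22); (2, Line 4 1)]) (Leaf 2
[:: (2, Tri 1 16); (1, Tri 15 15); (3, Low 5); (2, Max 22); (2, Max 5); (2, Line 4 1); (2, Line 1
4); (2, Tri 1 17); (4, Low 17)])) (Leaf 5 [:: (1, Line 4 4); (3, Line 4 1); (3, Line 3 4); (1, Line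
3 3); (4, Line 1 0); (3, Line 0 3); (350, Low 7); (1, Col 3); (1, Line 0 2); (3, Line 2 2); (1, Line
1 4); (1, Line 3 2); (1, Line 1 3); (1, Line 2 1); (1, Line 0 1); (170, Tri 7 7); (1, Line 4
0)])))))) (Split 17 0 (Split 23 0 (Split 11 0 (Leaf 11 [:: (10, Line 1 1); (11, Max 4); (3, Max 5);
(3, Max 7); (1, Max 13); (1, Max 14); (10, Tri 1 15); (1, Col 4); (1, Col 3); (10, Line 4 1)]) (Leaf
23 [:: (20, Line 1 1); (3, Tri 1 15); (17, Tri 5 11); (23, Max 4); (7, Tri 15 15); (12, Head 7); (3,
Col 2); (3, Tri 11 15); (3, Col 3); (20, Line 4 1); (3, Col 4)])) (Split 11 0 (Leaf 33 [:: (30, Line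
1 1); (3, Col 2); (10, Tri 7 16); (3, Col 4); (10, Tri 23 23); (33, Max 4); (12, Tri 15 15); (3, Col
3); (30, Line 4 1); (2, Tri 16 16); (6, Tri 1 15)]) (Leaf 2 [:: (2, Line 1 1); (2, Max 4); (2, Tri 5
11); (1, Tri 15 15); (3, Low 5); (2, Line 4 1); (1, Tri 23 23)]))) (Split 23 0 (Split 11 0 (Leaf 23
[:: (20, Tri 1 16); (4, Head 7); (23, Max 4); (2, Max 7); (3, Max 13); (3, Max 14); (10, Tri 15 15);
(3, Col 3); (20, Line 1 1); (20, Line 4 1); (3, Max 20); (3, Max 22)]) (Leaf 2 [:: (2, Max 4); (1,
Tri 15 15); (1, Max 17); (1, Tri 1 16); (2, Tri 5 11); (2, Line 1 1); (2, Line 4 1); (3, Low 5)]))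
(Split 11 0 (Leaf 6 [:: (4, Tri 1 16); (4, Max 4); (11, Low 5); (3, Tri 15 15); (2, Tri 23 23); (6,
Line 1 1); (6, Line 4 1); (6, Max 5); (2, Line 1 4)]) (Split 23 2 (Leaf 1 [:: (1, Max 4); (2, Low
1); (1, Tri 11 15); (1, Line 1 1); (1, Line 4 1); (1, Tri 1 16)]) (Leaf 2 [:: (2, Tri 11 15); (4,
Low 1); (2, Max 4); (1, Tri 23 23); (2, Line 1 1); (2, Line 4 1); (2, Tri 1 16)])))))) (Split 11 0
(Split 17 0 (Split 23 0 (Leaf 11 [:: (10, Line 1 1); (11, Max 4); (3, Max 5); (3, Max 7); (1, Max
13); (1, Max 14); (10, Tri 1 15); (1, Col 4); (1, Col 3); (10, Line 4 1)]) (Leaf 33 [:: (30, Line 1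
1); (3, Col 2); (10, Tri 7 16); (3, Col 4); (10, Tri 23 23); (33, Max 4); (12, Tri 15 15); (3, Col
3); (30, Line 4 1); (2, Tri 16 16); (6, Tri 1 15)])) (Split 23 0 (Leaf 23 [:: (20, Tri 1 16); (4,
Head 7); (23, Max 4); (2, Max 7); (3, Max 13); (3, Max 14); (10, Tri 15 15); (3, Col 3); (20, Line 1
1); (20, Line 4 1); (3, Max 20); (3, Max 22)]) (Leaf 2 [:: (2, Tri 1 16); (2, Max 4); (3, Low 5);
(1, Tri 15 15); (1, Tri 23 23); (2, Line 1 1); (2, Line 4 1); (2, Max 5); (1, Low 16)]))) (Split 17
0 (Split 23 0 (Leaf 23 [:: (20, Line 1 1); (3, Tri 1 15); (17, Tri 5 11); (23, Max 4); (7, Tri 15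
15); (12, Head 7); (3, Col 2); (3, Tri 11 15); (3, Col 3); (20, Line 4 1); (3, Col 4)]) (Leaf 2 [::
(2, Line 1 1); (2, Max 4); (2, Tri 5 11); (1, Tri 15 15); (3, Low 5); (2, Line 4 1); (1, Tri 23
23)])) (Split 23 0 (Leaf 2 [:: (2, Max 4); (1, Tri 15 15); (1, Max 17); (1, Tri 1 16); (2, Tri 5
11); (2, Line 1 1); (2, Line 4 1); (3, Low 5)]) (Leaf 2 [:: (3, Low 16); (2, Max 4); (1, Tri 23 23);
(5, Low 5); (2, Tri 5 11); (1, Tri 15 15); (2, Tri 1 16); (2, Line 1 1); (2, Line 4 1); (2, Max
5)]))))))))) (Split 4 0 (Leaf 1 [:: (1, Col 2); (1, Col 3); (4, Tri 5 7); (1, Col 4)]) (Split 5 4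
(Split 7 1 (Leaf 1 [:: (1, Col 2); (1, Col 3); (1, Col 4)]) (Split 5 3 (Split 7 2 (Leaf 1 [:: (1,
Col 2); (1, Col 3); (1, Col 4)]) (Split 1 4 (Leaf 1 [:: (1, Col 2); (1, Max 4); (1, Col 3); (4, Tri
5 7); (1, Col 4)]) (Split 22 0 (Split 14 0 (Split 15 0 (Split 16 0 (Split 11 0 (Leaf 4 [:: (2, Line
1 4); (4, Tri 5 7); (1, Col 4); (1, Line 1 1); (2, Col 3); (3, Line 4 1); (1, Line 0 2)]) (Leaf 6
[:: (2, Tri 1 11); (4, Tri 5 7); (2, Col 3); (1, Col 4); (2, Max 18); (4, Line 1 4); (1, Line 1 1);
(5, Line 4 1); (1, Line 0 2)])) (Split 13 0 (Split 11 0 (Leaf 1 [:: (3, Tri 5 7); (1, Col 3); (1,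
Col 4)]) (Leaf 1 [:: (1, Tri 1 11); (1, Col 3); (3, Tri 5 7); (1, Col 4)])) (Leaf 6 [:: (1, Head 7);
(9, Tri 5 7); (4, Col 3); (2, Line 4 3); (2, Col 4); (2, Tri 1 12); (2, Tri 13 16); (4, Line 1 4);
(2, Line 4 1)]))) (Split 15 1 (Split 16 0 (Split 11 0 (Leaf 3 [:: (1, Line 1 4); (5, Tri 5 7); (1,
Col 4); (1, Low 7); (2, Col 3); (2, Line 4 1); (1, Line 0 2)]) (Leaf 22 [:: (2, Max 13); (22, Tri 5
7); (10, Col 3); (5, Max 18); (6, Col 4); (10, Tri 11 15); (12, Line 1 4); (3, Line 1 1); (1, Tri 15
15); (16, Line 4 1); (4, Line 0 2)])) (Split 11 0 (Leaf 3 [:: (1, Line 1 4); (1, Low 7); (5, Tri 5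
7); (2, Max 4); (1, Tri 1 15); (2, Col 3); (2, Line 4 1); (1, Col 4); (1, Line 0 2)]) (Leaf 3 [::
(2, Tri 1 11); (2, Max 4); (5, Tri 5 7); (1, Low 7); (1, Col 4); (1, Tri 1 15); (2, Col 3); (1, Line
0 2); (2, Line 4 1); (1, Line 1 4)]))) (Split 11 0 (Split 13 0 (Leaf 1 [:: (3, Tri 5 7); (1, Col 3);
(1, Col 4)]) (Leaf 1 [:: (1, Tri 1 12); (3, Tri 5 7); (1, Col 3); (1, Col 4)])) (Leaf 1 [:: (2, Low
15); (1, Col 2); (2, Tri 11 15); (1, Col 3); (4, Tri 5 7); (1, Max 4); (1, Col 4)])))) (Split 13 0
(Split 11 0 (Leaf 1 [:: (1, Tri 5 7); (1, Tri 7 7); (1, Col 3); (1, Col 4)]) (Leaf 2 [:: (2, Tri 1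
11); (3, Tri 7 7); (2, Col 3); (2, Col 4)])) (Split 11 0 (Leaf 1 [:: (1, Tri 1 13); (1, Col 3); (3,
Tri 5 7); (1, Col 4)]) (Leaf 1 [:: (1, Tri 1 11); (1, Max 4); (1, Tri 1 13); (1, Col 3); (3, Tri 5
7); (1, Col 4)])))) (Leaf 1 [:: (1, Low 7); (1, Col 2); (1, Tri 7 22); (1, Col 3); (4, Tri 5 7); (1,
Col 4)])))) (Split 1 4 (Leaf 1 [:: (1, Col 2); (1, Max 4); (1, Col 3); (4, Tri 5 7); (1, Col 4)])
(Split 4 3 (Leaf 1 [:: (1, Col 2); (1, Col 3); (4, Tri 5 7); (1, Col 4)]) (Split 22 0 (Split 20 0
(Split 13 0 (Leaf 1 [:: (1, Line 1 4); (2, Tri 5 7); (1, Col 3); (1, Line 1 1); (2, Low 5)]) (Leaf 3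
[:: (4, Low 5); (2, Line 1 4); (8, Tri 5 7); (1, Col 2); (1, Col 4); (3, Col 3); (2, Line 1 1); (1,
Max 4); (2, Tri 1 12)])) (Split 14 0 (Split 13 0 (Leaf 1 [:: (1, Line 1 4); (2, Tri 5 7); (1, Col
3); (1, Low 5)]) (Leaf 1 [:: (1, Tri 5 7); (1, Tri 12 20); (1, Tri 1 12); (1, Col 3); (1, Line 1
4)])) (Split 13 0 (Split 11 0 (Leaf 1 [:: (1, Tri 5 7); (1, Tri 7 7); (1, Col 3); (1, Col 4)]) (Leaf
5 [:: (5, Tri 1 11); (1, Tri 7 7); (5, Col 3); (2, Max 14); (13, Tri 5 7); (5, Col 4); (2, Line 1
1)])) (Leaf 1 [:: (1, Tri 12 20); (1, Tri 5 7); (1, Col 3); (1, Line 1 4); (1, Tri 1 13)])))) (Leaf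
1 [:: (1, Col 2); (1, Tri 7 22); (1, Col 3); (4, Tri 5 7); (1, Low 7); (1, Col 4)])))))) (Split 1 4
(Leaf 1 [:: (1, Col 2); (1, Max 4); (1, Col 3); (4, Tri 5 7); (1, Col 4)]) (Split 4 4 (Leaf 1 [::
(1, Col 2); (1, Col 3); (4, Tri 5 7); (1, Col 4)]) (Split 20 2 (Split 13 0 (Leaf 1 [:: (2, Low 5);
(1, Line 1 4); (2, Tri 5 7); (1, Col 3); (1, Line 1 1)]) (Leaf 3 [:: (2, Tri 1 12); (2, Line 1 4);
(4, Low 5); (8, Tri 5 7); (1, Col 2); (3, Col 3); (2, Line 1 1); (1, Max 4); (1, Col 4)])) (Split 15
0 (Split 16 0 (Leaf 3 [:: (1, Col 2); (1, Max 4); (2, Line 1 1); (2, Low 5); (1, Col 3); (1, Col 4);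
(4, Tri 5 7); (2, Line 1 4); (2, Line 4 1)]) (Split 17 0 (Split 11 0 (Split 13 0 (Leaf 1 [:: (1,
Line 1 1); (1, Low 5); (3, Tri 5 7); (1, Col 3); (1, Col 4)]) (Leaf 2 [:: (1, Col 2); (1, Line 1 1);
(1, Low 5); (1, Col 3); (1, Col 4); (4, Tri 5 7); (1, Line 1 4); (1, Line 4 1); (1, Tri 13 16)]))
(Leaf 1 [:: (1, Line 1 1); (1, Low 20); (1, Tri 5 11); (1, Tri 5 7); (1, Max 4); (1, Line 4 1); (1,
Low 5); (1, Col 4)])) (Leaf 2 [:: (1, Col 2); (1, Max 4); (1, Line 1 1); (1, Low 5); (1, Col 3); (1,
Col 4); (4, Tri 5 7); (1, Tri 1 16); (1, Line 1 4); (1, Line 4 1)]))) (Leaf 5 [:: (1, Line 3 3); (1,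
Line 3 4); (4, Line 1 1); (1, Line 3 2); (1, Line 3 0); (145, Tri 5 15); (4, Line 1 4); (160, Low
5); (1, Line 3 1); (4, Line 1 0); (4, Line 1 3); (4, Line 1 2); (140, Low 20)])))))))) (Split 4 0
(Leaf 1 [:: (3, Max 5); (1, Col 2); (1, Col 3); (1, Col 4); (4, Tri 7 24)]) (Leaf 1 [:: (4, Tri 7
24); (1, Tri 5 24); (1, Col 2); (1, Col 3); (3, Max 5); (1, Col 4)]))) (Split 4 0 (Leaf 1 [:: (4,
Tri 3 7); (1, Col 2); (1, Col 3); (1, Col 4)]) (Leaf 1 [:: (1, Col 2); (4, Tri 3 7); (1, Col 3); (1,
Tri 1 3); (1, Col 4)])))) (Split 7 0 (Split 3 0 (Split 13 0 (Split 23 0 (Split 11 0 (Split 15 0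
(Split 19 0 (Split 17 0 (Leaf 1 [:: (1, Line 4 4); (1, Line 1 1)]) (Split 24 0 (Leaf 1 [:: (1, Line
4 4); (1, Line 1 1)]) (Split 4 0 (Split 12 0 (Leaf 1 [:: (1, Line 1 1); (1, Line 3 1); (1, Max 20)])
(Leaf 5 [:: (3, Line 3 1); (2, Tri 5 12); (1, Max 8); (3, Line 4 4); (2, Max 16); (2, Col 4); (5,
Line 1 1)])) (Split 12 0 (Leaf 21 [:: (13, Line 3 1); (14, Line 4 4); (7, Tri 5 24); (3, Max 17);
(1, Max 14); (2, Max 16); (5, Col 3); (6, Max 20); (20, Line 1 1); (1, Col 4)]) (Leaf 6 [:: (3, Line
3 1); (1, Col 4); (2, Tri 5 24); (1, Head 8); (4, Line 4 4); (1, Max 16); (2, Tri 5 12); (1, Col 3);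
(1, Max 20); (5, Line 1 1)]))))) (Split 24 0 (Split 17 0 (Leaf 1 [:: (1, Line 4 4); (1, Line 1 1)])
(Split 12 0 (Split 20 0 (Leaf 13 [:: (3, Line 3 1); (5, Line 1 4); (8, Line 4 4); (3, Max 8); (5,
Col 3); (4, Tri 19 19); (13, Line 1 1)]) (Leaf 3 [:: (1, Tri 19 19); (2, Tri 8 17); (1, Col 3); (1,
Line 4 4); (3, Line 1 1)])) (Leaf 7 [:: (5, Tri 12 19); (2, Max 4); (5, Tri 5 12); (4, Head 8); (5,
Line 4 4); (2, Col 3); (1, Max 5); (2, Max 20); (7, Line 1 1)]))) (Split 17 0 (Leaf 9 [:: (8, Tri 5
19); (4, Head 8); (8, Line 4 4); (1, Col 4); (1, Col 3); (1, Col 2); (8, Line 1 1)]) (Split 17 1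
(Leaf 9 [:: (8, Tri 5 19); (4, Head 8); (8, Line 4 4); (1, Col 4); (1, Col 3); (1, Col 2); (8, Line
1 1)]) (Split 14 0 (Split 18 0 (Split 22 0 (Leaf 1 [:: (1, Tri 5 19); (1, Line 4 4)]) (Leaf 1 [::
(1, Tri 5 19); (1, Line 4 4); (1, Tri 5 17); (1, Head 7)])) (Leaf 1 [:: (1, Line 4 4); (1, Tri 1
17); (1, Tri 5 19)])) (Leaf 17 [:: (15, Tri 14 17); (15, Tri 5 19); (6, Head 8); (15, Line 4 4); (2,
Max 4); (2, Max 12); (3, Max 22); (2, Col 3); (3, Max 18); (2, Col 4); (12, Line 1 1)])))))) (Split
19 0 (Split 24 0 (Split 17 0 (Leaf 1 [:: (1, Line 4 4); (1, Line 1 1)]) (Split 14 0 (Split 22 0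
(Split 12 0 (Leaf 14 [:: (10, Line 1 1); (3, Line 1 4); (7, Line 3 1); (5, Tri 15 15); (11, Line 4
4); (4, Col 3); (3, Max 20)]) (Leaf 5 [:: (4, Line 1 1); (3, Head 8); (4, Line 4 4); (2, Tri 15 15);
(1, Col 3); (4, Tri 5 12); (1, Col 4)])) (Leaf 3 [:: (1, Tri 15 15); (3, Line 4 4); (1, Col 3); (2,
Tri 5 17); (1, Line 1 1)])) (Leaf 11 [:: (8, Tri 14 17); (4, Tri 15 15); (11, Line 4 4); (3, Max
22); (2, Max 5); (3, Col 3); (8, Line 1 1)]))) (Split 4 0 (Split 20 0 (Split 12 0 (Leaf 1 [:: (1,
Line 3 1); (1, Max 8); (1, Col 3); (1, Line 1 1)]) (Leaf 5 [:: (4, Line 1 1); (4, Tri 8 12); (1, Col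
2); (1, Col 4); (4, Line 3 1); (1, Col 3); (3, Max 16)])) (Split 12 0 (Leaf 7 [:: (6, Line 1 1); (6,
Tri 5 15); (2, Max 16); (1, Col 2); (3, Head 8); (6, Line 3 1); (1, Col 3); (1, Max 20); (1, Max
22); (1, Max 24)]) (Leaf 1 [:: (1, Tri 1 24); (1, Tri 8 12); (1, Col 3); (1, Line 1 1); (1, Max
8)]))) (Split 20 0 (Split 12 0 (Leaf 1 [:: (1, Tri 5 24); (1, Col 3); (1, Line 1 1)]) (Leaf 1 [::
(1, Tri 5 24); (1, Tri 8 12); (1, Col 3); (1, Line 1 1)])) (Split 12 0 (Leaf 1 [:: (1, Tri 1 24);
(1, Max 5); (1, Col 3); (1, Line 1 1); (1, Head 8); (1, Tri 5 24)]) (Leaf 11 [:: (2, Line 3 1); (3,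
Head 8); (5, Tri 5 24); (1, Tri 5 15); (6, Line 4 4); (2, Max 5); (4, Max 17); (5, Col 3); (4, Tri 1
24); (11, Line 1 1); (5, Tri 8 12)]))))) (Split 24 0 (Split 17 0 (Leaf 4 [:: (4, Tri 1 19); (4, Line
4 4); (1, Max 14); (1, Max 18); (1, Max 22); (3, Line 1 1)]) (Split 12 0 (Split 20 0 (Split 1 4
(Leaf 1 [:: (1, Max 5); (2, Max 8); (1, Col 3); (1, Line 1 1)]) (Leaf 7 [:: (3, Line 1 4); (5, Max
8); (1, Line 3 1); (4, Tri 1 19); (4, Line 4 4); (3, Col 3); (7, Line 1 1)])) (Leaf 14 [:: (9, Tri 8
17); (5, Max 5); (2, Max 15); (7, Tri 1 19); (5, Col 3); (14, Line 1 1); (1, Tri 19 19); (9, Line 4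
4)])) (Leaf 7 [:: (2, Max 20); (2, Max 4); (5, Tri 5 12); (5, Tri 1 19); (5, Line 4 4); (2, Col 3);
(7, Line 1 1); (4, Head 8); (1, Max 5)]))) (Split 17 0 (Leaf 7 [:: (2, Tri 1 19); (1, Max 4); (2,
Tri 15 15); (4, Head 8); (6, Line 4 4); (1, Col 2); (1, Col 3); (6, Tri 5 19); (1, Col 4); (6, Line
1 1)]) (Split 14 0 (Split 22 0 (Split 18 0 (Leaf 13 [:: (5, Tri 15 15); (3, Line 3 1); (12, Line 4
4); (2, Tri 1 19); (1, Col 3); (10, Tri 5 19); (1, Col 2)]) (Leaf 4 [:: (2, Line 3 1); (1, Tri 15
15); (4, Line 4 4); (2, Col 3); (2, Tri 1 18); (2, Tri 5 19)])) (Split 18 0 (Leaf 1 [:: (1, Line 4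
4); (1, Tri 1 19); (1, Tri 5 17)]) (Leaf 17 [:: (4, Tri 15 15); (16, Tri 5 17); (1, Col 2); (16,
Line 4 4); (1, Col 3); (8, Tri 1 18); (8, Tri 1 19); (1, Col 4); (8, Tri 24 24)]))) (Split 12 0
(Split 4 0 (Leaf 3 [:: (2, Tri 14 17); (1, Tri 15 15); (2, Tri 5 19); (2, Line 4 4); (1, Col 3); (2,
Line 1 1); (1, Max 8); (1, Col 4)]) (Leaf 55 [:: (39, Tri 14 17); (39, Line 4 4); (16, Tri 5 24);
(35, Head 8); (18, Tri 15 15); (3, Tri 1 19); (36, Tri 5 19); (16, Col 3); (39, Line 1 1); (13, Max
22); (13, Max 20); (3, Col 4)])) (Split 4 0 (Leaf 3 [:: (1, Tri 5 12); (1, Tri 15 15); (1, Tri 14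
17); (1, Head 8); (2, Line 4 4); (1, Col 3); (2, Line 1 1); (1, Col 4); (2, Tri 5 19)]) (Leaf 53 [::
(15, Tri 14 17); (40, Head 8); (15, Tri 5 24); (23, Tri 5 12); (5, Max 20); (14, Tri 15 15); (38,
Line 4 4); (15, Col 3); (38, Line 1 1); (10, Tri 1 19); (10, Col 4); (5, Max 22); (28, Tri 5
19)])))))))) (Split 24 0 (Split 12 0 (Split 20 0 (Leaf 1 [:: (1, Tri 8 8); (1, Col 3); (1, Line 1
1)]) (Split 15 0 (Split 19 0 (Split 17 0 (Leaf 1 [:: (1, Line 4 4); (1, Line 1 1)]) (Leaf 8 [:: (4,
Line 4 4); (4, Line 1 4); (2, Tri 8 8); (1, Col 4); (1, Col 2); (3, Tri 8 17); (1, Col 3); (1, Line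
0 1); (7, Line 1 1)])) (Split 17 0 (Split 16 0 (Leaf 11 [:: (10, Line 4 1); (8, Max 4); (3, Line 1
4); (7, Tri 8 8); (1, Max 5); (1, Col 2); (1, Col 4); (1, Col 3); (10, Line 1 1)]) (Leaf 29 [:: (20,
Tri 5 11); (4, Tri 8 8); (5, Col 4); (24, Line 4 4); (5, Col 2); (5, Col 3); (12, Tri 19 19); (24,
Line 1 1)])) (Split 16 0 (Leaf 17 [:: (16, Line 1 1); (6, Tri 8 17); (6, Tri 8 8); (1, Col 2); (10,
Line 1 4); (8, Tri 19 19); (1, Col 3); (7, Col 4)]) (Leaf 1 [:: (1, Tri 1 16); (1, Max 4); (1, Tri 8
11); (1, Line 1 1)])))) (Leaf 1 [:: (1, Tri 8 8); (1, Tri 5 15); (1, Col 3); (1, Line 1 1)])))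
(Split 20 0 (Leaf 1 [:: (1, Tri 8 8); (1, Tri 1 11); (1, Col 3); (1, Line 1 1); (1, Max 5)]) (Split
15 0 (Split 19 0 (Split 17 0 (Leaf 1 [:: (1, Line 4 4); (1, Line 1 1)]) (Leaf 5 [:: (1, Col 4); (1,
Line 1 4); (2, Tri 8 8); (1, Col 2); (4, Line 4 4); (1, Tri 1 11); (3, Tri 5 12); (1, Col 3); (4,
Line 1 1)])) (Split 17 0 (Leaf 15 [:: (5, Tri 1 11); (8, Max 5); (8, Tri 8 11); (13, Line 4 4); (5,
Tri 12 19); (2, Col 4); (2, Col 3); (2, Col 2); (13, Line 1 1)]) (Leaf 19 [:: (16, Tri 1 11); (1,
Line 1 4); (8, Max 5); (2, Tri 8 8); (10, Line 4 4); (8, Max 4); (9, Col 3); (5, Tri 19 19); (9, Tri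
8 17); (19, Line 1 1)]))) (Split 8 2 (Leaf 1 [:: (1, Max 4); (1, Tri 1 11); (1, Tri 5 15); (1, Col
3); (1, Line 1 1)]) (Leaf 1 [:: (1, Tri 1 11); (1, Tri 8 8); (1, Max 4); (1, Col 3); (1, Line 1 1);
(1, Tri 5 15)]))))) (Split 8 2 (Split 1 4 (Split 4 0 (Leaf 1 [:: (4, Max 5); (1, Col 2); (1, Col 3);
(1, Col 4)]) (Leaf 1 [:: (3, Max 5); (1, Col 2); (1, Col 3); (1, Col 4); (1, Tri 5 24)])) (Split 20
0 (Split 4 0 (Leaf 1 [:: (1, Tri 8 8); (1, Tri 11 24); (1, Col 3); (1, Line 1 1)]) (Leaf 1 [:: (1,
Tri 5 24); (1, Tri 8 8); (1, Col 3); (1, Line 1 1)])) (Split 4 0 (Leaf 1 [:: (1, Tri 1 24); (1, Tri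
8 8); (1, Col 3); (1, Line 1 1); (1, Max 12)]) (Leaf 1 [:: (1, Tri 5 24); (1, Max 12); (1, Tri 1
24); (1, Col 3); (1, Line 1 1); (1, Tri 8 8)])))) (Split 12 0 (Split 4 0 (Leaf 1 [:: (1, Tri 8 8);
(1, Col 3); (1, Line 1 1); (1, Tri 11 24)]) (Leaf 1 [:: (1, Tri 5 24); (1, Tri 8 8); (1, Col 3); (1,
Line 1 1)])) (Split 4 0 (Leaf 1 [:: (1, Tri 1 11); (1, Tri 8 8); (1, Tri 11 24); (1, Col 3); (1,
Line 1 1); (1, Max 20)]) (Leaf 1 [:: (1, Tri 5 24); (1, Tri 8 8); (1, Tri 1 11); (1, Col 3); (1,
Line 1 1); (1, Max 20)])))))) (Split 8 1 (Split 1 4 (Leaf 1 [:: (4, Max 5); (1, Col 2); (1, Col 3);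
(1, Col 4)]) (Split 4 0 (Leaf 1 [:: (3, Max 5); (1, Col 2); (1, Col 3); (1, Col 4); (4, Tri 8 23)])
(Split 24 0 (Split 20 0 (Leaf 3 [:: (9, Tri 8 23); (7, Max 5); (3, Col 2); (3, Col 3); (2, Line 1
1); (1, Max 22)]) (Split 15 0 (Split 19 0 (Leaf 2 [:: (4, Tri 8 23); (1, Line 1 4); (1, Line 1 1);
(1, Line 4 4); (3, Max 5); (1, Col 3); (1, Col 2); (1, Col 4)]) (Split 12 0 (Split 14 0 (Leaf 1 [::
(2, Max 5); (1, Line 1 4); (1, Col 3); (1, Col 4); (3, Tri 8 23)]) (Leaf 5 [:: (12, Tri 8 23); (2,
Line 1 4); (2, Line 1 1); (2, Line 4 4); (3, Col 2); (2, Tri 5 14); (3, Col 3); (8, Max 5); (3, Col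
4); (1, Max 4)])) (Leaf 5 [:: (12, Tri 8 23); (2, Line 1 4); (2, Line 1 1); (1, Max 4); (2, Line 4
4); (3, Col 2); (3, Col 3); (2, Tri 12 19); (3, Col 4); (10, Max 5)]))) (Leaf 3 [:: (9, Tri 8 23);
(4, Max 5); (3, Col 2); (3, Tri 5 15); (3, Col 3); (2, Line 1 1); (1, Max 22); (3, Max 4)]))) (Leaf
1 [:: (3, Max 5); (1, Col 2); (1, Col 3); (1, Col 4); (4, Tri 8 23); (1, Tri 5 24)])))) (Leaf 1 [::
(1, Low 8); (4, Max 5); (1, Col 2); (1, Col 3); (1, Col 4); (5, Tri 8 23)]))) (Split 4 0 (Leaf 1 [::
(1, Col 2); (4, Tri 5 8); (1, Col 3); (1, Col 4)]) (Split 5 4 (Split 8 1 (Leaf 1 [:: (1, Col 2); (1,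
Col 3); (1, Col 4)]) (Split 23 0 (Split 5 3 (Split 11 0 (Split 14 0 (Split 12 0 (Leaf 1 [:: (3, Tri
5 8); (1, Col 3); (1, Col 4)]) (Leaf 1 [:: (3, Tri 5 8); (1, Col 3); (1, Tri 1 12); (1, Col 4)]))
(Split 12 0 (Leaf 1 [:: (1, Tri 1 13); (1, Col 3); (3, Tri 5 8); (1, Col 4)]) (Leaf 1 [:: (1, Tri 1
12); (1, Tri 1 13); (3, Tri 5 8); (1, Max 4); (1, Col 3); (1, Col 4)]))) (Split 12 0 (Split 14 0
(Leaf 1 [:: (1, Tri 5 8); (1, Tri 8 8); (1, Col 3); (1, Col 4)]) (Leaf 2 [:: (3, Tri 8 8); (2, Tri 1
13); (2, Col 3); (2, Col 4)])) (Split 14 0 (Leaf 1 [:: (1, Tri 1 11); (3, Tri 5 8); (1, Col 3); (1,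
Col 4)]) (Leaf 1 [:: (3, Tri 5 8); (1, Tri 1 11); (1, Tri 1 13); (1, Col 3); (1, Max 4); (1, Col
4)])))) (Split 24 0 (Split 1 4 (Leaf 1 [:: (1, Max 4); (1, Col 2); (4, Tri 5 8); (1, Col 3); (1, Col
4)]) (Split 20 0 (Split 12 0 (Leaf 1 [:: (1, Line 1 4); (2, Tri 5 8); (1, Col 3); (1, Line 1 1); (2,
Low 5)]) (Leaf 3 [:: (1, Col 4); (2, Line 1 4); (4, Low 5); (1, Max 4); (8, Tri 5 8); (1, Col 2);
(3, Col 3); (2, Line 1 1); (2, Tri 1 12)])) (Split 11 0 (Split 12 0 (Leaf 1 [:: (1, Low 5); (1, Max
20); (2, Tri 5 8); (1, Col 3); (1, Line 1 1)]) (Leaf 1 [:: (1, Tri 1 12); (1, Tri 5 8); (1, Max 4);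
(1, Col 3); (1, Line 1 1); (1, Tri 13 20)])) (Split 12 0 (Split 14 0 (Leaf 1 [:: (1, Tri 5 8); (1,
Tri 8 8); (1, Col 3); (1, Col 4)]) (Leaf 3 [:: (1, Tri 8 8); (3, Tri 1 13); (3, Col 3); (7, Tri 5
8); (3, Col 4); (2, Line 1 4)])) (Leaf 1 [:: (1, Max 4); (1, Tri 13 20); (1, Tri 5 8); (1, Col 3);
(1, Line 1 1); (1, Tri 1 11)]))))) (Leaf 2 [:: (1, Head 8); (2, Col 2); (7, Tri 5 8); (2, Col 3);
(2, Tri 5 24); (2, Col 4)]))) (Leaf 1 [:: (1, Low 8); (4, Max 5); (1, Col 2); (1, Col 3); (1, Col
4); (5, Tri 8 23)]))) (Split 1 4 (Leaf 1 [:: (1, Max 4); (1, Col 2); (4, Tri 5 8); (1, Col 3); (1,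
Col 4)]) (Split 14 0 (Split 12 0 (Leaf 1 [:: (1, Low 5); (3, Tri 5 8); (1, Col 3); (1, Col 4); (1,
Line 1 4)]) (Leaf 1 [:: (3, Tri 5 8); (1, Col 3); (1, Low 5); (1, Col 4); (1, Line 1 4); (1, Tri 1
12)])) (Split 12 0 (Leaf 1 [:: (1, Low 5); (1, Tri 1 13); (1, Col 3); (3, Tri 5 8); (1, Col 4); (1,
Line 1 4)]) (Leaf 3 [:: (2, Low 5); (10, Tri 5 8); (2, Tri 1 13); (3, Col 3); (2, Tri 1 12); (1, Max
4); (3, Col 4); (2, Line 1 4); (1, Col 2)]))))))) (Split 4 0 (Leaf 1 [:: (4, Tri 3 5); (1, Col 2);
(1, Col 3); (1, Col 4)]) (Leaf 1 [:: (1, Col 2); (4, Tri 3 5); (1, Tri 1 3); (1, Col 3); (1, Col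
4)]))) (Split 3 0 (Split 4 0 (Leaf 1 [:: (1, Col 2); (4, Tri 1 7); (1, Col 4); (1, Col 3); (3, Max
5)]) (Split 5 3 (Leaf 1 [:: (4, Tri 1 7); (1, Col 2); (1, Max 4); (1, Col 3); (1, Col 4); (2, Low
1)]) (Split 24 0 (Split 7 1 (Split 8 1 (Split 1 4 (Split 11 0 (Split 12 0 (Split 13 0 (Leaf 1 [::
(1, Col 4); (1, Max 4); (3, Tri 1 7); (1, Max 14); (1, Col 3); (3, Max 5)]) (Split 14 0 (Leaf 1 [::
(3, Tri 1 7); (3, Max 5); (1, Max 13); (1, Col 3); (1, Max 4); (1, Col 4)]) (Leaf 1 [:: (3, Tri 1
7); (3, Max 5); (1, Col 4); (1, Tri 1 13); (1, Col 3)]))) (Split 13 0 (Split 23 0 (Leaf 1 [:: (1,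
Tri 5 7); (1, Max 4); (1, Max 20); (1, Col 3); (1, Line 1 1); (1, Tri 1 7)]) (Split 14 0 (Leaf 1 [::
(1, Col 4); (1, Max 4); (3, Tri 1 7); (1, Col 3); (3, Max 5); (1, Max 12)]) (Leaf 2 [:: (2, Max 4);
(4, Max 5); (2, Tri 5 7); (2, Col 3); (4, Tri 1 7); (1, Tri 14 14); (2, Col 4)]))) (Split 14 0 (Leaf
1 [:: (3, Tri 1 7); (1, Col 3); (1, Col 4); (1, Tri 1 12); (3, Max 5)]) (Leaf 1 [:: (3, Tri 1 7);
(1, Col 3); (1, Col 4); (1, Tri 1 12); (1, Tri 1 13); (3, Max 5); (1, Max 4)])))) (Split 11 1 (Split
12 0 (Split 13 0 (Split 23 0 (Leaf 1 [:: (2, Tri 1 7); (1, Col 3); (1, Max 4); (1, Max 5); (1, Line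
1 1); (1, Max 20)]) (Split 14 0 (Leaf 1 [:: (1, Max 11); (3, Tri 1 7); (3, Max 5); (1, Col 3); (1,
Col 4); (1, Max 4)]) (Leaf 2 [:: (2, Max 4); (1, Tri 14 14); (2, Col 4); (2, Col 3); (6, Tri 1 7);
(6, Max 5)]))) (Split 14 0 (Leaf 1 [:: (3, Tri 1 7); (1, Col 4); (1, Tri 5 8); (1, Col 3); (2, Max
5)]) (Leaf 1 [:: (3, Tri 1 7); (1, Col 4); (1, Tri 1 13); (3, Max 5); (1, Col 3)]))) (Split 12 1
(Split 13 0 (Split 14 0 (Leaf 1 [:: (3, Tri 1 7); (3, Max 5); (1, Col 3); (1, Tri 1 11); (1, Col
4)]) (Split 20 0 (Leaf 1 [:: (1, Col 3); (1, Line 1 1); (1, Line 1 4)]) (Split 23 0 (Leaf 3 [:: (6,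
Tri 1 7); (1, Col 4); (1, Tri 12 20); (3, Max 4); (2, Tri 1 11); (5, Max 5); (3, Col 3); (2, Line 1
1); (1, Tri 11 14)]) (Split 22 0 (Leaf 2 [:: (5, Tri 1 7); (5, Max 5); (2, Col 3); (2, Max 4); (1,
Col 4); (2, Tri 1 11); (1, Tri 14 14); (1, Max 20)]) (Leaf 1 [:: (2, Tri 1 7); (1, Tri 11 14); (1,
Max 4); (1, Col 3); (1, Tri 1 11); (1, Tri 1 22); (2, Max 5)]))))) (Split 14 0 (Leaf 1 [:: (1, Tri 1
12); (1, Max 4); (3, Tri 1 7); (3, Max 5); (1, Col 3); (1, Tri 1 11); (1, Col 4)]) (Leaf 1 [:: (3,
Tri 1 7); (1, Col 4); (1, Col 3); (1, Max 4); (1, Tri 1 11); (1, Tri 1 13); (3, Max 5)]))) (Leaf 1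
[:: (4, Low 12); (1, Col 2); (1, Col 3); (4, Tri 5 7); (1, Max 4); (1, Col 4)]))) (Split 11 2 (Split
12 0 (Split 13 0 (Split 14 0 (Leaf 1 [:: (1, Max 11); (3, Tri 1 7); (3, Max 5); (1, Col 3); (1, Col
4); (1, Max 4)]) (Split 20 0 (Leaf 1 [:: (1, Col 3); (1, Line 1 1); (1, Line 1 4)]) (Split 23 0
(Leaf 1 [:: (1, Max 22); (2, Max 5); (1, Max 4); (2, Tri 1 7); (1, Col 3); (1, Tri 11 14)]) (Leaf 2
[:: (2, Max 4); (1, Tri 11 14); (4, Max 5); (2, Col 3); (1, Line 1 1); (4, Tri 1 7); (1, Col 4); (1,
Tri 8 23)])))) (Split 14 0 (Leaf 1 [:: (1, Col 4); (1, Tri 5 8); (3, Tri 1 7); (1, Max 4); (1, Col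
3); (2, Max 5)]) (Leaf 1 [:: (3, Tri 1 7); (1, Col 4); (1, Tri 1 13); (1, Max 4); (1, Col 3); (3,
Max 5)]))) (Split 13 0 (Split 23 0 (Leaf 1 [:: (1, Tri 1 11); (1, Max 20); (2, Tri 1 7); (1, Col 3);
(1, Max 5); (1, Line 1 1); (1, Max 4)]) (Split 14 2 (Leaf 1 [:: (3, Tri 1 7); (1, Max 4); (3, Max
5); (1, Col 3); (1, Tri 1 11); (1, Col 4)]) (Leaf 2 [:: (2, Low 11); (1, Tri 14 14); (2, Max 4); (2,
Col 3); (4, Tri 1 11); (2, Col 4); (6, Max 5); (6, Tri 1 7)]))) (Split 14 0 (Leaf 1 [:: (1, Tri 1
12); (1, Max 4); (3, Tri 1 7); (3, Max 5); (1, Col 3); (1, Tri 1 11); (1, Col 4)]) (Leaf 1 [:: (3,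
Tri 1 7); (1, Col 4); (1, Col 3); (1, Max 4); (1, Tri 1 11); (1, Tri 1 13); (3, Max 5)])))) (Split
12 0 (Split 15 0 (Split 16 0 (Split 18 0 (Split 19 0 (Leaf 1 [:: (1, Col 4); (3, Tri 1 7); (3, Max
5); (1, Max 17); (1, Col 2); (1, Max 4)]) (Split 22 0 (Leaf 1 [:: (1, Tri 1 7); (1, Low 11); (1, Max
5); (1, Line 1 4); (1, Col 2); (1, Line 4 1)]) (Split 14 0 (Leaf 1 [:: (1, Max 22); (1, Line 1 4);
(1, Line 4 1)]) (Leaf 1 [:: (2, Tri 1 7); (3, Low 11); (1, Tri 11 11); (1, Max 20); (1, Tri 5 14);
(1, Line 1 4); (1, Col 2)])))) (Split 19 0 (Leaf 1 [:: (1, Col 4); (3, Max 5); (1, Col 2); (3, Tri 1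
7); (1, Tri 11 18); (1, Low 11); (1, Max 17)]) (Split 17 0 (Leaf 1 [:: (1, Max 19); (3, Tri 1 7);
(1, Low 11); (1, Tri 11 18); (1, Col 4); (1, Col 2); (3, Max 5)]) (Leaf 1 [:: (1, Tri 1 17); (1, Col
2); (1, Tri 1 18); (1, Max 4); (1, Col 4); (3, Max 5); (3, Tri 1 7)])))) (Leaf 1 [:: (1, Tri 1 7);
(4, Low 11); (4, Tri 5 11); (1, Col 2); (1, Col 3); (1, Col 4)])) (Leaf 1 [:: (5, Low 11); (4, Max
5); (1, Col 2); (1, Col 3); (5, Tri 11 15); (1, Col 4)])) (Leaf 1 [:: (5, Low 11); (4, Max 5); (1,
Col 2); (1, Col 3); (5, Tri 1 11); (1, Col 4)]))))) (Split 5 4 (Leaf 1 [:: (3, Max 5); (1, Col 2);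
(4, Tri 1 7); (1, Col 4); (1, Col 3)]) (Split 20 1 (Split 23 0 (Leaf 3 [:: (9, Tri 1 7); (7, Max 5);
(1, Max 22); (2, Line 1 1); (3, Col 2); (3, Col 3)]) (Leaf 3 [:: (10, Tri 1 7); (2, Line 1 1); (2,
Tri 8 23); (3, Col 2); (3, Max 4); (3, Col 3); (8, Max 5); (1, Col 4)])) (Split 15 0 (Split 11 0
(Split 17 0 (Split 23 0 (Split 22 0 (Leaf 2 [:: (1, Col 2); (3, Tri 1 7); (1, Line 4 4); (1, Line 1
1); (3, Max 5); (1, Col 3); (1, Line 4 1)]) (Leaf 2 [:: (3, Tri 1 7); (1, Col 3); (1, Line 4 4); (1,
Col 2); (3, Max 5); (1, Tri 7 22); (1, Line 4 1); (1, Line 1 1)])) (Split 22 0 (Leaf 5 [:: (3, Col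
2); (3, Max 4); (10, Tri 1 7); (2, Line 4 4); (1, Col 4); (10, Max 5); (2, Line 1 1); (4, Tri 8 23);
(2, Line 4 1); (3, Col 3)]) (Leaf 5 [:: (10, Tri 1 7); (3, Max 4); (4, Tri 1 22); (1, Col 4); (2,
Line 4 4); (10, Max 5); (3, Col 2); (2, Line 4 1); (2, Line 1 1); (3, Col 3)]))) (Split 16 0 (Split
12 0 (Leaf 5 [:: (3, Col 3); (3, Max 4); (2, Line 1 1); (14, Tri 1 7); (10, Max 5); (3, Col 2); (2,
Line 1 4); (3, Col 4); (2, Line 4 1)]) (Leaf 3 [:: (2, Col 2); (2, Max 4); (1, Line 1 1); (6, Max
5); (1, Line 4 1); (9, Tri 1 7); (2, Col 3); (1, Line 1 4); (1, Tri 5 7); (2, Col 4)])) (Split 19 0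
(Leaf 3 [:: (3, Tri 1 16); (9, Tri 1 7); (7, Max 5); (3, Col 2); (3, Max 4); (3, Col 4); (1, Max
18); (2, Line 1 1)]) (Leaf 2 [:: (1, Tri 1 16); (2, Col 2); (2, Max 4); (1, Line 1 1); (2, Col 4);
(1, Tri 16 19); (1, Col 3); (5, Max 5); (7, Tri 1 7)])))) (Split 16 0 (Split 12 0 (Leaf 5 [:: (3,
Col 3); (3, Max 4); (2, Line 1 1); (14, Tri 1 7); (10, Max 5); (3, Col 2); (2, Line 1 4); (3, Col
4); (2, Line 4 1)]) (Leaf 3 [:: (2, Col 2); (2, Max 4); (1, Line 1 1); (6, Max 5); (1, Line 4 1);
(9, Tri 1 7); (2, Col 3); (1, Line 1 4); (1, Tri 5 7); (2, Col 4)])) (Split 12 0 (Leaf 3 [:: (2, Col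
3); (2, Col 2); (1, Line 1 1); (6, Max 5); (1, Tri 5 11); (2, Max 4); (1, Line 1 4); (1, Line 4 1);
(2, Col 4); (9, Tri 1 7)]) (Split 13 0 (Leaf 3 [:: (9, Tri 1 7); (2, Line 1 1); (1, Max 14); (3, Col
3); (3, Tri 1 11); (3, Col 4); (7, Max 5); (3, Max 4)]) (Leaf 2 [:: (1, Line 1 1); (6, Max 5); (7,
Tri 1 7); (1, Col 2); (2, Col 4); (2, Col 3); (2, Max 4); (1, Tri 1 11); (1, Tri 1 12)]))))) (Leaf 1
[:: (1, Low 20); (1, Col 2); (1, Col 3); (1, Tri 5 15); (3, Max 5); (1, Col 4); (4, Tri 1 7)])))))
(Leaf 1 [:: (4, Max 5); (1, Col 2); (1, Low 8); (5, Tri 1 7); (1, Col 4); (1, Col 3)])) (Leaf 1 [::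
(4, Max 5); (1, Col 2); (5, Tri 1 7); (1, Col 4); (1, Col 3); (1, Low 7)])) (Leaf 1 [:: (1, Col 2);
(3, Max 5); (1, Col 4); (1, Col 3); (1, Tri 5 24); (4, Tri 1 7)])))) (Split 4 0 (Leaf 2 [:: (8, Tri
1 7); (2, Col 2); (1, Tri 3 3); (2, Col 4); (2, Col 3); (7, Max 5)]) (Leaf 1 [:: (4, Tri 1 7); (1,
Tri 1 3); (1, Col 2); (1, Col 4); (1, Col 3); (4, Max 5)]))))) (Split 3 0 (Split 7 0 (Split 1 4
(Leaf 1 [:: (4, Head 8); (1, Col 2); (4, Tri 5 5); (1, Col 3); (1, Col 4)]) (Split 4 0 (Leaf 1 [::
(4, Head 8); (1, Col 2); (4, Tri 5 5); (1, Col 3); (1, Col 4)]) (Split 24 0 (Split 8 0 (Leaf 1 [::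
(2, Tri 5 5); (1, Col 2); (1, Col 3); (1, Col 4)]) (Split 23 0 (Split 20 0 (Split 22 0 (Leaf 1 [::
(3, Tri 5 5); (3, Head 8); (1, Col 2); (1, Col 3)]) (Split 17 0 (Split 19 0 (Split 11 0 (Leaf 2 [::
(3, Tri 5 5); (3, Head 8); (1, Line 2 4); (1, Line 4 4); (1, Col 2); (1, Col 3); (1, Line 1 1)])
(Leaf 2 [:: (2, Tri 11 22); (3, Tri 5 5); (2, Tri 8 8); (2, Col 2); (2, Col 3)])) (Leaf 2 [:: (6,
Head 8); (6, Tri 5 5); (2, Col 2); (2, Col 3); (1, Tri 22 22)])) (Leaf 2 [:: (6, Head 8); (5, Tri 5
5); (2, Col 2); (2, Tri 5 17); (2, Col 3)]))) (Split 22 0 (Leaf 2 [:: (5, Tri 5 5); (2, Max 4); (2,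
Tri 10 20); (6, Head 8); (2, Col 2); (2, Col 3)]) (Split 12 0 (Split 13 0 (Split 11 0 (Leaf 1 [::
(1, Tri 5 5); (2, Head 8); (1, Tri 10 20); (1, Col 3); (1, Line 1 1)]) (Leaf 1 [:: (1, Max 4); (1,
Tri 5 5); (2, Head 8); (1, Tri 1 10); (1, Tri 10 20); (1, Col 3); (1, Line 1 1)])) (Split 11 0 (Leaf
1 [:: (1, Tri 5 5); (1, Tri 13 20); (1, Col 3); (1, Line 1 1); (1, Head 8)]) (Leaf 2 [:: (1, Tri 1
10); (1, Tri 10 20); (1, Tri 13 20); (1, Tri 8 8); (1, Tri 5 8); (2, Col 3); (2, Line 1 1); (1, Max
4)]))) (Split 12 1 (Split 13 0 (Split 11 0 (Leaf 1 [:: (1, Tri 5 5); (1, Tri 10 20); (2, Head 8);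
(1, Col 3); (1, Line 1 1)]) (Leaf 1 [:: (1, Tri 1 11); (1, Tri 10 20); (2, Head 8); (1, Tri 5 5);
(1, Max 4); (1, Col 3); (1, Line 1 1)])) (Split 11 0 (Leaf 1 [:: (1, Tri 10 20); (1, Tri 5 5); (2,
Head 8); (1, Tri 1 12); (1, Col 3); (1, Line 1 1); (1, Max 4)]) (Leaf 3 [:: (6, Tri 5 5); (3, Max
4); (2, Tri 1 10); (8, Head 8); (1, Col 2); (2, Tri 1 12); (3, Col 3); (2, Line 1 1); (2, Tri 10
20); (1, Col 4)]))) (Split 13 0 (Split 11 0 (Split 14 0 (Leaf 6 [:: (15, Tri 5 5); (4, Col 4); (14,
Head 8); (2, Line 4 4); (6, Col 3); (2, Tri 10 12); (2, Line 2 1)]) (Leaf 4 [:: (9, Tri 5 5); (4,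
Tri 1 14); (2, Tri 10 12); (2, Line 4 4); (4, Col 3); (2, Col 4); (8, Head 8)])) (Leaf 1 [:: (1, Col
2); (4, Head 8); (1, Col 3); (1, Low 12); (1, Tri 1 11); (1, Col 4); (4, Tri 5 5)])) (Leaf 1 [:: (2,
Tri 1 12); (4, Head 8); (1, Max 4); (1, Col 2); (2, Low 12); (1, Col 3); (1, Col 4); (4, Tri 5
5)])))))) (Leaf 1 [:: (1, Max 8); (1, Col 2); (1, Col 3); (1, Max 4); (1, Col 4); (3, Tri 8 23); (2,
Tri 5 5)]))) (Leaf 2 [:: (8, Head 8); (2, Col 2); (7, Tri 5 5); (2, Col 3); (2, Col 4); (2, Tri 5
24)])))) (Split 8 0 (Split 4 0 (Leaf 1 [:: (4, Head 7); (4, Tri 5 5); (1, Col 2); (1, Col 3); (1,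
Col 4)]) (Split 22 0 (Split 24 0 (Split 20 0 (Split 23 0 (Leaf 1 [:: (3, Head 7); (3, Tri 5 5); (1,
Col 2); (1, Col 3)]) (Split 14 0 (Split 13 0 (Leaf 4 [:: (9, Tri 5 5); (2, Col 2); (2, Line 2 1);
(4, Col 3); (2, Line 1 4); (10, Head 7)]) (Leaf 6 [:: (2, Line 2 1); (15, Tri 5 5); (2, Line 1 4);
(4, Col 2); (16, Head 7); (6, Col 3); (2, Tri 10 13)])) (Leaf 2 [:: (2, Tri 14 23); (3, Tri 5 5);
(2, Col 2); (2, Tri 7 7); (2, Col 3)]))) (Split 23 0 (Leaf 2 [:: (6, Head 7); (5, Tri 5 5); (2, Col
2); (2, Tri 10 20); (2, Col 3)]) (Split 14 0 (Split 12 0 (Split 13 0 (Leaf 1 [:: (1, Tri 5 5); (1,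
Col 3); (1, Line 1 4); (1, Tri 10 20); (2, Head 7)]) (Split 11 0 (Leaf 6 [:: (14, Head 7); (15, Tri
5 5); (4, Col 4); (2, Tri 10 13); (2, Line 2 4); (6, Col 3); (2, Line 4 1)]) (Leaf 4 [:: (4, Tri 1
10); (9, Tri 5 5); (8, Head 7); (2, Col 4); (4, Col 3); (2, Line 4 1); (2, Max 4); (2, Tri 10
13)]))) (Split 11 0 (Leaf 1 [:: (1, Tri 5 5); (1, Tri 12 23); (1, Col 3); (1, Line 4 1); (1, Head
7)]) (Leaf 2 [:: (2, Tri 5 5); (1, Tri 1 11); (2, Head 7); (1, Max 4); (2, Col 3); (1, Tri 12 23);
(2, Line 4 1); (1, Line 1 4)]))) (Split 12 0 (Split 11 0 (Leaf 1 [:: (1, Tri 5 5); (1, Col 3); (1,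
Line 4 1); (1, Tri 14 23)]) (Leaf 1 [:: (1, Tri 1 10); (1, Tri 5 5); (1, Max 4); (1, Tri 14 23); (1,
Col 3); (1, Line 4 1)])) (Split 11 0 (Leaf 1 [:: (1, Tri 1 14); (1, Tri 5 5); (1, Tri 12 23); (1,
Max 4); (1, Col 3); (1, Line 4 1); (1, Head 7)]) (Leaf 1 [:: (1, Max 4); (1, Tri 5 5); (1, Line 4
1); (1, Col 3); (1, Tri 1 11); (1, Tri 14 23)])))))) (Leaf 1 [:: (1, Max 7); (1, Max 4); (1, Col 2);
(2, Tri 5 5); (1, Col 3); (1, Col 4); (3, Tri 7 24)])) (Leaf 2 [:: (2, Tri 7 22); (6, Head 7); (7,
Tri 5 5); (2, Col 2); (2, Col 3); (2, Col 4)]))) (Leaf 1 [:: (4, Tri 1 7); (1, Col 2); (1, Col 4);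
(1, Col 3); (1, Max 4); (2, Max 5); (1, Tri 5 5)]))) (Split 4 0 (Split 7 0 (Leaf 2 [:: (1, Tri 3 3);
(8, Head 8); (8, Tri 5 5); (2, Col 2); (2, Col 3); (2, Col 4)]) (Split 8 0 (Leaf 2 [:: (1, Tri 3 3);
(8, Head 7); (8, Tri 5 5); (2, Col 2); (2, Col 3); (2, Col 4)]) (Leaf 2 [:: (2, Col 2); (5, Low 1);
(2, Max 4); (2, Col 4); (4, Tri 5 5); (2, Col 3); (8, Tri 1 7); (1, Tri 3 3)]))) (Split 7 0 (Leaf 1
[:: (1, Tri 1 3); (4, Head 8); (1, Col 2); (1, Col 3); (1, Col 4); (4, Tri 5 5)]) (Split 8 0 (Leaf 1
[:: (1, Tri 1 3); (4, Head 7); (1, Col 2); (1, Col 3); (4, Tri 5 5); (1, Col 4)]) (Leaf 2 [:: (2,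
Col 2); (5, Low 1); (2, Max 4); (2, Col 4); (4, Tri 5 5); (2, Col 3); (8, Tri 1 7); (1, Tri 3
3)]))))))) (Split 7 0 (Leaf 1 [:: (4, Low 1); (1, Max 4); (1, Max 2); (4, Head 8); (8, Tri 5 21);
(1, Col 2); (1, Col 3); (1, Col 4); (1, Max 3)]) (Split 8 0 (Leaf 1 [:: (1, Max 2); (1, Col 2); (8,
Tri 5 21); (4, Low 1); (1, Col 3); (1, Max 4); (1, Max 3); (1, Col 4); (4, Head 7)]) (Leaf 1 [:: (4,
Tri 5 21); (4, Tri 1 7); (5, Low 1); (1, Col 2); (1, Col 4); (1, Max 3); (1, Col 3); (1, Max 4)]))))
(Split 7 0 (Leaf 1 [:: (1, Col 3); (1, Max 3); (1, Max 4); (1, Col 4); (4, Head 8); (8, Tri 1 9);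
(1, Max 2); (4, Low 1); (1, Col 2)]) (Split 8 0 (Leaf 1 [:: (1, Max 4); (1, Col 2); (4, Low 1); (1,
Col 4); (1, Col 3); (8, Tri 1 9); (4, Head 7); (1, Max 2); (1, Max 3)]) (Leaf 1 [:: (4, Tri 1 9);
(1, Col 2); (1, Max 3); (1, Col 3); (1, Col 4); (1, Max 4); (5, Low 1); (4, Tri 1 7)])))) (Split 9 0
(Split 8 0 (Leaf 1 [:: (1, Col 4); (1, Col 3); (1, Max 4); (1, Col 2); (4, Head 7); (8, Tri 1 5);
(1, Max 3); (4, Low 1); (1, Max 2)]) (Split 7 0 (Leaf 1 [:: (1, Col 2); (4, Low 1); (1, Max 4); (4,
Head 8); (1, Max 2); (1, Max 3); (1, Col 3); (1, Col 4); (8, Tri 1 5)]) (Leaf 1 [:: (1, Max 3); (1,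
Col 4); (4, Tri 1 7); (1, Col 3); (1, Max 4); (4, Tri 1 5); (5, Low 1); (1, Col 2)]))) (Split 8 0
(Leaf 1 [:: (1, Col 4); (1, Max 3); (1, Max 4); (4, Tri 1 5); (4, Low 1); (4, Tri 1 9); (1, Max 2);
(1, Col 2); (1, Col 3); (4, Head 7)]) (Split 7 0 (Leaf 1 [:: (1, Col 2); (4, Low 1); (1, Col 3); (4,
Tri 1 9); (1, Max 4); (1, Max 2); (4, Tri 1 5); (1, Max 3); (4, Head 8); (1, Col 4)]) (Split 3 0
(Leaf 1 [:: (2, Head 8); (4, Tri 1 5); (1, Col 3); (1, Max 4); (1, Col 4); (2, Tri 1 7); (2, Head
7); (1, Col 2); (8, Low 1); (4, Tri 1 9)]) (Split 4 0 (Leaf 1 [:: (2, Head 7); (1, Max 3); (8, Low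
1); (2, Tri 1 7); (4, Tri 1 9); (1, Col 2); (2, Head 8); (1, Col 3); (4, Tri 1 5); (1, Col 4)])
(Leaf 1 [:: (4, Tri 1 9); (10, Low 1); (1, Tri 1 3); (2, Head 7); (2, Head 8); (1, Col 3); (2, Tri 1
7); (1, Col 4); (1, Col 2); (4, Tri 1 5)]))))))))) (Leaf 5 [:: (3, Line 1 1); (1, Line 4 4); (350,
Low 1); (1, Line 3 4); (170, Tri 1 1); (3, Line 4 1); (1, Line 0 4); (1, Line 0 2); (1, Line 4 2);
(1, Line 2 2); (1, Line 3 2); (1, Line 1 4); (1, Line 1 2); (3, Line 0 1); (1, Line 2 4); (3, Line 3
1); (3, Line 2 1)])) (Leaf 5 [:: (375, Low 1); (2, Line 1 1); (1, Line 4 4); (1, Line 1 2); (1, Line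
3 4); (185, Tri 0 1); (2, Line 3 1); (1, Line 0 3); (1, Line 0 4); (2, Line 2 1); (1, Line 0 2); (1,
Line 4 2); (1, Line 2 2); (2, Line 4 1); (1, Line 3 2); (1, Line 1 3); (1, Line 2 3); (1, Line 4 3);
(2, Line 0 1); (1, Line 2 4); (1, Line 1 4); (1, Line 3 3)])).

Lemma no_extremal_grid x N : ~ extremal_grid x N.
Proof.
move=> xG; have /negP[] := extremal_grid_check xG certificate.
by vm_compute.
Qed.

Local Open Scope ring_scope.

(** * Triples of cosets *)

Section Dyson.

Variable G : finZmodType.
Implicit Types (X Y Z : {set G}) (H K : {group G}).

Lemma card_shift X a : #|[set x + a | x in X]| = #|X|.
Proof. by apply: card_imset; apply: addIr. Qed.

(** In a finite group closure under the operation suffices, so the inclusion of X + h in X can be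
    used instead of equality. *)
Lemma stabilizer_group K X :
  group_set [set h in K | [forall x in X, x + h \in X]].
Proof.
apply/group_setP; split=> [|h k].
  rewrite inE group1; apply/forall_inP=> x Xx.
  by rewrite (_ : x + _ = x) // addr0.
rewrite !inE => /andP[Kh /forall_inP sh] /andP[Kk /forall_inP sk].
rewrite groupM //=; apply/forall_inP=> x Xx.
by rewrite (_ : x + _ = x + h + k) ?sk ?sh // -addrA.
Qed.

(** The group law of a [finZmodType] is its addition, up to conversion; this lets the lemmas on
    finite groups be used in additive notation. *)
Lemma mem_groupD K x y : x \in K -> y \in K -> x + y \in K.
Proof. exact: (@groupM _ K). Qed.

Lemma mem_groupB K x y : x \in K -> y \in K -> x - y \in K.
Proof. by move=> Kx Ky; apply: mem_groupD => //; apply: (@groupVr _ K). Qed.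

(* Dyson's e-transforms (X, Y) -> (X :|: (Y + e), Y :&: (X - e)) are applied
   until none of them shrinks Y; then Y - y is contained in the stabiliser of
   the current X. *)
Lemma dyson K X Y Z :
    X \subset K -> Y \subset K -> Z \subset K ->
    X != set0 -> Y != set0 -> Z != set0 ->
    {in X & Y, forall x y, x + y \notin Z} ->
  exists (H : {group G}) (X' : {set G}) y, [/\ H \proper K, X \subset X', X' \subset K,
    {in X' & H, forall x h, x + h \in X'}
    & [/\ (#|X| + #|Y| <= #|X'| + #|H|)%N, y \in Y
        & {in X', forall x, x + y \notin Z}]].
Proof.
move: {2}#|Y| (leqnn #|Y|) => n; elim: n => [|n IHn] in X Y *.
  by rewrite leqn0 cards_eq0 => /eqP->; rewrite eqxx.
move=> leYn sXK sYK sZK X0 Y0 Z0 disj.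
(* The terminal case: for every [e = x - y'], all of Y + e lies in X, so all differences of points
   of Y stabilise X. *)
have [stabb|] := boolP [forall x in X, forall y in Y, forall y' in Y,
    x + (y - y') \in X].
  have stab x y y' : x \in X -> y \in Y -> y' \in Y -> x + (y - y') \in X.
    move=> Xx Yy Yy'; have /forall_inP/(_ x Xx)/forall_inP/(_ y Yy) := stabb.
    by move/forall_inP/(_ y' Yy').
  have /set0Pn[y0 Yy0] := Y0; have /set0Pn[x0 Xx0] := X0.
  have /set0Pn[z0 Zz0] := Z0.
  exists (group (stabilizer_group K X)), X, y0; split=> //.
  - rewrite properE; apply/andP; split.
      by apply/subsetP=> h; rewrite inE => /andP[].
    (* This element of K maps x0 to [z0 - y0], which is not in X: adding y0 to it gives a point of
       Z. *)
    apply/subsetPn; exists (z0 - y0 - x0).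
      apply: mem_groupB; first apply: mem_groupB.
      - exact: (subsetP sZK).
      - exact: (subsetP sYK).
      - exact: (subsetP sXK).
    rewrite inE negb_and; apply/orP; right; apply/negP=> /forall_inP/(_ x0 Xx0).
    by rewrite addrC subrK => /disj/(_ Yy0); rewrite subrK Zz0.
  - by move=> x h Xx; rewrite inE => /andP[_ /forall_inP->].
  - split=> //; last by move=> x /disj; apply.
    rewrite leq_add2l -(card_shift Y (- y0)); apply: subset_leq_card.
    apply/subsetP=> _ /imsetP[y Yy ->]; rewrite inE; apply/andP; split.
      by apply: mem_groupB; apply: (subsetP sYK).
    by apply/forall_inP=> x Xx; apply: stab.
rewrite negb_forall_in => /exists_inP[x Xx].
rewrite negb_forall_in => /exists_inP[y Yy].
rewrite negb_forall_in => /exists_inP[y' Yy' nX].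
(* With this shift y' survives in the new Y, as y' + e = x, while y is lost, as y + e = x + (y - y')
   is not in X. So Y shrinks but stays nonempty. *)
pose e := x - y'.
have Ke : e \in K by apply: mem_groupB; [apply: (subsetP sXK)|apply: (subsetP sYK)].
pose Ye := [set t + e | t in Y].
pose X1 := X :|: Ye; pose Y1 := [set t in Y | t + e \in X].
(* Y1 + e is the intersection of X and Y + e, while X1 is their union. *)
have cardXY : (#|X1| + #|Y1| = #|X| + #|Y|)%N.
  rewrite -[X in _ = (_ + X)%N](card_shift Y e) -/Ye -[in RHS]cardsUI; congr (_ + _)%N.
  rewrite -(card_shift Y1 e); apply: eq_card => t; rewrite inE.
  apply/imsetP/andP=> [[s /[!inE]/andP[Ys Xs] ->]|[Xt /imsetP[s Ys tE]]].
    by split=> //; apply: imset_f.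
  by exists s; rewrite // inE Ys -tE.
have ltY1 : (#|Y1| <= n)%N.
  rewrite -ltnS; apply: leq_trans leYn; apply: proper_card.
  rewrite properE; apply/andP; split; first by apply/subsetP=> t /[!inE]/andP[].
  apply/subsetPn; exists y => //; rewrite inE Yy /e addrCA /=.
  by rewrite addrCA in nX; rewrite addrCA.
have [|||||H [X' [y1 [pH sX1 sX' stab [le1 Yy1 disj1]]]]] :=
    IHn X1 Y1 ltY1 _ _ sZK _ _ Z0.
- rewrite subUset sXK; apply/subsetP=> _ /imsetP[t Yt ->].
  by apply: mem_groupD => //; apply: (subsetP sYK).
- by apply/subsetP=> t /[!inE]/andP[Yt _]; apply: (subsetP sYK).
- by apply/set0Pn; exists x; rewrite inE Xx.
- by apply/set0Pn; exists y'; rewrite inE Yy' /e addrC subrK.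
(* No new sums arise: (t + e) + v = (v + e) + t, with v + e in X and t in Y. *)
- move=> u v /setUP[Xu|/imsetP[t Yt ->]] /[!inE]/andP[Yv Xv].
    exact: disj.
  by rewrite -addrA (addrC t) (addrC e); apply: disj.
exists H, X', y1; split=> //.
  by apply: subset_trans sX1; apply: subsetUl.
by split; rewrite -?cardXY //; move: Yy1; rewrite inE => /andP[].
Qed.

(** By Lagrange the order of H is itself a power of 5. *)
Lemma proper5 K H m : #|K| = (5 ^ m)%N -> H \proper K -> (5 * #|H| <= #|K|)%N.
Proof.
move=> cK pH; have := cardSg (proper_sub pH); have := proper_card pH.
rewrite cK => lt5 /dvdn_pfactor-/(_ isT)[k lekm Hk].
by rewrite Hk -expnS leq_exp2l // -(@ltn_exp2l 5) // -Hk.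
Qed.

(** The translate X' + y is disjoint from Z inside K, so |X'| + |Z| <= |K|; Dyson's theorem replaces
    |X| + |Y| by |X'| + |H| with |H| <= |K|/5. *)
Lemma card_sum_free_triple K X Y Z m :
    #|K| = (5 ^ m)%N ->
    X \subset K -> Y \subset K -> Z \subset K ->
    X != set0 -> Y != set0 -> Z != set0 ->
    {in X & Y, forall x y, x + y \notin Z} ->
  (5 * (#|X| + #|Y| + #|Z|) <= 6 * #|K|)%N.
Proof.
move=> cK sXK sYK sZK X0 Y0 Z0.
move=> /(dyson sXK sYK sZK X0 Y0 Z0)[H [X' [y [pH _ sX' _ [leXY Yy disj]]]]].
have le5 := proper5 cK pH.
have leXZ : (#|X'| + #|Z| <= #|K|)%N.
  rewrite -(card_shift X' y) -cardsUI (_ : _ :&: Z = set0) ?cards0 ?addn0.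
    apply: subset_leq_card; rewrite subUset sZK andbT.
    apply/subsetP=> _ /imsetP[x Xx ->].
    by apply: mem_groupD; [apply: (subsetP sX')|apply: (subsetP sYK)].
  apply/setP=> t; rewrite !inE; apply/negP=> /andP[/imsetP[x Xx ->]].
  exact/negP/disj.
lia.
Qed.

End Dyson.

(** * The sharper bound when two of the sets are dense *)

Section FineTriple.

Variable G : finZmodType.
Implicit Types (X Y Z : {set G}) (H K : {group G}).

Lemma rcoset_eqB H (x y : G) : (H :* x == H :* y)%g = ((x - y)%R \in H).
Proof. by rewrite (sameP eqP rcoset_eqP) mem_rcoset. Qed.

Lemma sum_card_fibers H K X (f : G -> G) : {in X, forall x, f x \in K} ->
  (\sum_(C in rcosets H K) #|[set x in X | (H :* f x)%g == C]| = #|X|)%N.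
Proof.
move=> fK; rewrite -[RHS]sum1_card.
rewrite (partition_big (fun x => H :* f x)%g (mem (rcosets H K))) /=; last first.
  by move=> x Xx; apply/rcosetsP; exists (f x); rewrite ?fK.
by apply: eq_bigr => C _; rewrite -sum1_card; apply: eq_bigl => x; rewrite inE.
Qed.

(** Since Z lies in the coset of z0, each of the 5 cosets C of H for X is paired with the coset z0 -
    C for Y. A pair holds at most |H| points, as its sums avoid z0. By density some pair has both
    parts nonempty; there the triple bound in H, with Z included, gives 6/5 |H|. The total is (4 +
    6/5) |H| = 26/25 |K|. *)
Lemma card_sum_free_triple_coset K H X Y Z z0 m r :
    #|H| = (5 ^ m)%N -> H \subset K -> #|K| = (5 * #|H|)%N ->
    X \subset K -> Y \subset K -> Z \subset K -> z0 \in Z ->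
    {in Z, forall z, z - z0 \in H} ->
    {in X & Y, forall x y, x + y \notin Z} ->
    (r <= 4)%N -> (r * #|K| < 5 * #|X|)%N -> ((4 - r) * #|K| < 5 * #|Y|)%N ->
  (25 * (#|X| + #|Y| + #|Z|) <= 26 * #|K|)%N.
Proof.
move=> cH sHK cK sXK sYK sZK Zz0 ZH disj ler4 ltX ltY.
pose R := rcosets H K.
have cR : #|R| = 5%N.
  apply/eqP; rewrite -(@eqn_pmul2l #|H|) ?cardG_gt0 //; apply/eqP.
  by have := Lagrange sHK; rewrite cK /R => ->; rewrite mulnC.
pose XC C := [set x in X | (H :* x)%g == C].
pose YC C := [set y in Y | (H :* (z0 - y)%R)%g == C].
have sumX : (\sum_(C in R) #|XC C| = #|X|)%N.
  by apply: sum_card_fibers => x; apply: (subsetP sXK).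
have sumY : (\sum_(C in R) #|YC C| = #|Y|)%N.
  apply: (@sum_card_fibers H K Y (fun y => z0 - y)) => y Yy; apply: mem_groupB.
    exact: (subsetP sZK).
  exact: (subsetP sYK).
have le_pair C : C \in R -> (#|XC C| + #|YC C| <= #|H|)%N.
  (* The reflection of [YC] in z0 lies in the same coset as [XC], and is disjoint from it because x
     = z0 - y would give x + y = z0. *)
  case/rcosetsP=> c Kc ->; rewrite -[X in (_ + X)%N](card_imset _ (subrI z0)).
  rewrite -(card_rcoset H c) -cardsUI (_ : _ :&: _ = set0) ?cards0 ?addn0.
    apply: subset_leq_card; rewrite subUset; apply/andP; split.
      by apply/subsetP=> x /[!inE]/andP[_ /eqP<-]; apply: rcoset_refl.
    apply/subsetP=> _ /imsetP[y /[!inE]/andP[_ /eqP<-] ->].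
    exact: rcoset_refl.
  apply/setP=> x; rewrite !inE; apply/negP=> /andP[/andP[Xx _]].
  case/imsetP=> y /[!inE]/andP[Yy _] xE.
  by have := disj x y Xx Yy; rewrite xE subrK Zz0.
have le_both C : C \in R -> XC C != set0 -> YC C != set0 ->
    (5 * (#|XC C| + #|YC C| + #|Z|) <= 6 * #|H|)%N.
  case/rcosetsP=> c Kc -> X0 Y0.
  (* The shifts -c, c - z0 and -z0 bring the three sets into H, and the first two add up to the
     third, so sums still avoid Z. *)
  rewrite -(card_shift (XC _) (- c)) -(card_shift (YC _) (c - z0)).
  rewrite -(card_shift Z (- z0)); apply: (card_sum_free_triple cH).
  - by apply/subsetP=> _ /imsetP[x /[!inE]/andP[_ Hx] ->]; rewrite rcoset_eqB in Hx.
  - apply/subsetP=> _ /imsetP[y /[!inE]/andP[_ Hy] ->]; rewrite rcoset_eqB in Hy.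
    by rewrite (_ : y + _ = - (z0 - y - c)) ?(groupVr Hy) // !opprB addrCA.
  - by apply/subsetP=> _ /imsetP[z Zz ->]; apply: ZH.
  - by have /set0Pn[x Xx] := X0; apply/set0Pn; exists (x - c); apply: imset_f.
  - by have /set0Pn[y Yy] := Y0; apply/set0Pn; exists (y + (c - z0)); apply: imset_f.
  - by apply/set0Pn; exists (z0 - z0); apply: imset_f.
  move=> _ _ /imsetP[x /[!inE]/andP[Xx _] ->] /imsetP[y /[!inE]/andP[Yy _] ->].
  apply/imsetP=> -[z Zz]; rewrite addrACA addKr => /addIr zE.
  by have := disj x y Xx Yy; rewrite zE Zz.
(* Pigeonhole: X has more than r |H| points and so meets at least r + 1 cosets, Y meets at least 5 -
   r, and there are only 5 pairs. *)
have [C0 [RC0 X0 Y0]] : exists C, [/\ C \in R, XC C != set0 & YC C != set0].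
  have [/exists_inP[C RC /andP[]]|/exists_inPn none] :=
      boolP [exists C in R, (XC C != set0) && (YC C != set0)]; first by exists C.
  pose P := [set C in R | XC C != set0]; pose Q := [set C in R | YC C != set0].
  have lePQ : (#|P| + #|Q| <= 5)%N.
    rewrite -cR -cardsUI (_ : P :&: Q = set0) ?cards0 ?addn0.
      by apply: subset_leq_card; apply/subsetP=> C /[!inE]/orP[]/andP[].
    apply/setP=> C; rewrite !inE; apply/negP=> /andP[/andP[RC ?] /andP[_ ?]].
    by move: (none C RC) => /negP[]; apply/andP.
  have bound (T : {set G} -> {set G}) :
      (forall C, C \in R -> #|T C| <= #|H|)%N ->
      (\sum_(C in R) #|T C| <= #|[set C in R | T C != set0]| * #|H|)%N.
    move=> leT; rewrite (bigID (fun C => T C == set0)) /= big1 ?add0n.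
      rewrite -sum_nat_const big_mkcond [leqRHS]big_mkcond /=.
      apply: leq_sum => C _; rewrite inE.
      by case: ifP => // /andP[RC _]; apply: leT.
    by move=> C /andP[_ /eqP->]; apply: cards0.
  have leX : (#|X| <= #|P| * #|H|)%N.
    by rewrite -sumX; apply: bound => C /le_pair; lia.
  have leY : (#|Y| <= #|Q| * #|H|)%N.
    by rewrite -sumY; apply: bound => C /le_pair; lia.
  rewrite cK in ltX ltY; have H0 := cardG_gt0 H.
  have ltP : (r < #|P|)%N.
    by rewrite -(@ltn_pmul2r #|H|) //; lia.
  have ltQ : (4 - r < #|Q|)%N.
    by rewrite -(@ltn_pmul2r #|H|) //; lia.
  lia.
have sumXY : (\sum_(C in R) (#|XC C| + #|YC C|) = #|X| + #|Y|)%N.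
  by rewrite big_split sumX sumY.
rewrite (bigD1 C0) //= in sumXY; have := le_both C0 RC0 X0 Y0.
have rest : (\sum_(C in R | C != C0) (#|XC C| + #|YC C|) <= 4 * #|H|)%N.
  apply: leq_trans (_ : \sum_(C in R | C != C0) #|H| <= _)%N.
    by apply: leq_sum => C /andP[RC _]; apply: le_pair.
  rewrite sum_nat_const leq_mul2r; apply/orP; right.
  have := cardD1 C0 R; rewrite RC0 cR add1n => -[->].
  by apply/eq_leq/eq_card => C; rewrite !inE andbC.
move: rest sumXY; set rest := (\sum_(C in R | C != C0) _)%N.
rewrite cK; move: #|XC C0| #|YC C0| #|X| #|Y| #|Z| #|H| rest => a b x y z h s; lia.
Qed.

(* If [25 * #|H| > #|K|] for the subgroup given by Dyson's theorem, then H has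
   index 5 and X' misses a single coset of H, which therefore contains Z. *)
Lemma card_sum_free_triple_dense K X Y Z m r :
    #|K| = (5 ^ m)%N -> X \subset K -> Y \subset K -> Z \subset K ->
    Z != set0 -> {in X & Y, forall x y, x + y \notin Z} ->
    (r <= 4)%N -> (r * #|K| < 5 * #|X|)%N -> ((4 - r) * #|K| < 5 * #|Y|)%N ->
  (25 * (#|X| + #|Y| + #|Z|) <= 26 * #|K|)%N.
Proof.
move=> cK sXK sYK sZK Z0 disj ler4 ltX ltY.
have X0 : X != set0 by rewrite -card_gt0; move: ltX; case: #|X| => //; rewrite muln0.
have Y0 : Y != set0 by rewrite -card_gt0; move: ltY; case: #|Y| => //; rewrite muln0.
have [H [X' [y [pH _ sX' stab [leXY Yy disj']]]]] :=
  dyson sXK sYK sZK X0 Y0 Z0 disj.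
have [sHK _] := andP pH.
have Ky : y \in K by apply: (subsetP sYK).
pose Zy := [set z - y | z in Z]; pose D := K :\: X'.
have cZy : #|Zy| = #|Z| by apply: card_shift.
have sZD : Zy \subset D.
  apply/subsetP=> _ /imsetP[z Zz ->]; rewrite inE andbC mem_groupB ?Ky ?(subsetP sZK z Zz) //=.
  by apply/negP=> /disj'; rewrite subrK Zz.
have cD : (#|X'| + #|D| = #|K|)%N.
  by rewrite -(cardsID X' K) (setIidPr sX').
have leZD : (#|Z| <= #|D|)%N by rewrite -cZy; apply: subset_leq_card.
(* For a small H the total |K| + |H| is already at most 26/25 |K|. Otherwise the index, a power of
   5, is below 25 and hence equal to 5. *)
have [leH|ltH] := leqP (25 * #|H|)%N #|K|.
  by clear -leXY cD leZD leH; move: #|D| cD leZD => d; lia.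
have [k cH] : exists k, #|H| = (5 ^ k)%N.
  have := cardSg sHK; rewrite cK => /dvdn_pfactor-/(_ isT)[k _ ->].
  by exists k.
have cK5 : #|K| = (5 * #|H|)%N.
  have := proper5 cK pH; move: ltH; rewrite cK cH -expnS -(expnD 5 2 k).
  by rewrite ltn_exp2l // leq_exp2l // => ltm lek; congr (5 ^ _)%N; clear -ltm lek; lia.
have [z0 Zz0] := set0Pn _ Z0.
apply: (card_sum_free_triple_coset cH sHK cK5 sXK sYK sZK Zz0 _ disj ler4) => //.
(* The complement of the H-stable set X' is H-stable, so D is a union of cosets of H. *)
have stabD x h : x \in D -> h \in H -> x + h \in D.
  rewrite !inE => /andP[nXx Kx] Hh; rewrite mem_groupD ?(subsetP sHK h Hh) // andbT.
  apply: contra nXx => Xxh; rewrite -(addrK h x); apply: stab => //.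
  exact: (@groupVr _ H).
have Dz z : z \in Z -> z - y \in D.
  by move=> Zz; apply: (subsetP sZD); apply: imset_f.
have sub2 z : z \in Z -> [set z - y + h | h in H] \subset D.
  by move=> Zz; apply/subsetP=> _ /imsetP[h Hh ->]; apply: stabD; first apply: Dz.
move=> z Zz; apply/negPn/negP=> nH.
(* Two points of Z in distinct cosets of H would put two disjoint cosets into D. But |X'| + |H| >=
   |X| + |Y| > 4 |H|, so that |D| < 2 |H|. *)
pose S t := [set t - y + h | h in H].
have cS t : #|S t| = #|H| by apply: card_imset; apply: addrI.
have : (#|S z :|: S z0| <= #|D|)%N.
  by apply: subset_leq_card; rewrite subUset /S sub2 // sub2.
rewrite cardsU (_ : S z :&: S z0 = set0) ?cards0 ?subn0 ?cS.
  have : (4 * #|H| < #|X| + #|Y|)%N.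
    rewrite -[in (4 * _)%N](subnKC ler4) mulnDl.
    by rewrite -addSn; apply: leq_add; [|apply: ltnW]; rewrite -(@ltn_pmul2l 5) // mulnCA -cK5.
  by clear -leXY cD cK5; move: #|D| cD => d; lia.
apply/setP=> t; rewrite !inE; apply/negP=> /andP[/imsetP[h Hh ->]].
case/imsetP=> k' Hk E; move/negP: nH; apply.
rewrite (_ : z - z0 = k' - h); first exact: mem_groupB.
apply/eqP; rewrite subr_eq addrAC eq_sym subr_eq; apply/eqP.
by apply: (addIr (- y)); rewrite [RHS]addrAC E [RHS]addrAC (addrC z0).
Qed.

End FineTriple.

(** * The same bounds for subsets of cosets *)

Section CosetTriple.

Variable G : finZmodType.
Implicit Types (X Y Z : {set G}) (K : {group G}).

(** A form free of coset representatives: for nonempty sets the first condition puts each of X, Y, Z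
    into one coset of K, the third coset being the sum of the other two. *)
Definition coset_triple K X Y Z :=
  forall x y z, x \in X -> y \in Y -> z \in Z ->
    (x + y - z \in K) && (x + y != z).

(* Turns x + y - z into z - x - y, so that any two of the three sets can play
   the symmetric part. *)
Lemma coset_triple_rot K X Y Z :
  coset_triple K X Y Z -> coset_triple K Z [set - x | x in X] Y.
Proof.
move=> XYZ z _ y Zz /imsetP[x Xx ->] Yy; have /andP[Kxyz nz] := XYZ x y z Xx Yy Zz.
apply/andP; split.
  by rewrite -[_ - y]opprK (groupVr _) // !opprB [y + _]addrA (addrC y).
by apply: contra nz => /eqP<-; rewrite addrC subrK.
Qed.

Lemma coset_tripleC K X Y Z : coset_triple K X Y Z -> coset_triple K Y X Z.
Proof. by move=> XYZ y x z Yy Xx Zz; rewrite (addrC y); apply: XYZ. Qed.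

Lemma coset_triple_subgroup K X Y Z : coset_triple K X Y Z ->
    X != set0 -> Y != set0 -> Z != set0 ->
  exists X' Y' Z' : {set G},
    [/\ X' \subset K, Y' \subset K, Z' \subset K,
        {in X' & Y', forall x y, x + y \notin Z'}
      & [/\ #|X'| = #|X|, #|Y'| = #|Y| & #|Z'| = #|Z|]].
Proof.
move=> XYZ /set0Pn[x0 Xx0] /set0Pn[y0 Yy0] /set0Pn[z0 Zz0].
have K0 : x0 + y0 - z0 \in K by case/andP: (XYZ x0 y0 z0 Xx0 Yy0 Zz0).
(* Z is shifted by x0 + y0 and not by z0, so that the equation x + y = z is preserved; the shifted
   set is still in K because x0 + y0 - z0 is. *)
exists [set x - x0 | x in X], [set y - y0 | y in Y], [set z - (x0 + y0) | z in Z].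
split; last by rewrite !card_shift.
- apply/subsetP=> _ /imsetP[x Xx ->].
  have /andP[Kx _] := XYZ x y0 z0 Xx Yy0 Zz0.
  by have := mem_groupB Kx K0; rewrite opprB addrA subrK opprD addrACA subrr addr0.
- apply/subsetP=> _ /imsetP[y Yy ->].
  have /andP[Ky _] := XYZ x0 y z0 Xx0 Yy Zz0.
  by have := mem_groupB Ky K0; rewrite opprB addrA subrK opprD addrACA subrr add0r.
- apply/subsetP=> _ /imsetP[z Zz ->]; rewrite -opprB (groupVr _) //.
  by have /andP[] := XYZ x0 y0 z Xx0 Yy0 Zz.
move=> _ _ /imsetP[x Xx ->] /imsetP[y Yy ->]; apply/imsetP=> -[z Zz].
rewrite addrACA -opprD => /addIr E.
by have /andP[_ /eqP] := XYZ x y z Xx Yy Zz.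
Qed.

Lemma card_coset_triple K X Y Z m : #|K| = (5 ^ m)%N -> coset_triple K X Y Z ->
    X != set0 -> Y != set0 -> Z != set0 ->
  (5 * (#|X| + #|Y| + #|Z|) <= 6 * #|K|)%N.
Proof.
move=> cK XYZ X0 Y0 Z0.
have [X' [Y' [Z' [sX sY sZ disj [cX cY cZ]]]]] := coset_triple_subgroup XYZ X0 Y0 Z0.
rewrite -cX -cY -cZ; apply: (card_sum_free_triple cK) disj => //.
- by rewrite -card_gt0 cX card_gt0.
- by rewrite -card_gt0 cY card_gt0.
- by rewrite -card_gt0 cZ card_gt0.
Qed.

Lemma card_coset_triple_dense K X Y Z m r :
    #|K| = (5 ^ m)%N -> coset_triple K X Y Z -> Z != set0 -> (r <= 4)%N ->
    (r * #|K| < 5 * #|X|)%N -> ((4 - r) * #|K| < 5 * #|Y|)%N ->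
  (25 * (#|X| + #|Y| + #|Z|) <= 26 * #|K|)%N.
Proof.
move=> cK XYZ Z0 ler ltX ltY.
have X0 : X != set0 by rewrite -card_gt0; move: ltX; case: #|X| => //; rewrite muln0.
have Y0 : Y != set0 by rewrite -card_gt0; move: ltY; case: #|Y| => //; rewrite muln0.
have [X' [Y' [Z' [sX sY sZ disj [cX cY cZ]]]]] := coset_triple_subgroup XYZ X0 Y0 Z0.
rewrite -cX -cY -cZ.
apply: (card_sum_free_triple_dense cK sX sY sZ _ disj ler); rewrite ?cX ?cY //.
by rewrite -card_gt0 cZ card_gt0.
Qed.

(** After translation into K, a single point z of the third set suffices: X and z - Y are disjoint
    subsets of K. *)
Lemma card_coset_pair K X Y Z : coset_triple K X Y Z ->
  X != set0 -> Y != set0 -> Z != set0 -> (#|X| + #|Y| <= #|K|)%N.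
Proof.
move=> XYZ X0 Y0 Z0.
have [X' [Y' [Z' [sX sY sZ disj [cX cY cZ]]]]] := coset_triple_subgroup XYZ X0 Y0 Z0.
have /set0Pn[z Zz] : Z' != set0 by rewrite -card_gt0 cZ card_gt0.
rewrite -cX -cY -(card_imset Y' (subrI z)) -cardsUI.
rewrite (_ : _ :&: _ = set0) ?cards0 ?addn0.
  apply: subset_leq_card; rewrite subUset sX; apply/subsetP=> _ /imsetP[y Yy ->].
  by apply: mem_groupB; [apply: (subsetP sZ)|apply: (subsetP sY)].
apply/setP=> x; rewrite !inE; apply/negP=> /andP[Xx /imsetP[y Yy xE]].
by have := disj x y Xx Yy; rewrite xE subrK Zz.
Qed.

End CosetTriple.

(** * Fibres of an additive map *)

Section Fibers.

Variables (G U : finZmodType) (f : G -> U).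
Hypothesis fD : {morph f : x y / x + y}.

Lemma ker_group_set : group_set [set x | f x == 0].
Proof.
have f0 : f 0 = 0 by apply: (addrI (f 0)); rewrite -fD !addr0.
apply/group_setP; split=> [|x y]; first by rewrite inE; apply/eqP.
by rewrite !inE => /eqP fx /eqP fy; apply/eqP; rewrite [LHS]fD fx fy addr0.
Qed.

Definition ker_add : {group G} := group ker_group_set.

Definition fiber (A : {set G}) (u : U) : {set G} := [set a in A | f a == u].

Lemma morph_sub : {morph f : x y / x - y}.
Proof. by move=> x y; apply: (addIr (f y)); rewrite -fD !subrK. Qed.

Lemma fiber_triple A u v : sum_free A ->
  coset_triple ker_add (fiber A u) (fiber A v) (fiber A (u + v)).
Proof.
move=> sfA x y z /[!inE]/andP[Ax /eqP fx] /andP[Ay /eqP fy] /andP[Az /eqP fz].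
apply/andP; split; first by rewrite morph_sub fD fx fy fz subrr.
apply/eqP=> xyz; have /sum_freeP[] := sfA; by exists x, y, z.
Qed.

Lemma sum_card_fiber A : (\sum_u #|fiber A u| = #|A|)%N.
Proof.
rewrite -[RHS]sum1_card (partition_big f xpredT) //=.
by apply: eq_bigr => u _; rewrite -sum1_card; apply: eq_bigl => x; rewrite inE.
Qed.

Lemma card_ker : (forall u, exists x, f x = u) -> #|G| = (#|U| * #|ker_add|)%N.
Proof.
move=> fsurj; rewrite -cardsT -sum_card_fiber -sum_nat_const; apply: eq_bigr => u _.
have [x <-] := fsurj u; rewrite -(card_shift (ker_add : {set G}) x).
apply: eq_card => y; rewrite !inE; apply/idP/imsetP=> [/eqP fy|[k /[!inE]/eqP fk ->]].
  by exists (y - x); rewrite ?subrK // inE morph_sub fy subrr.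
by rewrite fD fk add0r eqxx.
Qed.

Lemma card_ker5 n : #|G| = (5 ^ n)%N -> exists m, #|ker_add| = (5 ^ m)%N.
Proof.
move=> cG; have := cardSg (subsetT ker_add).
by rewrite cardsT cG => /dvdn_pfactor-/(_ isT)[k _ ->]; exists k.
Qed.

Lemma le_card_fiber A u : (#|fiber A u| <= #|ker_add|)%N.
Proof.
have [->|/set0Pn[a /[!inE]/andP[_ /eqP fa]]] := eqVneq (fiber A u) set0.
  by rewrite cards0.
rewrite -(card_shift (fiber A u) (- a)); apply/subset_leq_card/subsetP=> x.
by case/imsetP=> b /[!inE]/andP[_ /eqP fb] ->; rewrite morph_sub fa fb subrr.
Qed.

(** The version for maps that may fail to be onto; [card_orth2] applies it to two vectors that may
    be proportional. *)
Lemma card_ker_ge : (#|G| <= #|U| * #|ker_add|)%N.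
Proof.
rewrite -cardsT -sum_card_fiber -sum_nat_const.
by apply: leq_sum => u _; apply: le_card_fiber.
Qed.

End Fibers.

(** * Linear forms and normal sets *)

Section Functionals.

Variable n : nat.
Implicit Types (A : {set 'rV['F_5]_n}) (g : 'cV['F_5]_n).

Definition form g (a : 'rV['F_5]_n) : 'F_5 := (a *m g) 0 0.

Lemma formD g : {morph form g : a b / a + b}.
Proof. by move=> a b; rewrite /form mulmxDl mxE. Qed.

Lemma formZ g (t : 'F_5) a : form g (t *: a) = t * form g a.
Proof. by rewrite /form -scalemxAl mxE. Qed.

Lemma form_surj g : g != 0 -> forall t, exists a, form g a = t.
Proof.
move=> /cV0Pn[i gi] t; exists ((t / g i 0) *: delta_mx 0 i).
rewrite formZ /form -rowE mxE divfK //.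
Qed.

(** Normality in terms of an equation: if V is the kernel of the form and w has value 3, then 2w + V
    and 3w + V are the level sets of 1 and -1. *)
Definition normal_form A := exists g, {in A, forall a, (form g a == 1) || (form g a == -1)}.

Lemma F5_cases (t : 'F_5) : t \in [:: 0; 1; 2; 3; 4].
Proof. by case: t => [[|[|[|[|[|]]]]]]. Qed.

Lemma card_F5 : #|{: 'F_5}| = 5%N.
Proof. exact: card_Fp. Qed.

Lemma card_rV_F5 : #|{: 'rV['F_5]_n}| = (5 ^ n)%N.
Proof. by rewrite card_mx card_F5 mul1n. Qed.

Lemma sum_F5 (F : 'F_5 -> nat) :
  (\sum_t F t)%N = (F 0%R + (F 1%R + (F 2%R + (F 3%R + F 4%R))))%N.
Proof.
rewrite !big_ord_recl big_ord0 addn0.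
by congr (F _ + (F _ + (F _ + (F _ + F _))))%N; apply: val_inj.
Qed.

(** A slice at level 1 that is more than half full excludes the levels 0 and 2, by the pair bound
    for 1 + 0 = 1 and 1 + 1 = 2. If level 3 were occupied, a triple bound would limit all that
    remains of A to 6/5 of a hyperplane. *)
Lemma normal_of_dense_slice A g : sum_free A -> g != 0 ->
    (6 * 5 ^ n < 25 * #|A|)%N -> (5 ^ n < 10 * #|fiber (form g) A 1%R|)%N ->
  normal_form A.
Proof.
move=> sfA g0 largeA dense.
have [m cK] := card_ker5 (formD g) card_rV_F5.
have cKn := card_ker (formD g) (form_surj g0); rewrite card_rV_F5 card_F5 in cKn.
pose F t := fiber (form g) A t.
have T u v : coset_triple (ker_add (formD g)) (F u) (F v) (F (u + v)).
  exact: fiber_triple.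
have sumA : (#|F 0%R| + (#|F 1%R| + (#|F 2%R| + (#|F 3%R| + #|F 4%R|))))%N = #|A|.
  by rewrite -(sum_card_fiber (form g) A) sum_F5.
set K := ker_add _ in cK cKn T.
have largeK : (6 * #|K| < 5 * #|A|)%N by lia.
have d1 : (#|K| < 2 * #|F 1%R|)%N by rewrite -/(F 1) in dense; lia.
have F1 : F 1 != set0 by rewrite -card_gt0; lia.
have F0 : F 0 = set0.
  apply/eqP; apply: contraLR d1 => F0.
  (* Rotating the triple makes F 1 and its negative the two summands and F 0 the target, so the pair
     bound gives 2 |F 1| <= |K|. *)
  have := coset_triple_rot (T 1 0); rewrite addr0 => T1.
  have N1 : [set - x | x in F 1] != set0 by rewrite -card_gt0 (card_imset _ oppr_inj) card_gt0.
  by have := card_coset_pair T1 F1 N1 F0; rewrite (card_imset _ oppr_inj) -leqNgt; lia.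
have F2 : F 2 = set0.
  apply/eqP; apply: contraLR d1 => F2; rewrite -leqNgt.
  by have := card_coset_pair (T 1 1) F1 F1 F2; lia.
have F3 : F 3 = set0.
  apply/eqP/negPn/negP=> F3.
  (* If level 4 is empty, the triple 3 + 3 = 1 covers all of A, with F 3 even counted twice;
     otherwise 1 + 3 = 4 covers it. *)
  have [F4|F4] := eqVneq (F 4) set0.
    have T33 : coset_triple K (F 3) (F 3) (F 1).
      by have := T 3 3; rewrite (_ : 3 + 3 = 1) //; apply: val_inj.
    have := card_coset_triple cK T33 F3 F3 F1.
    by move: sumA; rewrite F0 F2 F4 !cards0; clear -largeK d1; lia.
  have T13 : coset_triple K (F 1) (F 3) (F 4).
    by have := T 1 3; rewrite (_ : 1 + 3 = 4) //; apply: val_inj.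
  have := card_coset_triple cK T13 F1 F3 F4.
  by move: sumA; rewrite F0 F2 !cards0; clear -largeK d1; lia.
exists g => a Aa; have Fa : a \in F (form g a) by rewrite inE Aa eqxx.
have := F5_cases (form g a); rewrite !inE => /or4P[|||/orP[]] /eqP E; rewrite E in Fa *.
- by rewrite F0 inE in Fa.
- by [].
- by rewrite F2 inE in Fa.
- by rewrite F3 inE in Fa.
- by [].
Qed.

Lemma normal_set_of_form A : (0 < n)%N -> A != set0 -> normal_form A -> normal_set 5 A.
Proof.
move=> n0 /set0Pn[a0 Aa0] [g gA]; apply/normal_set5.
have g0 : g != 0.
  by apply: contraTneq (gA a0 Aa0) => ->; rewrite /form mulmx0 mxE.
(* The value 3 is the inverse of 2 modulo 5: then 2w has value 6 = 1 and 3w has value 9 = -1. *)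
have [w gw] := form_surj g0 3.
pose f : 'Hom('rV['F_5]_n, 'rV['F_5]_1) := linfun (mulmxr g).
have fE a : (f a == 0) = (form g a == 0).
  rewrite lfunE /= /form; apply/eqP/eqP=> [->|E]; first by rewrite mxE.
  by apply/matrixP=> i j; rewrite !ord1 E mxE.
exists (lker f), w; split.
- have imf : limg f = fullv.
    apply/eqP; rewrite eqEsubv subvf; apply/subvP=> u _.
    have [a au] := form_surj g0 (u 0 0).
    rewrite (_ : u = f a) ?memv_img ?memvf //.
    by rewrite lfunE /=; apply/matrixP=> i j; rewrite !ord1 -au.
  have := limg_ker_dim f fullv; rewrite capfv imf !dimvf /dim /= mul1n addn1.
  by rewrite mul1n.
- by rewrite memv_ker fE gw.
apply/subsetP=> a Aa.
have mem (t : 'rV['F_5]_n) : t \in [set w *+ 2; w *+ 3] -> form g a = form g t ->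
    a \in sumset [set w *+ 2; w *+ 3] [set v in lker f].
  move=> wt E; apply/imset2P; exists t (a - t); rewrite // ?(addrC t) ?subrK //.
  by rewrite inE memv_ker fE (morph_sub (formD g)) E subrr.
case/orP: (gA a Aa) => /eqP E; [apply: (mem (w *+ 2))|apply: (mem (w *+ 3))].
- by rewrite !inE eqxx.
- by rewrite E -scaler_nat formZ gw; apply: val_inj.
- by rewrite !inE eqxx orbT.
- by rewrite E -scaler_nat formZ gw; apply: val_inj.
Qed.

End Functionals.

(** * Coordinates modulo a subspace of codimension 2 *)

Definition cellv (u : nat) : 'rV['F_5]_2 :=
  \row_k (if k == 0 then (u %/ 5)%:R else (u %% 5)%:R).

Lemma cellv0 u : cellv u 0 0 = (u %/ 5)%:R. Proof. by rewrite mxE. Qed.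
Lemma cellv1 u : cellv u 0 1 = (u %% 5)%:R. Proof. by rewrite mxE. Qed.

Lemma rV2P (r s : 'rV['F_5]_2) : r 0 0 = s 0 0 -> r 0 1 = s 0 1 -> r = s.
Proof.
move=> E0 E1; apply/rowP=> k.
have [->|->] : k = 0 \/ k = 1 by case: k => [[|[|]]] // ?; [left|right]; apply: val_inj.
  exact: E0.
exact: E1.
Qed.

Lemma F5_nat_mod m : ((m %% 5)%N%:R : 'F_5) = m%:R.
Proof. exact: (Fp_nat_mod (isT : prime 5)). Qed.

Lemma F5_nat_inj a b : (a < 5)%N -> (b < 5)%N -> (a%:R : 'F_5) = b%:R -> a = b.
Proof.
move=> a5 b5 /(congr1 (@nat_of_ord _)); rewrite !(val_Fp_nat (isT : prime 5)).
by rewrite !modn_small.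
Qed.

Lemma cellv_add u v : cellv (cell_add u v) = cellv u + cellv v.
Proof.
apply: rV2P; rewrite !mxE /= /cell_add.
  rewrite (mulnC 5) divnMDl // [(_ %% 5 %/ 5)%N]divn_small ?ltn_pmod // addn0.
  by rewrite F5_nat_mod natrD.
by rewrite (mulnC 5) modnMDl modn_mod F5_nat_mod natrD.
Qed.

Definition cell_index (r : 'rV['F_5]_2) : 'I_25 := inord (5 * r 0%R 0%R + r 0%R 1%R).

Lemma cell_indexE r : cell_index r = (5 * r 0%R 0%R + r 0%R 1%R)%N :> nat.
Proof.
have r5 (t : 'F_5) : (t < 5)%N by apply: ltn_ord.
rewrite inordK //; apply: (@leq_trans (5 * 4 + 5)) => //.
by rewrite -addnS leq_add ?r5 // leq_mul2l -ltnS r5.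
Qed.

Lemma cellvK (u : 'I_25) : cell_index (cellv u) = u.
Proof.
apply: val_inj; rewrite /= cell_indexE cellv0 cellv1 !(val_Fp_nat (isT : prime 5)).
rewrite modn_mod [(u %/ 5 %% 5)%N]modn_small ?ltn_divLR ?(ltn_ord u) //.
by rewrite mulnC -divn_eq.
Qed.

Lemma cell_indexK r : cellv (cell_index r) = r.
Proof.
have r5 (t : 'F_5) : (t < 5)%N by apply: ltn_ord.
have natK (t : 'F_5) : (t : nat)%:R = t by apply: (natr_Zp t).
apply: rV2P; rewrite !mxE /= cell_indexE (mulnC 5).
  by rewrite divnMDl // divn_small ?r5 // addn0 natK.
by rewrite modnMDl modn_small ?r5 // natK.
Qed.

Section Grid.

Variables (n : nat) (A : {set 'rV['F_5]_n}).
Implicit Type M : 'M['F_5]_(n, 2).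

Definition grid_map M (a : 'rV['F_5]_n) := a *m M.

Lemma grid_mapD M : {morph grid_map M : a b / a + b}.
Proof. by move=> a b; rewrite /grid_map mulmxDl. Qed.

Definition cell M u : {set 'rV['F_5]_n} := fiber (grid_map M) A (cellv u).
Definition column M (t : 'F_5) : {set 'rV['F_5]_n} := [set a in A | (a *m M) 0 0 == t].

(** The sums over the whole grid, over columns and over lines are all evaluated with this lemma. *)
Lemma sum_card_cell M (P : pred nat) (Q : pred 'rV['F_5]_2) :
    (forall u, (u < 25)%N -> P u = Q (cellv u)) ->
  (\sum_(u < 25 | P u) #|cell M u| = #|[set a in A | Q (grid_map M a)]|)%N.
Proof.
move=> PQ; rewrite -[RHS]sum1_card.
rewrite (partition_big (fun a => cell_index (grid_map M a)) (fun u : 'I_25 => P u)) /=.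
  apply: eq_bigr => u Pu; rewrite -sum1_card; apply: eq_bigl => a; rewrite !inE.
  rewrite -andbA; congr (_ && _); apply/eqP/andP=> [->|[_ /eqP<-]].
    by rewrite -PQ // Pu cellvK.
  by rewrite cell_indexK.
by move=> a /[!inE]/andP[_ Qa]; rewrite PQ // cell_indexK.
Qed.

Lemma card_column M i : (i < 5)%N ->
  (\sum_(u < 25 | u %/ 5 == i) #|cell M u| = #|column M i%:R|)%N.
Proof.
move=> i5; rewrite (sum_card_cell M (P := fun u => (u %/ 5 == i)%N)
  (Q := fun r => r 0 0 == i%:R)) // => u u25.
rewrite cellv0; apply/eqP/eqP=> [->//|]; apply: F5_nat_inj => //.
by rewrite ltn_divLR.
Qed.

(** A change of coordinates only relabels the cells. The normalisations of the grid follow by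
    comparing M with [M *m T] for suitable T. *)
Lemma cell_mulmx M (T : 'M_2) u v : T \in unitmx -> cellv u *m T = cellv v ->
  cell (M *m T) v = cell M u.
Proof.
move=> uT uv; apply/setP=> a; rewrite !inE /grid_map mulmxA -uv.
by rewrite (can_eq (mulmxK uT)).
Qed.

Lemma row_full_mulmx M (T : 'M_2) : T \in unitmx -> row_full M -> row_full (M *m T).
Proof.
move=> uT; rewrite -!col_leq_rank => fM; apply: leq_trans fM _.
by have := mxrankM_maxl (M *m T) (invmx T); rewrite mulmxK.
Qed.

Definition mx2 (a b c d : 'F_5) : 'M['F_5]_2 :=
  \matrix_(i, j) (if i == 0 then (if j == 0 then a else b) else (if j == 0 then c else d)).

Lemma mul_mx2_0 (r : 'rV_2) a b c d : (r *m mx2 a b c d) 0 0 = r 0 0 * a + r 0 1 * c.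
Proof. by rewrite !mxE !big_ord_recl big_ord0 addr0 !mxE; congr (_ * _ + r _ _ * _); apply: val_inj. Qed.

Lemma mul_mx2_1 (r : 'rV_2) a b c d : (r *m mx2 a b c d) 0 1 = r 0 0 * b + r 0 1 * d.
Proof. by rewrite !mxE !big_ord_recl big_ord0 addr0 !mxE; congr (_ * _ + r _ _ * _); apply: val_inj. Qed.

Lemma unit_mx2 a b c d : a * d - b * c != 0 -> mx2 a b c d \in unitmx.
Proof. 
rewrite unitmxE (expand_det_row _ 0) !big_ord_recl big_ord0 /cofactor !det_mx11.
by rewrite !mxE /= expr0 mul1r expr1 mulN1r mulrN addr0 unitfE. Qed.

(** The invertible matrices act transitively on the nonzero vectors. *)
Lemma cell_to_first u : (0 < u < 25)%N ->
  exists2 T : 'M['F_5]_2, T \in unitmx & cellv u *m T = cellv 1.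
Proof.
case/andP=> u0 u25; pose i : 'F_5 := (u %/ 5)%:R; pose j : 'F_5 := (u %% 5)%:R.
have ui : cellv u 0 0 = i by apply: cellv0.
have uj : cellv u 0 1 = j by apply: cellv1.
have [j0|j0] := eqVneq j 0.
  have i0 : i != 0.
    apply: contraTneq u0 => i0; rewrite (divn_eq u 5).
    have -> : (u %/ 5 = 0)%N by apply: (@F5_nat_inj _ 0) i0; rewrite ?ltn_divLR.
    by have -> : (u %% 5 = 0)%N by apply: (@F5_nat_inj _ 0) j0; rewrite ?ltn_pmod.
  exists (mx2 0 (1 / i) 1 0).
    by apply: unit_mx2; rewrite mul0r sub0r mulr1 oppr_eq0 mul1r invr_eq0.
  apply: rV2P; rewrite ?mul_mx2_0 ?mul_mx2_1 ui uj j0 ?(cellv0, cellv1).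
    by rewrite mulr0 mul0r addr0.
  by rewrite mulr0 addr0 mul1r divff.
(* It has determinant 1 and maps (i, j) to (i j - j i, 1) = (0, 1). *)
exists (mx2 j 0 (- i) (1 / j)).
  by apply: unit_mx2; rewrite mul0r subr0 mul1r divff // oner_eq0.
apply: rV2P; rewrite ?mul_mx2_0 ?mul_mx2_1 ui uj ?(cellv0, cellv1).
  by rewrite mulrN mulrC subrr.
by rewrite mulr0 add0r mul1r divff.
Qed.

End Grid.

(** * Coordinates that maximise the largest cell *)

Section LargestCell.

Variables (n : nat) (A : {set 'rV['F_5]_n}).
Hypothesis sfA : sum_free A.
Hypothesis largeA : (6 * 5 ^ n < 25 * #|A|)%N.
Hypothesis nnA : ~ normal_form A.
Implicit Type M : 'M['F_5]_(n, 2).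

Notation B := (#|A|.+1).

(* Lexicographic order on the largest cell, the largest column, and the
   largest cell of that column. *)
Definition grid_key M : nat :=
  (#|cell A M 1| * B + #|column A M 1|) * B + #|cell A M 5|.

(** All three counts are below |A| + 1, so they are the digits of [grid_key] in that base. *)
Lemma lex_max M M' : (grid_key M' <= grid_key M)%N ->
  [/\ (#|cell A M' 1| <= #|cell A M 1|)%N,
      #|cell A M' 1| = #|cell A M 1| -> (#|column A M' 1%R| <= #|column A M 1%R|)%N
    & #|cell A M' 1| = #|cell A M 1| -> #|column A M' 1%R| = #|column A M 1%R| ->
      (#|cell A M' 5| <= #|cell A M 5|)%N].
Proof.
have lecell N u : (#|cell A N u| < B)%N.
  by rewrite ltnS; apply: subset_leq_card; apply/subsetP=> a /[!inE]/andP[].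
have lecol N : (#|column A N 1%R| < B)%N.
  by rewrite ltnS; apply: subset_leq_card; apply/subsetP=> a /[!inE]/andP[].
have lex a b a' b' (C : nat) : (b < C)%N -> (a' * C + b' <= a * C + b)%N ->
    (a' <= a)%N /\ (a' = a -> (b' <= b)%N).
  move=> ltb le; split; last by move=> aa; move: le; rewrite aa leq_add2l.
  rewrite -ltnS -(@ltn_pmul2r C); last exact: leq_ltn_trans ltb.
  rewrite mulSn addnC; apply: leq_ltn_trans (leq_addr b' _) _.
  by apply: leq_ltn_trans le _; rewrite ltn_add2l.
move=> /lex[] // le1 imp1; have [le2 imp2] := lex _ _ _ _ _ (lecol M) le1.
by split=> // E1 E2; apply: imp1; rewrite E1 E2.
Qed.

Lemma ker_grid_map M : row_full M ->
  (25 * #|ker_add (grid_mapD M)| = 5 ^ n)%N.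
Proof.
move=> fM; rewrite -card_rV_F5 (card_ker (grid_mapD M)) ?card_rV_F5 // => u.
by exists (u *m pinvmx M); rewrite /grid_map mulmxKpV // submx_full.
Qed.

Lemma column_mulmx M (T : 'M_2) (s t : 'F_5) : s != 0 -> T 0 0 = s^-1 -> T 1 0 = 0 ->
  column A (M *m T) t = column A M (s * t).
Proof.
move=> s0 T0 T1; apply/setP=> a; rewrite !inE mulmxA [X in X == t]mxE; congr (_ && _).
rewrite !big_ord_recl big_ord0 addr0 T0 (_ : lift 0 0 = 1) ?T1 ?mulr0 ?addr0; last exact: val_inj.
by rewrite -(inj_eq (mulfI s0)) mulrCA divff // mulr1.
Qed.

Lemma extremal_of_max M : row_full M ->
    (3 * 5 ^ n < 125 * #|cell A M 1|)%N ->
    (forall M', row_full M' -> grid_key M' <= grid_key M)%N ->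
  extremal_grid (fun u => #|cell A M u|) #|ker_add (grid_mapD M)|.
Proof.
move=> fM large maxM; have cK := ker_grid_map fM.
have max T : T \in unitmx -> (grid_key (M *m T) <= grid_key M)%N.
  by move=> uT; apply/maxM/row_full_mulmx.
have [m cK5] := card_ker5 (grid_mapD M) (card_rV_F5 n).
have triple u v : coset_triple (ker_add (grid_mapD M)) (cell A M u) (cell A M v)
    (cell A M (cell_add u v)).
  by rewrite /cell cellv_add; apply: fiber_triple.
have c0 (X : {set 'rV['F_5]_n}) : (0 < #|X|)%N = (X != set0) by rewrite card_gt0.
split.
(* The kernel has N = 5^n / 25 points, so the bound on |A| reads 6 N < |A|; likewise the hypothesis
   on cell 1 reads 3 N < 5 |cell 1|. *)
- have := sum_card_cell A M (P := xpredT) (Q := xpredT) (fun _ _ => erefl).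
  rewrite (_ : [set a in A | _] = A) => [->|]; last by apply/setP=> a; rewrite inE andbT.
  by move: largeA; rewrite -cK; lia.
- by move: large; rewrite -cK; lia.
- by move=> u _; apply: le_card_fiber.
- move=> u /cell_to_first[T uT Tu]; have [+ _ _] := lex_max (max T uT).
  by rewrite (cell_mulmx A M uT Tu).
- move=> i i5; rewrite !card_column ?(andP i5).2 //.
  have i0 : (i%:R : 'F_5) != 0.
    case/andP: i5 => i0 i5; apply: contraTneq i0 => E.
    by rewrite (@F5_nat_inj i 0).
  (* Dividing the first coordinate by i turns column i into column 1 and fixes cell 1 = (0, 1). The
     first digit of the key ties, so the second one decides. *)
  pose T := mx2 (i%:R^-1) 0 0 1.
  have uT : T \in unitmx by apply: unit_mx2; rewrite mulr1 mulr0 subr0 invr_eq0.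
  have [_ + _] := lex_max (max T uT).
  rewrite (column_mulmx M 1 i0) ?mxE // mulr1; apply.
  rewrite (@cell_mulmx _ A M T 1 1) //.
  by apply: rV2P; rewrite ?mul_mx2_0 ?mul_mx2_1 !(cellv0, cellv1) ?mul0r ?mulr0 ?addr0 ?add0r ?mulr1.
- move=> u u25 u1; have k5 := ltn_pmod u (isT : 0 < 5)%N.
  (* A shear that moves (1, j) to (1, 0) while fixing cell 1 and column 1 as a whole; now the third
     digit of the key decides. *)
  pose T := mx2 1 (- (u %% 5)%:R) 0 1.
  have uT : T \in unitmx by apply: unit_mx2; rewrite mulr1 mulr0 subr0 oner_eq0.
  have [_ _] := lex_max (max T uT).
  rewrite (@cell_mulmx _ A M T u 5) //.
    apply.
      rewrite (@cell_mulmx _ A M T 1 1) //.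
      by apply: rV2P; rewrite ?mul_mx2_0 ?mul_mx2_1 !(cellv0, cellv1) ?mul0r ?mulr0 ?addr0 ?add0r ?mulr1.
    by rewrite (@column_mulmx M T 1 1) ?mulr1 // ?mxE ?invr1 ?oner_eq0.
  apply: rV2P; rewrite ?mul_mx2_0 ?mul_mx2_1 !(cellv0, cellv1) u1.
    by rewrite mulr1 mulr0 addr0.
  by rewrite mulr1 mul1r addrC subrr.
- move=> c d.
  pose h : 'cV['F_5]_2 := \col_k (if k == 0 then c%:R else d%:R).
  have hE (r : 'rV['F_5]_2) : (r *m h) 0 0 = r 0 0 * c%:R + r 0 1 * d%:R.
    rewrite !mxE !big_ord_recl big_ord0 addr0 !mxE /=.
    by congr (_ + r _ _ * _); apply: val_inj.
  rewrite (sum_card_cell A M (P := on_line c d) (Q := fun r => (r *m h) 0 0 == 1)).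
    rewrite (_ : [set a in A | _] = fiber (form (M *m h)) A 1); last first.
      by apply/setP=> a; rewrite !inE /form /grid_map mulmxA.
    (* A vanishing form, as for c = d = 0, never takes the value 1; for any other form a slice that
       is more than half full would make A normal. *)
    have [g0|g0] := eqVneq (M *m h) 0.
      rewrite (_ : fiber _ _ _ = set0) ?cards0 ?muln0 //.
      by apply/setP=> a; rewrite !inE g0 /form mulmx0 mxE andbF.
    rewrite leqNgt; apply/negP=> lt; apply: nnA.
    by apply: (normal_of_dense_slice sfA g0 largeA); rewrite -cK -[25%N]/(5 * 5)%N -[10%N]/(5 * 2)%N -!mulnA ltn_pmul2l.
  move=> u u25; rewrite hE cellv0 cellv1 -!natrM -natrD /on_line.
  rewrite (mulnC c) (mulnC d); set s := (_ + _)%N.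
  apply/eqP/eqP=> [E|E]; first by rewrite -F5_nat_mod E.
  by apply: F5_nat_inj; rewrite ?ltn_pmod // F5_nat_mod.
- move=> u v _ _; rewrite !c0; apply: card_coset_triple cK5 (triple u v).
move=> u v r a b _ _ + + + ab ler lta ltb; rewrite !c0 => U0 V0 W0.
have cN (X : {set 'rV['F_5]_n}) : #|[set - x | x in X]| = #|X|.
  exact: card_imset oppr_inj.
(* Rotations and swaps bring the two dense cells into the positions of the summands. Negating a cell
   on the way does not change its size. *)
move: ab lta ltb; rewrite !inE => /or3P[]/eqP[-> ->] ltX ltY.
- exact: (card_coset_triple_dense cK5 (triple u v) W0 ler).
- rewrite -(cN (cell A M u)) in ltX.
  have := card_coset_triple_dense cK5 (coset_tripleC (coset_triple_rot (triple u v)))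
    V0 ler ltX ltY.
  by rewrite cN addnAC.
rewrite -(cN (cell A M v)) in ltX.
have := card_coset_triple_dense cK5
  (coset_tripleC (coset_triple_rot (coset_tripleC (triple u v)))) U0 ler ltX ltY.
by rewrite cN addnC addnA.
Qed.

End LargestCell.

(** Coordinates maximising [grid_key] have a cell 1 at least as large as that of M, so for a
    non-normal A they would produce an extremal grid. *)
Lemma normal_of_dense_cell n (A : {set 'rV['F_5]_n}) (M : 'M_(n, 2)) :
    sum_free A -> (6 * 5 ^ n < 25 * #|A|)%N -> row_full M ->
    (3 * 5 ^ n < 125 * #|cell A M 1|)%N ->
  normal_form A.
Proof.
move=> sfA largeA fM largeM.
have [/existsP[g /forall_inP gA]|nn] :=
  boolP [exists g, [forall a in A, (form g a == 1) || (form g a == -1)]].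
  by exists g.
have nnA : ~ normal_form A.
  by case=> g gA; move/negP: nn; apply; apply/existsP; exists g; apply/forall_inP.
exfalso.
have [M' fM' maxM] := arg_maxnP (grid_key A) fM.
have fM'' : row_full M' := fM'.
apply: (no_extremal_grid (extremal_of_max sfA largeA nnA fM'' _ maxM)).
have [le _ _] := lex_max (maxM M fM).
by apply: leq_trans largeM _; rewrite leq_mul2l le orbT.
Qed.

(** * Sections by hyperplanes *)

Section Hyperplanes.

Definition section n (A : {set 'rV['F_5]_n}) (g : 'cV_n) : {set 'rV['F_5]_n} :=
  [set a in A | form g a == 0].

Lemma formDl n (a : 'rV['F_5]_n) : {morph (fun g => form g a) : g h / g + h}.
Proof. by move=> g h; rewrite /form mulmxDr mxE. Qed.

Lemma form_surjl n (a : 'rV['F_5]_n) : a != 0 -> forall t, exists g, form g a = t.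
Proof.
move=> /rV0Pn[j aj] t; exists ((t / a 0 j) *: delta_mx j 0).
by rewrite /form -scalemxAr mxE -colE mxE divfK.
Qed.

(** The rows of Q are a basis of the hyperplane, and R reads off coordinates in it; this turns a
    section of A into a subset of a space of one dimension less. *)
Lemma hyperplane_param m (g : 'cV['F_5]_m.+1) : g != 0 ->
  exists (Q : 'M_(m, m.+1)) (R : 'M_(m.+1, m)),
    [/\ Q *m R = 1%:M, Q *m g = 0 & forall a : 'rV_m.+1, a *m g = 0 -> a = a *m R *m Q].
Proof.
move=> g0; have rk : \rank (kermx g) = m.
  rewrite mxrank_ker -mxrank_tr rank_rV (_ : g^T != 0) ?subn1 //.
  by rewrite -(inj_eq trmx_inj) trmxK trmx0.
(* The number of rows of [row_base] is the rank itself; generalising it to k lets it be replaced by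
   m in the type of Q. *)
have base k : \rank (kermx g) = k ->
    exists2 Q : 'M['F_5]_(k, m.+1), row_free Q & (Q :=: kermx g)%MS.
  move=> <-; exists (row_base (kermx g)); first exact: row_base_free.
  exact: eq_row_base.
have [Q fQ eQ] := base m rk; have [R QR] := row_freeP fQ; exists Q, R; split=> //.
  by apply/sub_kermxP; rewrite eQ.
move=> a /sub_kermxP; rewrite -eQ => /submxP[D ->].
by rewrite -(mulmxA D Q R) QR mulmx1.
Qed.

Variables (m : nat) (A : {set 'rV['F_5]_m.+1}).
Hypothesis sfA : sum_free A.

Definition pull (Q : 'M_(m, m.+1)) : {set 'rV['F_5]_m} := [set b | b *m Q \in A].

Lemma sum_free_pull Q : sum_free (pull Q).
Proof.
apply/sum_freeP=> -[b [c [d [/[!inE] Ab Ac Ad bcd]]]].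
by have /sum_freeP[] := sfA; exists (b *m Q), (c *m Q), (d *m Q); rewrite -mulmxDl bcd.
Qed.

Lemma card_pull g Q (R : 'M_(m.+1, m)) : Q *m R = 1%:M -> Q *m g = 0 ->
    (forall a : 'rV_m.+1, a *m g = 0 -> a = a *m R *m Q) ->
  #|pull Q| = #|section A g|.
Proof.
move=> QR Qg aRQ; have injQ : injective (mulmx^~ Q : 'rV_m -> 'rV_m.+1).
  by move=> b c /(congr1 (mulmx^~ R)); rewrite -!mulmxA QR !mulmx1.
rewrite -(card_imset _ injQ); apply: eq_card => a; rewrite [in RHS]inE.
apply/imsetP/andP=> [[b /[!inE] Ab ->]|[Aa /eqP ga]].
  by rewrite Ab /form -mulmxA Qg mulmx0 mxE.
have {}ga : a *m g = 0 by apply/matrixP=> i j; rewrite !ord1 [RHS]mxE; apply: ga.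
by exists (a *m R); rewrite ?inE -aRQ.
Qed.

(** The section is normal, hence covered by two parallel cosets of codimension 2. The fuller one has
    more than 3/5 of the points of its coset, and in suitable coordinates it lies in cell 1. *)
Lemma normal_of_dense_hyperplane g :
    (forall B : {set 'rV['F_5]_m}, sum_free B -> (6 * 5 ^ m < 25 * #|B|)%N -> normal_form B) ->
    (6 * 5 ^ m.+1 < 25 * #|A|)%N -> g != 0 -> (6 * 5 ^ m < 25 * #|section A g|)%N ->
  normal_form A.
Proof.
move=> IH largeA g0 largeg; have [Q [R [QR Qg aRQ]]] := hyperplane_param g0.
have cB := card_pull QR Qg aRQ; rewrite -cB in largeg.
have [c cP] := IH _ (sum_free_pull Q) largeg.
pose F (s : 'F_5) := [set b in pull Q | form c b == s].
have sub : pull Q \subset F 1 :|: F (-1).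
  by apply/subsetP=> b Bb; apply/setUP; case/orP: (cP b Bb) => cb; [left|right]; rewrite inE Bb.
(* s = 1 or -1 is the level of the fuller half. As s is its own inverse, the form s c takes the
   value 1 there. *)
have [s s1 largeF] : exists2 s : 'F_5, s * s = 1 & (3 * 5 ^ m < 25 * #|F s|)%N.
  have := leq_trans (subset_leq_card sub) (leq_card_setU _ _).
  have [ltF _|leF le] := ltnP (3 * 5 ^ m) (25 * #|F 1%R|).
    by exists 1; rewrite ?mulr1.
  by exists (-1); rewrite ?mulrNN ?mulr1 //; lia.
(* Through R the form s c extends from the hyperplane to the whole space. In the coordinates (g, c')
   the set [F s] has image (0, 1), which is cell 1. *)
pose c' := R *m (s *: c); pose M : 'M['F_5]_(m.+1, 2) := \matrix_(i, k) (if k == 0 then g i 0 else c' i 0).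
have M0 a : (a *m M) 0 0 = form g a.
  by rewrite /form !mxE; apply: eq_bigr => i _; rewrite mxE.
have M1 a : (a *m M) 0 1 = form c' a.
  by rewrite /form !mxE; apply: eq_bigr => i _; rewrite mxE.
have /set0Pn[b0 /[!inE]/andP[_ /eqP b0c]] : F s != set0 by rewrite -card_gt0; lia.
have [w gw] := form_surj g0 1.
have Qg0 (b : 'rV_m) : form g (b *m Q) = 0 by rewrite /form -mulmxA Qg mulmx0 mxE.
have Qc' (b : 'rV_m) : form c' (b *m Q) = s * form c b.
  by rewrite /form /c' -mulmxA (mulmxA Q) QR mul1mx -scalemxAr mxE.
have fM : row_full M.
  rewrite -sub1mx; apply/row_subP=> i; set u := row i _; apply/submxP.
  (* w has first coordinate 1 and [b0 *m Q] has coordinates (0, 1), so the second coefficient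
     corrects for the second coordinate of w. *)
  exists (u 0 0 *: w + (u 0 1 - u 0 0 * form c' w) *: (b0 *m Q)).
  apply: rV2P; rewrite ?M0 ?M1 formD !formZ ?gw ?Qg0 ?Qc' ?b0c ?s1 !mulr1 ?mulr0 ?addr0 //.
  by rewrite addrC subrK.
apply: (normal_of_dense_cell sfA largeA fM).
rewrite expnS; suff : (#|F s| <= #|cell A M 1|)%N by lia.
have injQ : injective (mulmx^~ Q : 'rV_m -> 'rV_m.+1).
  by move=> b c0 /(congr1 (mulmx^~ R)); rewrite -!mulmxA QR !mulmx1.
rewrite -(card_imset _ injQ); apply: subset_leq_card; apply/subsetP=> _ /imsetP[b Fb ->].
move: Fb; rewrite !inE => /andP[-> /eqP cb] /=; apply/eqP/rV2P.
  by rewrite /grid_map M0 Qg0 cellv0.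
by rewrite /grid_map M1 Qc' cb s1 cellv1.
Qed.

End Hyperplanes.

(** * Sum-free sets in the plane *)

(** The six lines through the origin of the grid, without the origin: the first is spanned by (0,
    1), the others by (1, k). *)
Definition directions : seq (seq nat) :=
  [:: 1; 2; 3; 4] :: [seq [seq 5 * t + (t * k) %% 5 | t <- iota 1 4]%N | k <- iota 0 5].

Definition has_triple (s : seq nat) : bool :=
  has (fun u => has (fun v => cell_add u v \in s) s) s.

(** A depth-first search over all choices of one cell per direction, cut off as soon as the partial
    choice contains some u, v and u + v, where u = v is allowed. *)
Fixpoint transversals_have_triple (ds : seq (seq nat)) (s : seq nat) : bool :=
  has_triple s ||
  if ds is d :: ds' then all (fun u => transversals_have_triple ds' (u :: s)) d else false.

(** If P met all the directions, following its cells down the search would end in a triple inside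
    P. *)
Lemma transversal_missed (P : pred nat) ds s :
    (forall u v, P u -> P v -> ~~ P (cell_add u v)) ->
    transversals_have_triple ds s -> all P s -> has (fun d => all (predC P) d) ds.
Proof.
move=> Psf; elim: ds s => [|d ds IHds] s /= /orP[] //.
- case/hasP=> u su /hasP[v sv suv] /allP Ps.
  by have := Psf u v (Ps u su) (Ps v sv); rewrite (Ps _ suv).
- case/hasP=> u su /hasP[v sv suv] /allP Ps.
  by have := Psf u v (Ps u su) (Ps v sv); rewrite (Ps _ suv).
move=> /allP dall Ps; have [//|/allPn[u du /negPn Pu]] := boolP (all (predC P) d).
by rewrite (IHds (u :: s)) ?orbT ?dall //= Pu.
Qed.

(** The four alternatives are v = u, v = 2u, v = 3u (that is 2v = u, since 6 = 1 modulo 5) and v =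
    -u. All but the first are impossible in a sum-free set without opposite points. *)
Definition proportional (d : seq nat) : bool :=
  all (fun u => all (fun v => [|| u == v, cell_add u u == v, cell_add v v == u
                                | cell_add u v == 0%N]) d) d.

Lemma count_direction (P : pred nat) d : uniq d -> proportional d ->
    (forall u v, P u -> P v -> ~~ P (cell_add u v)) ->
    (forall u v, P u -> P v -> cell_add u v != 0)%N ->
  (count P d <= 1)%N.
Proof.
move=> ud /allP prop Psf Pas; rewrite -size_filter.
have uf : uniq (filter P d) by apply: filter_uniq.
case E: (filter P d) uf => [|u [|v s]] //= /andP[nuv _].
have /andP[Pu du] : P u && (u \in d) by rewrite -mem_filter E mem_head.
have /andP[Pv dv] : P v && (v \in d) by rewrite -mem_filter E !inE eqxx orbT.
have /allP/(_ v dv)/or4P[] := prop u du.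
- by move/eqP=> uv; rewrite uv mem_head in nuv.
- by move/eqP=> uv; have := Psf u u Pu Pu; rewrite uv Pv.
- by move/eqP=> uv; have := Psf v v Pv Pv; rewrite uv Pu.
- by rewrite (negPf (Pas u v Pu Pv)).
Qed.

Lemma sumn_lt_size (T : eqType) (F : T -> nat) (s : seq T) d :
    (forall e, e \in s -> F e <= 1)%N -> d \in s -> F d = 0%N ->
  (sumn [seq F e | e <- s] < size s)%N.
Proof.
move=> le1 sd Fd; rewrite sumnE big_map (big_rem d) //= Fd add0n.
have s0 : (0 < size s)%N by case: s sd {le1}.
rewrite -(prednK s0) ltnS -(size_rem sd) -sum1_size.
rewrite [leqLHS]big_seq_cond [leqRHS]big_seq_cond.
by apply: leq_sum => e /andP[/mem_rem/le1].
Qed.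

(* A plane sum-free set meeting each direction at most once misses one of the
   six directions. *)
Lemma card_sum_free_plane (B : {set 'rV['F_5]_2}) : sum_free B ->
  {in B, forall b, - b \notin B} -> (#|B| <= 5)%N.
Proof.
move=> sfB asB; pose P u := cellv u \in B.
have Psf u v : P u -> P v -> ~~ P (cell_add u v).
  move=> Pu Pv; apply/negP=> Puv; have /sum_freeP[] := sfB.
  by exists (cellv u), (cellv v), (cellv (cell_add u v)); rewrite -cellv_add.
have c00 : cellv 0 = 0 by apply: rV2P; rewrite ?cellv0 ?cellv1 mxE.
have P0 : ~~ P 0%N by apply/negP=> P0; have := Psf _ _ P0 P0; rewrite P0.
have Pas u v : P u -> P v -> (cell_add u v != 0)%N.
  move=> Pu Pv; apply/eqP=> uv; have := cellv_add u v; rewrite uv c00.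
  by move/esym/eqP; rewrite addr_eq0 => /eqP E; have := asB _ Pv; rewrite -E; apply/negP/negPn.
have -> : #|B| = count P (iota 0 25).
  have := sum_card_cell B 1%:M (P := xpredT) (Q := xpredT) (fun _ _ => erefl).
  rewrite (_ : [set a in B | _] = B) => [<-|]; last by apply/setP=> a; rewrite inE andbT.
  rewrite -sum1_count -[iota 0 25]/(index_iota 0 25) big_mkord big_mkcond [RHS]big_mkcond.
  apply: eq_bigr => u _; rewrite (_ : cell B 1%:M u = if P u then [set cellv u] else set0).
    by case: (P u); rewrite ?cards1 ?cards0.
  apply/setP=> a; rewrite !inE /grid_map mulmx1; case: ifP => Pu; rewrite !inE.
    by rewrite andbC; case: eqP => // ->; apply: Pu.
  by apply/negP=> /andP[Ba /eqP E]; rewrite /P -E Ba in Pu.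
(* The origin and the six directions partition the grid; the origin is not in B, each direction
   contributes at most one point, and one direction contributes none. *)
have /seq.permP-> : perm_eq (iota 0 25) (0%N :: flatten directions) by vm_compute.
rewrite -[count P _]/(P 0%N + count P (flatten directions))%N (negPf P0) add0n.
rewrite count_flatten.
have /hasP[d dir missed] : has (fun d => all (predC P) d) directions.
  by apply: (transversal_missed Psf) (_ : all P [::]) => //; vm_compute.
have le1 e : e \in directions -> (count P e <= 1)%N.
  move=> ee; apply: count_direction Psf Pas.
    by apply: (allP (_ : all uniq directions) e ee).
  by apply: (allP (_ : all proportional directions) e ee).
rewrite -ltnS; apply: (sumn_lt_size le1 dir).
by apply/eqP; rewrite -leqn0 leqNgt -has_count -all_predC.
Qed.

(** * Averaging over hyperplanes through the origin *)

Section Averaging.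

Variables (n : nat) (A : {set 'rV['F_5]_n}).
Hypothesis sfA : sum_free A.

Definition orth (a : 'rV['F_5]_n) : {set 'cV_n} := [set g | form g a == 0].

Lemma sum_free_neq0 a : a \in A -> a != 0.
Proof.
move=> Aa; apply: contraTneq Aa => ->; apply/negP=> A0; have /sum_freeP[] := sfA.
by exists 0, 0, 0; rewrite addr0.
Qed.

Lemma card_orth a : a != 0 -> (5 * #|orth a| = 5 ^ n)%N.
Proof.
move=> a0; have := card_ker (formDl a) (form_surjl a0).
by rewrite card_F5 card_mx card_F5 muln1 => ->; congr (_ * _)%N.
Qed.

Lemma card_orth2 a b : (5 ^ n <= 25 * #|orth a :&: orth b|)%N.
Proof.
pose f (g : 'cV['F_5]_n) : 'rV['F_5]_2 := \row_k form g (if k == 0 then a else b).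
have fD : {morph f : g h / g + h} by move=> g h; apply/rowP=> k; rewrite !mxE formDl.
have := card_ker_ge fD; rewrite card_rV_F5 card_mx card_F5 muln1 => le.
apply: leq_trans le _; rewrite leq_mul2l; apply/subset_leq_card/subsetP=> g.
rewrite !inE => /eqP/rowP fg; have := fg 0; have := fg 1.
by rewrite !mxE /= => -> ->.
Qed.

(** Double counting of the pairs (a, g) with g in S vanishing at a. *)
Lemma sum_card_section (S : {set 'cV_n}) :
  (\sum_(g in S) #|section A g| = \sum_(a in A) #|S :&: orth a|)%N.
Proof.
under eq_bigr do rewrite -sum1_card; under [RHS]eq_bigr do rewrite -sum1_card.
rewrite (exchange_big_dep (mem A)) /=; last by move=> g a _ /[!inE]/andP[].
by apply: eq_bigr => a Aa; apply: eq_bigl => g; rewrite !inE Aa.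
Qed.

(** The zero form is no hyperplane; its section is all of A, which accounts for the extra term
    |A|. *)
Lemma sum_card_section_le (S : {set 'cV_n}) c : 0 \in S ->
    (forall g, g != 0 -> (#|section A g| <= c)%N) ->
  (\sum_(g in S) #|section A g| <= #|A| + (#|S| - 1) * c)%N.
Proof.
move=> S0 lec; rewrite (bigD1 0) //=; apply: leq_add.
  by apply: subset_leq_card; apply/subsetP=> a /[!inE]/andP[].
rewrite (cardsD1 0 S) S0 add1n subn1 /= -sum_nat_const.
rewrite [leqRHS](eq_bigl (fun g => (g \in S) && (g != 0))); last by move=> g; rewrite !inE andbC.
by apply: leq_sum => g /andP[_ /lec].
Qed.

End Averaging.

(** Otherwise |A| (5^(m+3) - 1) <= 6 * 5^(m+1) (5^(m+4) - 1). With |A| at least 6 * 5^(m+2) + 1 the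
    left side is larger by at least 5^(m+1) - 1, which is positive; in dimension 3 the analogous
    difference is 0. *)
Lemma dense_hyperplane_ge4 m (A : {set 'rV['F_5]_m.+4}) : sum_free A ->
    (6 * 5 ^ m.+4 < 25 * #|A|)%N ->
  exists2 g : 'cV_m.+4, g != 0 & (6 * 5 ^ m.+3 < 25 * #|section A g|)%N.
Proof.
move=> sfA largeA; have [/exists_inP//|/exists_inPn none] :=
  boolP [exists (g : 'cV['F_5]_m.+4 | g != 0), (6 * 5 ^ m.+3 < 25 * #|section A g|)%N].
pose c := ((6 * 5 ^ m.+1))%N.
have lec g : g != 0 -> (#|section A g| <= c)%N.
  by move/none; rewrite -leqNgt /c !expnS => le; lia.
have := @sum_card_section_le _ A [set: 'cV_m.+4] c (in_setT 0) lec.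
rewrite sum_card_section (eq_bigr (fun=> 5 ^ m.+3)%N); last first.
  move=> a /(sum_free_neq0 sfA)/card_orth; rewrite setTI expnS => /eqP.
  by rewrite eqn_pmul2l // => /eqP.
rewrite sum_nat_const cardsT card_mx card_F5 muln1 /c.
have p0 : (0 < 5 ^ m)%N by rewrite expn_gt0.
move: largeA; rewrite !expnS => largeA le; exfalso.
(* The threshold 6 * 5^(m+4) / 25 is exactly 150 * 5^m, so integrality gives one whole extra
   point. *)
have ltx : (150 * 5 ^ m < #|A|)%N by lia.
move: le ltx p0; clear; move: (5 ^ m)%N #|A| => [//|q] x + /subnKC xE _.
rewrite -xE; move: (x - _)%N => y; nia.
Qed.

(** Only the 25 forms vanishing at a fixed point a of A are averaged: they all vanish at a, and at
    least 5 of them vanish at any given other point. *)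
Lemma dense_plane (A : {set 'rV['F_5]_3}) : sum_free A -> (30 < #|A|)%N ->
  exists2 g : 'cV_3, g != 0 & (6 < #|section A g|)%N.
Proof.
move=> sfA largeA; have [/exists_inP//|/exists_inPn none] :=
  boolP [exists (g : 'cV['F_5]_3 | g != 0), (6 < #|section A g|)%N].
have le6 g : g != 0 -> (#|section A g| <= 6)%N by move/none; rewrite -leqNgt.
have S0 (a : 'rV['F_5]_3) : 0 \in orth a by rewrite inE /form mulmx0 mxE.
have cS (a : 'rV['F_5]_3) : a \in A -> #|orth a| = 25%N.
  by move=> /(sum_free_neq0 sfA)/card_orth; lia.
have ge5 (a b : 'rV['F_5]_3) : (5 <= #|orth a :&: orth b|)%N.
  by have := card_orth2 a b; rewrite -[(5 ^ 3)%N]/(25 * 5)%N leq_pmul2l.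
(* If -a is in A, all 25 forms vanish at it too, and 50 + 5 (|A| - 2) <= |A| + 24 * 6 fails for |A|
   > 30. *)
have [/exists_inP[a Aa Ana]|/exists_inPn asA] := boolP [exists a in A, - a \in A].
  have := sum_card_section_le (S0 a) le6; rewrite sum_card_section cS //.
  have ana : - a != a.
    by rewrite eq_sym -subr_eq0 opprK -mulr2n -scaler_nat scaler_eq0 negb_or (sum_free_neq0 sfA Aa).
  rewrite (bigD1 a) //= setIid (bigD1 (- a)) /=; last by rewrite Ana.
  have -> : orth (- a) = orth a.
    by apply/setP=> g; rewrite !inE /form mulNmx mxE oppr_eq0.
  rewrite setIid cS //.
  have : (\sum_(b in A :\ a :\ - a) 5
    <= \sum_(b | (b \in A) && (b != a) && (b != - a)) #|orth a :&: orth b|)%N.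
    rewrite [leqLHS](eq_bigl (fun b => (b \in A) && (b != a) && (b != - a))).
      by apply: leq_sum => b _; apply: ge5.
    by move=> b; rewrite !inE; case: (b \in A); case: (b == a); case: (b == - a).
  rewrite sum_nat_const; have := cardsD1 a A; have := cardsD1 (- a) (A :\ a).
  rewrite !inE Aa Ana ana /= !add1n => cA1 cA.
  move=> les /(leq_trans (leq_add (leqnn 25) (leq_add (leqnn 25) les))).
  move: largeA; rewrite cA cA1; clear; move: #|_| => x lt le; exfalso; lia.
(* Without opposite points the plane bound applies to every section, and 25 + 5 (|A| - 1) <= |A| +
   24 * 5 fails; with 6 in place of 5 it would hold with equality at |A| = 31. *)
have le5 g : g != 0 -> (#|section A g| <= 5)%N.
  move=> g0; have [Q [R [QR Qg aRQ]]] := hyperplane_param g0.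
  rewrite -(card_pull A QR Qg aRQ); apply: card_sum_free_plane.
    exact: sum_free_pull.
  by move=> b /[!inE] Ab; rewrite mulNmx; apply: asA.
have /set0Pn[a Aa] : A != set0 by rewrite -card_gt0; lia.
have := sum_card_section_le (S0 a) le5; rewrite sum_card_section cS //.
rewrite (bigD1 a) //= setIid cS //.
have : (\sum_(b in A :\ a) 5 <= \sum_(b in A | b != a) #|orth a :&: orth b|)%N.
  rewrite [leqLHS](eq_bigl (fun b => (b \in A) && (b != a))).
    by apply: leq_sum => b _; apply: ge5.
  by move=> b; rewrite !inE andbC.
rewrite sum_nat_const; have := cardsD1 a A; rewrite Aa add1n => cA.
move=> les /(leq_trans (leq_add (leqnn 25) les)).
by move: largeA; rewrite cA; clear; move: #|_| => x lt le; exfalso; lia.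
Qed.

(** * Induction on the dimension *)

Lemma normal_form_of_large n (A : {set 'rV['F_5]_n}) : sum_free A ->
  (6 * 5 ^ n < 25 * #|A|)%N -> normal_form A.
Proof.
elim: n A => [|n IHn] A sfA largeA.
  have /set0Pn[a Aa] : A != set0 by rewrite -card_gt0; lia.
  by have := sum_free_neq0 sfA Aa; rewrite (_ : a = 0) ?eqxx //; apply/rowP=> -[].
have /set0Pn[a Aa] : A != set0 by rewrite -card_gt0; lia.
have a0 := sum_free_neq0 sfA Aa.
case: n IHn A sfA largeA a Aa a0 => [|[|[|n]]] IHn A sfA largeA a Aa a0.
(* In dimension 1 a slice is a single point, so one point of A fills it: 5 < 10 * 1. *)
- have [g ga] := form_surjl a0 1.
  apply: (normal_of_dense_slice sfA (g := g)) => //.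
    by apply: contra_eq_neq ga => ->; rewrite /form mulmx0 mxE eq_sym oner_eq0.
  have : (0 < #|fiber (form g) A 1%R|)%N by rewrite card_gt0; apply/set0Pn; exists a; rewrite inE Aa ga /=.
  by lia.
(* In dimension 2 the cells are single points, and one point of A makes a dense cell: 3 * 25 < 125 *
   1. *)
- have u0 : (0 < cell_index a < 25)%N.
    rewrite ltn_ord andbT lt0n; apply: contra a0 => /eqP E.
    by rewrite -(cell_indexK a) E; apply/eqP/rV2P; rewrite ?cellv0 ?cellv1 mxE.
  have [T uT aT] := cell_to_first u0; rewrite cell_indexK in aT.
  apply: (normal_of_dense_cell sfA largeA (M := T)); first by rewrite row_full_unit.
  have : (0 < #|cell A T 1|)%N by rewrite card_gt0; apply/set0Pn; exists a; rewrite inE Aa /grid_map aT /=.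
  by lia.
- have [||g g0 lg] := @dense_plane A => //; first by lia.
  by apply: (normal_of_dense_hyperplane sfA IHn largeA g0); lia.
have [g g0 lg] := dense_hyperplane_ge4 sfA largeA.
exact: (normal_of_dense_hyperplane sfA IHn largeA g0).
Qed.

Theorem theorem1p4 (n : nat) (hn : (1 <= n)%N) (A : {set 'rV['F_5]_n})
    (hA : sum_free A)
    (hcard : 1.2%Q * 5 ^+ (n - 1) < #|A|%:R) :
  normal_set 5 A.
Proof.
(* Multiplying by 25 clears the decimal, as 25 * 1.2 = 6 * 5, and turns the exponent n - 1 into
   n. *)
have large : (6 * 5 ^ n < 25 * #|A|)%N.
  have exp_pred : 5%:R ^+ n = 5 ^+ (n - 1) * 5 :> rat by rewrite -exprSr subn1 prednK.
  have six_fifths : 1.2%Q = 6 / 5 by apply/eqP.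
  move: hcard; rewrite six_fifths -(ltr_nat rat) !natrM natrX exp_pred.
  move: (5 ^+ _) (#|A|%:R) => x y; lra.
apply: normal_set_of_form => //; first by rewrite -card_gt0; lia.
exact: normal_form_of_large.
Qed.
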